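(* Let $G$ be a Lie group, let $X$ be a smooth manifold on which $G$ acts smoothly and properly, and let $V$ be a differentiable $G$-module. Then $$H^r_d\left(G,C^\infty(X,V)\right)=H^r\left(G,C^\infty(X,V)\right)=\{0\},\quad r\geq 1.$$
   Context: A continuous $G$-module is a Hausdorff locally convex topological real vector space $V$ with a continuous linear action of $G$. A differentiable $G$-module is a continuous $G$-module $V$ which is quasi-complete (all closed bounded subsets are complete) and such that (1) for all $v\in V$ the orbit map $o_v:G\to V$, $g\mapsto g\cdot v$, is smooth, and (2) the map $V\to C^\infty(G,V)$, $v\mapsto o_v$, is smooth. $C^\infty(X,V)$ is the space of smooth maps with the $C^\infty$-topology and the $G$-action $(\alpha\cdot f)(x)=\alpha\cdot(f(\alpha^{-1}\cdot x))$; it is a differentiable $G$-module. For a continuous $G$-module $W$, the continuous cohomology $H^r(G,W)$ is the cohomology of the complex of continuous inhomogeneous cochains $C(G^r,W)$ (continuous maps) with $\partial^0(w)(\alpha)=\alpha\cdot w-w$ and $$\partial^r\lambda(\alpha_1,\dots,\alpha_{r+1})=\alpha_1\cdot\lambda(\alpha_2,\dots,\alpha_{r+1})+\sum_{i=1}^r(-1)^i\lambda(\alpha_1,\dots,\alpha_i\alpha_{i+1},\dots,\alpha_{r+1})+(-1)^{r+1}\lambda(\alpha_1,\dots,\alpha_r).$$ For a differentiable $G$-module $W$, $H^r_d(G,W)$ is the cohomology of the subcomplex of smooth cochains $C^\infty(G^r,W)$. *)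

(* Defs.v *)
From HB Require Import structures.
From mathcomp Require Import all_boot all_order all_algebra.
From mathcomp Require Import boolp classical_sets functions cardinality.
From mathcomp Require Import interval_inference reals topology tvs normedtype convex.
From mathcomp Require Import ring lra.
Import Order.TTheory GRing.Theory Num.Theory.
Import numFieldNormedType.Exports.
Set Implicit Arguments. Unset Strict Implicit. Unset Printing Implicit Defensive.
Local Open Scope classical_set_scope.
Local Open Scope ring_scope.

Section DirectionalDerivative.
Context {R : realType} {E F : tvsType R}.
Implicit Types (f : E -> F) (x v : E).

Definition is_dderive f x v (l : F) : Prop :=
  (fun h : R => h^-1 *: (f (x + h *: v) - f x)) @ (0 : R)^' --> l.

(* The directional derivative as a total function, 0 where it does not exist;
   it is only used with Hausdorff codomain, where the limit is unique. *)
Definition dderive f x v : F := xget 0 [set l | is_dderive f x v l].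

End DirectionalDerivative.

(* C^k maps on an open subset U of a locally convex space in the sense of
   Michal and Bastiani: f is C^(k+1) when it is continuous, all its directional
   derivatives exist on U, and (x, v) |-> df(x)(v) is C^k on U x E. For
   finite-dimensional E this is the usual notion of C^k map. *)
Fixpoint diff_class {R : realType} (k : nat) (E F : tvsType R)
    (U : set E) (f : E -> F) {struct k} : Prop :=
  (forall x, U x -> {for x, continuous f}) /\
  if k is j.+1 then
    exists df : E * E -> F,
      (forall x v, U x -> is_dderive f x v (df (x, v))) /\
      diff_class j (U `*` setT) df
  else True.

Definition smooth_on {R : realType} (E F : tvsType R) (U : set E) (f : E -> F) :=
  forall k, diff_class k U f.

Section Calculus.
Context {R : realType}.

Lemma add_cvg (T : Type) (G : set_system T) (FG : Filter G) (F : tvsType R)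
  (f g : T -> F) (a b : F) : f @ G --> a -> g @ G --> b -> (fun x => f x + g x) @ G --> a + b.
Proof.
move=> fa gb.
apply: (@cvg_comp _ _ _ (fun x => (f x, g x)) (fun p : F * F => p.1 + p.2) G (nbhs (a, b))).
  exact: cvg_pair.
exact: (add_continuous (a, b)).
Qed.

Lemma scale_cvg (T : Type) (G : set_system T) (FG : Filter G) (F : tvsType R)
  (s : T -> R) (g : T -> F) (a : R) (b : F) :
  s @ G --> a -> g @ G --> b -> (fun x => s x *: g x) @ G --> a *: b.
Proof.
move=> fa gb.
apply: (@cvg_comp _ _ _ (fun x => (s x, g x)) (fun p : R^o * F => p.1 *: p.2) G (nbhs ((a : R^o), b))).
  exact: (cvg_pair fa gb).
exact: (scale_continuous ((a : R^o), b)).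
Qed.

Lemma opp_cvg (T : Type) (G : set_system T) (FG : Filter G) (F : tvsType R)
  (g : T -> F) (b : F) : g @ G --> b -> (fun x => - g x) @ G --> - b.
Proof.
move=> gb; apply: (@cvg_comp _ _ _ g (fun x : F => - x) G (nbhs b)) => //.
exact: opp_continuous.
Qed.

Lemma diff_classW k (E F : tvsType R) U (f : E -> F) :
  diff_class k.+1 U f -> diff_class k U f.
Proof.
elim: k E U f => [|k IH] E U f; first by case.
move=> [cf [df [dfP dfk]]]; split=> //; exists df; split => //.
exact: IH.
Qed.

Lemma diff_class_cont k (E F : tvsType R) U (f : E -> F) :
  diff_class k U f -> forall x, U x -> {for x, continuous f}.
Proof. by case: k => [|k] []. Qed.

Lemma diff_class_sub k (E F : tvsType R) (U U' : set E) (f : E -> F) :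
  U' `<=` U -> diff_class k U f -> diff_class k U' f.
Proof.
elim: k E U U' f => [|k IH] E U U' f sU; first by case=> cf _; split => // x /sU /cf.
move=> [cf [df [dfP dfk]]]; split; first by move=> x /sU /cf.
exists df; split; first by move=> x v /sU /dfP; apply.
by apply: IH dfk => -[x v] [] /= /sU.
Qed.

Lemma is_dderive_lin (E F : tvsType R) a (f g : E -> F) x v l m :
  is_dderive f x v l -> is_dderive g x v m ->
  is_dderive (fun y => a *: f y + g y) x v (a *: l + m).
Proof.
move=> fl gm; rewrite /is_dderive.
under eq_fun => h.
  have -> : h^-1 *: (a *: f (x + h *: v) + g (x + h *: v) - (a *: f x + g x)) =
     a *: (h^-1 *: (f (x + h *: v) - f x)) + h^-1 *: (g (x + h *: v) - g x).
    by rewrite scalerA mulrC -scalerA -scalerDr; congr (_ *: _); rewrite scalerBr opprD addrACA.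
  over.
apply: add_cvg => //; apply: scale_cvg => //; exact: cvg_cst.
Qed.

Lemma diff_class_lin k (E F : tvsType R) U a (f g : E -> F) :
  diff_class k U f -> diff_class k U g ->
  diff_class k U (fun x => a *: f x + g x).
Proof.
have C (E' : tvsType R) (U' : set E') (f' g' : E' -> F) : (forall x, U' x -> {for x, continuous f'}) ->
   (forall x, U' x -> {for x, continuous g'}) ->
   (forall x, U' x -> {for x, continuous (fun x => a *: f' x + g' x)}).
  move=> cf cg x Ux; apply: add_cvg (cg _ Ux).
  by apply: scale_cvg (cf _ Ux); exact: cvg_cst.
elim: k E U f g => [|k IH] E U f g; first by move=> [cf _] [cg _]; split => //; exact: C.
move=> [cf [df [dfP dfk]]] [cg [dg [dgP dgk]]]; split; first exact: C.
exists (fun p => a *: df p + dg p); split; last exact: IH.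
by move=> x v Ux; apply: is_dderive_lin; [exact: dfP|exact: dgP].
Qed.

Lemma line_cvg (E : tvsType R) (x v : E) :
  (fun h : R => x + h *: v) @ (0 : R) --> x.
Proof.
rewrite -[X in _ --> X]addr0 -[X in _ --> _ + X](scale0r v).
apply: add_cvg; first exact: cvg_cst.
by apply: scale_cvg; [exact: cvg_id|exact: cvg_cst].
Qed.

Lemma is_dderive_eq (E F : tvsType R) (U : set E) (f g : E -> F) x v l :
  open U -> U x -> (forall y, U y -> f y = g y) ->
  is_dderive f x v l -> is_dderive g x v l.
Proof.
move=> oU Ux fg; apply: cvg_trans; apply: near_eq_cvg.
have : \forall h \near 0^', U (x + h *: v).
  by have /nbhs_dnbhs := @line_cvg _ x v U (open_nbhs_nbhs (conj oU Ux)).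
by apply: filterS => h Uh; rewrite fg// (fg x).
Qed.

Lemma for_cont_eq (E F : topologicalType) (U : set E) (f g : E -> F) x :
  open U -> U x -> (forall y, U y -> f y = g y) ->
  {for x, continuous f} -> {for x, continuous g}.
Proof.
move=> oU Ux fg cf; change (g @ x --> g x); rewrite -(fg x Ux).
apply: cvg_trans cf; apply: near_eq_cvg.
have : nbhs x U by apply: open_nbhs_nbhs.
by apply: filterS.
Qed.

Lemma diff_class_eq k (E F : tvsType R) (U : set E) (f g : E -> F) :
  open U -> (forall y, U y -> f y = g y) -> diff_class k U f -> diff_class k U g.
Proof.
move=> oU fg; case: k => [|k].
  by move=> [cf _]; split => // x Ux; exact: (for_cont_eq oU Ux fg (cf _ Ux)).
move=> [cf [df [dfP dfk]]]; split.
  by move=> x Ux; exact: (for_cont_eq oU Ux fg (cf _ Ux)).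
exists df; split => // x v Ux; exact: (is_dderive_eq oU Ux fg (dfP x v Ux)).
Qed.

Lemma diff_class_linear k (E F : tvsType R) (U : set E) (L : E -> F) :
  linear L -> continuous L -> diff_class k U L.
Proof.
elim: k E U L => [|k IH] E U L lL cL; first by split => // x _; exact: cL.
split; first by move=> x _; exact: cL.
exists (fun p => L p.2); split.
  move=> x v _; rewrite /is_dderive /=.
  apply: (@cvg_trans _ ((fun _ : R => L v) @ (0:R)^')); last exact: cvg_cst.
  apply: near_eq_cvg; apply: filterS (nbhs_dnbhs_neq (0:R)) => h h0 /=.
  by rewrite [x + _]addrC lL addrK scalerA mulVf// scale1r.
apply: IH; first by move=> a [x v] [y w] /=; exact: lL.
move=> p; apply: (@continuous_comp _ _ _ snd L); last exact: cL.
exact: cvg_snd.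
Qed.

Lemma diff_class_cst k (E F : tvsType R) (U : set E) (a : F) :
  diff_class k U (fun _ : E => a).
Proof.
elim: k E U a => [|k IH] E U a; first by split => // x _; exact: cvg_cst.
split; first by move=> x _; exact: cvg_cst.
exists (fun _ => 0); split; last exact: IH.
move=> x v _; rewrite /is_dderive.
under eq_fun do rewrite subrr scaler0.
exact: cvg_cst.
Qed.

Lemma is_dderive_pair (E F F' : tvsType R) (f : E -> F) (g : E -> F') x v l m :
  is_dderive f x v l -> is_dderive g x v m ->
  is_dderive (fun y => (f y, g y)) x v (l, m).
Proof. by move=> fl gm; exact: cvg_pair fl gm. Qed.

Lemma diff_class_pair k (E F F' : tvsType R) U (f : E -> F) (g : E -> F') :
  diff_class k U f -> diff_class k U g ->
  diff_class k U (fun x => (f x, g x)).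
Proof.
elim: k E U f g => [|k IH] E U f g.
  by move=> [cf _] [cg _]; split => // x Ux; apply: cvg_pair; [exact: cf|exact: cg].
move=> [cf [df [dfP dfk]]] [cg [dg [dgP dgk]]]; split.
  by move=> x Ux; apply: cvg_pair; [exact: cf|exact: cg].
exists (fun p => (df p, dg p)); split; last exact: IH.
by move=> x v Ux; apply: is_dderive_pair; [exact: dfP|exact: dgP].
Qed.

Lemma convex_nbhs (F : tvsType R) (x : F) (A : set F) : nbhs x A ->
  exists C : set F, [/\ open C, C x, C `<=` A &
    forall y z t, C y -> C z -> 0 <= t <= 1 -> C (t *: y + (1 - t) *: z)].
Proof.
move=> xA; have [B Bc [Bo Bb]] := @locally_convex R F.
have [C [BC Cx] CA] := Bb x A xA.
exists C; split => //; first exact: Bo.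
move=> y z t Cy Cz /andP[t0 t1].
have := Bc C; rewrite inE => /(_ BC) /(_ y z (Itv01 t0 t1)).
by rewrite !inE => /(_ Cy Cz).
Qed.

Lemma mean_value (F : tvsType R) (c c' : R -> F) (C : set F) :
  open C -> (forall y z t, C y -> C z -> 0 <= t <= 1 -> C (t *: y + (1 - t) *: z)) ->
  (forall s, 0 <= s <= 1 -> C (c' s)) ->
  (forall s, 0 <= s <= 1 -> (fun h => h^-1 *: (c (s + h) - c s)) @ (0:R)^' --> c' s) ->
  C (c 1 - c 0).
Proof.
move=> oC cC Cc' dc.
have loc s : 0 <= s <= 1 -> exists2 e : R, 0 < e &
    forall h, `|h| < e -> h != 0 -> C (h^-1 *: (c (s + h) - c s)).
  move=> s01; have := dc s s01 C; rewrite /= => /(_ (open_nbhs_nbhs (conj oC (Cc' _ s01)))).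
  move=> /nbhs_ballP[e e0 eP]; exists e => // h he h0; apply: eP => //=.
  by rewrite /ball /= sub0r normrN.
pose S := [set t : R | 0 <= t <= 1 /\ (t = 0 \/ C (t^-1 *: (c t - c 0)))].
have glue t b : S t -> t < b -> b <= 1 -> C ((b - t)^-1 *: (c b - c t)) -> S b.
  move=> [/andP[t0 t1] St] tb b1 Cb.
  have b0 : 0 < b by exact: le_lt_trans tb.
  split; first by rewrite (ltW b0).
  right; case: St => [t00|Ct]; first by move: Cb; rewrite t00 subr0.
  have [t00|tn0] := eqVneq t 0; first by move: Cb; rewrite t00 subr0.
  have -> : b^-1 *: (c b - c 0) = (t / b) *: (t^-1 *: (c t - c 0)) +
     (1 - t / b) *: ((b - t)^-1 *: (c b - c t)).
    rewrite !scalerA.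
    have -> : t / b / t = b^-1 by rewrite mulrAC divff// mul1r.
    have -> : (1 - t / b) / (b - t) = b^-1.
      by field; rewrite subr_eq0 gt_eqF//= gt_eqF.
    by rewrite -scalerDr; congr (_ *: _); rewrite [RHS]addrC addrA subrK.
  apply: cC => //; rewrite divr_ge0// ?(ltW b0)//=.
  by rewrite ler_pdivrMr// mul1r ltW.
have S0 : S 0 by split; [rewrite lexx ler01|left].
have hS : has_sup S.
  by split; [exists 0|exists 1 => t [/andP[]]].
pose T := sup S.
have T0 : 0 <= T by apply: ub_le_sup => //; case: hS.
have T1 : T <= 1 by apply: ge_sup; [exists 0|move=> t [/andP[]]].
have [|e e0 eP] := loc T; first by rewrite T0.
have ST : S T.
  have [t St tT] := sup_adherent e0 hS.
  have tT' : t <= T by apply: ub_le_sup => //; case: hS.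
  have [<-//|tnT] := eqVneq t T.
  apply: (glue t) => //; first by rewrite lt_neqAle tnT.
  have := eP (t - T); rewrite subr_eq0 => /(_ _ tnT).
  rewrite distrC ger0_norm ?subr_ge0// ltrBlDr => /(_ _).
  rewrite -ltrBlDl => /(_ tT).
  have -> : T + (t - T) = t by ring.
  by rewrite -[t - T]opprB invrN scaleNr -scalerN opprB.
have [TE|Tn1] := eqVneq T 1.
  case: ST => _ []; first by rewrite TE => /eqP; rewrite oner_eq0.
  by rewrite TE invr1 scale1r.
have Tlt : T < 1 by rewrite lt_neqAle Tn1.
pose b := T + Num.min (1 - T) (e / 2).
have mp : 0 < Num.min (1 - T) (e / 2) by rewrite lt_min subr_gt0 Tlt divr_gt0.
have Sb : S b.
  apply: (glue T) => //; first by rewrite ltrDl.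
    by rewrite /b -lerBrDl ge_min lexx.
  rewrite {1}/b [T + _]addrC addrK; apply: eP; last by rewrite gt_eqF.
  by rewrite gtr0_norm// gt_min [e / 2 < e]ltr_pdivrMr// ltr_pMr// ltr1n orbT.
have : b <= T by apply: ub_le_sup => //; case: hS.
by rewrite leNgt /b ltrDl mp.
Qed.

Lemma diff_quot_cvg (E F : tvsType R) (U : set E) (f : E -> F) df x v :
  open U -> U x -> (forall x v, U x -> is_dderive f x v (df (x, v))) ->
  {for (x, v), continuous df} ->
  (fun p : R * E => p.1^-1 *: (f (x + p.1 *: p.2) - f x)) @
     filter_prod (0:R)^' (nbhs v) --> df (x, v).
Proof.
move=> oU Ux dfP cdf A Adf.
have [C [oC Cx CA cC]] := convex_nbhs Adf.
have := cdf C (open_nbhs_nbhs (conj oC Cx)).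
move=> [[U1 W] /= [U1x Wv] U1W].
have : (fun p : R * E => x + p.1 *: p.2) @ (0:R, v) --> x.
  rewrite -[X in _ --> X]addr0 -[X in _ --> _ + X](scale0r v).
  apply: add_cvg; first exact: cvg_cst.
  by apply: scale_cvg; [exact: cvg_fst|exact: cvg_snd].
have UU1 : nbhs x (U `&` U1) by apply: filterI => //; apply: open_nbhs_nbhs.
move=> /(_ _ UU1) [[D W'] /= [D0 W'v] DW'].
case/nbhs_ballP: D0 => e /= e0 eD.
exists ([set h | `|h| < e /\ h != 0], W `&` W') => /=.
  split; last exact: filterI.
  apply/nbhs_ballP; exists e => //= h; rewrite /ball /= sub0r normrN => he h0.
  by split.
move=> [h w] /= [[he h0] [Ww W'w]]; apply: CA.
have near_line s : 0 <= s <= 1 -> (U `&` U1) (x + (s * h) *: w).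
  move=> /andP[s0 s1]; apply: (DW' (s * h, w)); split => //; apply: eD.
  rewrite /ball /= sub0r normrN normrM ger0_norm//.
  by apply: le_lt_trans he; rewrite ler_piMl.
have := @mean_value F (fun s => h^-1 *: f (x + (s * h) *: w))
  (fun s => df (x + (s * h) *: w, w)) C oC cC.
rewrite /= mul1r mul0r scale0r addr0 -scalerBr; apply.
  by move=> s /near_line[_ U1s]; apply: (U1W (_, _)).
move=> s /near_line[Us _].
have := dfP _ w Us; rewrite /is_dderive => H.
have K : (fun k : R => k * h) @ (0:R)^' --> (0:R)^'.
  move=> B /nbhs_ballP[d /= d0 dB]; apply/nbhs_ballP.
  exists (d / `|h|); first by rewrite /= divr_gt0// normr_gt0.
  move=> k; rewrite /ball /= sub0r normrN ltr_pdivlMr ?normr_gt0// -normrM => kd k0.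
  apply: dB; first by rewrite /ball /= sub0r normrN.
  by rewrite mulf_neq0.
have := cvg_comp _ _ K H; apply: cvg_trans; apply: near_eq_cvg.
apply: filterS (nbhs_dnbhs_neq (0:R)) => k k0 /=.
rewrite -scalerBr scalerA invfM; congr (_ *: (f _ - _)).
by rewrite mulrDl scalerDl addrA.
Qed.

Lemma is_dderive_comp (E F H : tvsType R) (U : set F) (f : E -> F) (g : F -> H) dg x v l :
  open U -> U (f x) -> (forall x v, U x -> is_dderive g x v (dg (x, v))) ->
  {for (f x, l), continuous dg} -> is_dderive f x v l ->
  is_dderive (g \o f) x v (dg (f x, l)).
Proof.
move=> oU Ufx dgP cdg fl.
have := diff_quot_cvg oU Ufx dgP cdg.
have P : (fun h : R => (h, h^-1 *: (f (x + h *: v) - f x))) @ (0:R)^' -->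
    filter_prod (0:R)^' (nbhs l) by exact: cvg_pair cvg_id fl.
move=> /(cvg_comp _ _ P); apply: cvg_trans; apply: near_eq_cvg.
apply: filterS (nbhs_dnbhs_neq (0:R)) => h h0 /=.
by rewrite scalerA divff// scale1r [f x + _]addrC subrK.
Qed.

Lemma diff_class_comp_linear k (E F H : tvsType R) (U : set F) (L : E -> F) (f : F -> H) :
  linear L -> continuous L -> diff_class k U f -> diff_class k (L @^-1` U) (f \o L).
Proof.
elim: k E F U L f => [|k IH] E F U L f lL cL [cf kf].
  by split => // x Ux; apply: continuous_comp; [exact: cL|exact: cf].
have [df [dfP dfk]] := kf; split.
  by move=> x Ux; apply: continuous_comp; [exact: cL|exact: cf].
exists (df \o (fun p => (L p.1, L p.2))); split.
  move=> x v Ux; have := dfP _ (L v) Ux; apply: cvg_trans; apply: near_eq_cvg.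
  by apply: nearW => h /=; rewrite [x + _]addrC lL [_ + L x]addrC.
have := IH _ _ _ (fun p => (L p.1, L p.2)) df _ _ dfk; apply.
  by move=> a [x v] [y w] /=; rewrite !lL.
move=> p; apply: cvg_pair.
  by apply: (@continuous_comp _ _ _ fst L); [exact: cvg_fst|exact: cL].
by apply: (@continuous_comp _ _ _ snd L); [exact: cvg_snd|exact: cL].
Qed.

Lemma diff_class_comp k (E F H : tvsType R) (U : set E) (U' : set F)
   (f : E -> F) (g : F -> H) :
  open U' -> (forall x, U x -> U' (f x)) ->
  diff_class k U f -> diff_class k U' g -> diff_class k U (g \o f).
Proof.
elim: k E F H U U' f g => [|k IH] E F H U U' f g oU' fU.
  move=> [cf _] [cg _]; split => // x Ux.
  by apply: continuous_comp; [exact: cf|apply: cg; exact: fU].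
move=> fk gk; have [cf [df [dfP dfk]]] := fk; have [cg [dg [dgP dgk]]] := gk.
split.
  by move=> x Ux; apply: continuous_comp; [exact: cf|apply: cg; exact: fU].
pose Tf := fun p : E * E => (f p.1, df p).
exists (dg \o Tf); split.
  move=> x v Ux; apply: (is_dderive_comp oU') => //; first exact: fU.
    apply: (diff_class_cont dgk); split => //=; exact: fU.
  exact: dfP.
apply: (IH _ _ _ _ (U' `*` setT)) => //.
- rewrite openE => -[y w] [/= Uy _]; exists (U', setT) => //=.
  by split; [exact: open_nbhs_nbhs|exact: filterT].
- by move=> [x v] [/= /fU].
apply: diff_class_pair => //.
apply: (diff_class_sub (U := fst @^-1` U)); first by move=> [x v] [].
apply: (@diff_class_comp_linear k _ _ _ U fst f) => //; last exact: diff_classW.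
by move=> p; exact: cvg_fst.
Qed.
End Calculus.

(* [tvsType] is the library's locally convex topological vector space; it is not
   required to be Hausdorff. *)
HB.mixin Record Tvs_isHausdorff (R : numDomainType) E of Tvs R E := {
  tvs_hausdorff : hausdorff_space E
}.

#[short(type="lcsType")]
HB.structure Definition HausdorffTvs (R : numDomainType) :=
  {E of Tvs R E & Tvs_isHausdorff R E}.

Section IteratedDerivative.
Context {R : realType}.

(* D_v1 (D_v2 (... f)) for s = [:: v1; v2; ...] *)
Definition iter_dderive (E F : tvsType R) (s : seq E) (f : E -> F) : E -> F :=
  foldr (fun v g x => dderive g x v) f s.

Lemma dderiveE (E : tvsType R) (F : lcsType R) (f : E -> F) x v l :
  is_dderive f x v l -> dderive f x v = l.
Proof.
move=> fl; rewrite /dderive; case: xgetP => [y _ fy|/(_ _ fl)//].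
exact: (cvg_unique (@tvs_hausdorff _ F) fy fl).
Qed.

Lemma smooth_on_dderive (E : tvsType R) (F : lcsType R) (U : set E) (f : E -> F) v :
  open U -> smooth_on U f ->
  (forall x, U x -> is_dderive f x v (dderive f x v)) /\
  smooth_on U (fun x => dderive f x v).
Proof.
move=> oU sf; split.
  move=> x Ux; have [_ [df [dfP _]]] := sf 1%N.
  by rewrite (dderiveE (dfP x v Ux)); exact: dfP.
move=> k; have [_ [df [dfP dfk]]] := sf k.+1.
apply: (@diff_class_eq _ _ _ _ _ (df \o (fun x => (x, v)))) => //.
  by move=> x Ux /=; rewrite (dderiveE (dfP x v Ux)).
apply: (diff_class_sub (U := U)) => //.
apply: (@diff_class_comp _ _ _ _ _ _ (U `*` setT)) => //.
- rewrite openE => -[y w] [/= Uy _]; exists (U, setT) => //=.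
  by split; [exact: open_nbhs_nbhs|exact: filterT].
- apply: diff_class_pair; last exact: diff_class_cst.
  by apply: diff_class_linear => // x; exact: cvg_id.
Qed.

Lemma smooth_on_iter (E : tvsType R) (F : lcsType R) (U : set E) (f : E -> F) s :
  open U -> smooth_on U f -> smooth_on U (iter_dderive s f).
Proof.
move=> oU sf; elim: s => //= v s IH.
by have [] := smooth_on_dderive v oU IH.
Qed.

Lemma smooth_on_lin (E F : tvsType R) (U : set E) a (f g : E -> F) :
  smooth_on U f -> smooth_on U g -> smooth_on U (fun x => a *: f x + g x).
Proof. by move=> sf sg k; exact: diff_class_lin. Qed.

Lemma iter_dderive_lin (E : tvsType R) (F : lcsType R) (U : set E) a (f g : E -> F) s :
  open U -> smooth_on U f -> smooth_on U g ->
  forall x, U x -> iter_dderive s (fun y => a *: f y + g y) x =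
    a *: iter_dderive s f x + iter_dderive s g x.
Proof.
move=> oU sf sg; elim: s => //= v s IH x Ux; apply: dderiveE.
have [dfs _] := smooth_on_dderive v oU (smooth_on_iter s oU sf).
have [dgs _] := smooth_on_dderive v oU (smooth_on_iter s oU sg).
have := is_dderive_lin (a := a) (dfs x Ux) (dgs x Ux).
by apply: (is_dderive_eq oU Ux) => y Uy; rewrite IH.
Qed.

End IteratedDerivative.

(* A chart with domain [cdom c]. [cmap] and [cinv] are total functions whose values
   off [cdom c] and off its image [cim c] are irrelevant. *)
Record chart (X E : Type) := Chart {
  cdom : set X;
  cmap :> X -> E;
  cinv : E -> X
}.

Definition cim (X E : Type) (c : chart X E) : set E := c @` cdom c.

Definition is_chart (X E : topologicalType) (c : chart X E) : Prop :=
  [/\ open (cdom c), open (cim c),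
      (forall x, cdom c x -> cinv c (c x) = x),
      (forall x, cdom c x -> {for x, continuous c}) &
      (forall y, cim c y -> {for y, continuous (cinv c)})].

(* Manifolds are Hausdorff, second countable and of pure dimension n (n = 0 is
   allowed); the atlas need not be maximal. *)
HB.mixin Record isManifold (R : realType) (n : nat) X of Topological X := {
  atlas : set (chart X 'rV[R]_n);
  atlas_chart : forall c, atlas c -> is_chart c;
  atlas_cover : forall x : X, exists2 c, atlas c & cdom c x;
  atlas_compat : forall c d, atlas c -> atlas d ->
    smooth_on (c @` (cdom c `&` cdom d)) (d \o cinv c);
  manifold_hausdorff : hausdorff_space X;
  manifold_second_countable : @second_countable X
}.

#[short(type="manifoldType")]
HB.structure Definition Manifold (R : realType) (n : nat) :=
  {X of Topological X & isManifold R n X}.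

Arguments atlas {R n} s.

Section SmoothMaps.
Context {R : realType}.

(* Smooth maps between spaces with given atlases, and smooth maps into a
   topological vector space. Atlases are explicit arguments so that products can
   be modelled on E * F and powers X^r on r x n matrices (row i is the i-th
   coordinate). *)
Definition smooth_map (X Y : topologicalType) (E F : tvsType R)
    (A : set (chart X E)) (B : set (chart Y F)) (f : X -> Y) : Prop :=
  continuous f /\
  forall c d, A c -> B d ->
    smooth_on (cim c `&` [set y | cdom d (f (cinv c y))]) (d \o f \o cinv c).

Definition smooth_fun (X : Type) (E V : tvsType R)
    (A : set (chart X E)) (f : X -> V) : Prop :=
  forall c, A c -> smooth_on (cim c) (f \o cinv c).

Definition prod_chart (X Y E F : Type) (c : chart X E) (d : chart Y F) :
    chart (X * Y) (E * F) :=
  Chart (cdom c `*` cdom d) (fun p => (c p.1, d p.2))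
        (fun q => (cinv c q.1, cinv d q.2)).

Definition prod_atlas (X Y E F : Type) (A : set (chart X E)) (B : set (chart Y F)) :
    set (chart (X * Y) (E * F)) :=
  [set prod_chart c d | c in A & d in B].

Definition pow_chart (X : Type) (n r : nat) (c : 'I_r -> chart X 'rV[R]_n) :
    chart ('I_r -> X) 'M[R]_(r, n) :=
  Chart [set a | forall i, cdom (c i) (a i)]
        (fun a => \matrix_(i, j) c i (a i) 0 j)
        (fun m i => cinv (c i) (row i m)).

Definition pow_atlas (X : Type) (n r : nat) (A : set (chart X 'rV[R]_n)) :
    set (chart ('I_r -> X) 'M[R]_(r, n)) :=
  [set pow_chart c | c in [set c | forall i, A (c i)]].

End SmoothMaps.

HB.mixin Record isLieGroup (R : realType) (n : nat) G
    of monoid.Group G & Manifold R n G := {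
  lie_mul_smooth : smooth_map (prod_atlas (atlas G) (atlas G)) (atlas G)
    (fun p : G * G => (p.1 * p.2)%g);
  lie_inv_smooth : smooth_map (atlas G) (atlas G) (fun g : G => g^-1%g)
}.

#[short(type="lieGroupType")]
HB.structure Definition LieGroup (R : realType) (n : nat) :=
  {G of monoid.Group G & Manifold R n G & isLieGroup R n G}.


Section Locality.
Context {R : realType}.

Lemma nbhs_setXT (E F : topologicalType) (U : set E) : open U ->
  open (U `*` [set: F]).
Proof.
move=> oU; rewrite openE => -[y w] [/= Uy _]; exists (U, setT) => //=.
by split; [exact: open_nbhs_nbhs|exact: filterT].
Qed.

Lemma diff_class_local k (E : tvsType R) (V : lcsType R) (U : set E) (f : E -> V) :
  (forall x, U x -> exists U', [/\ open U', U' x & diff_class k U' f]) ->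
  diff_class k U f.
Proof.
elim: k E U f => [|k IH] E U f loc.
  by split => // x /loc[U' [_ U'x [cf _]]]; exact: cf.
split; first by move=> x /loc[U' [_ U'x [cf _]]]; exact: cf.
exists (fun p => dderive f p.1 p.2); split.
  move=> x v /loc[U' [_ U'x [cf [df [dfP _]]]]] /=.
  by rewrite (dderiveE (dfP x v U'x)); exact: dfP.
apply: IH => -[x v] [/= /loc[U' [oU' U'x [cf [df [dfP dfk]]]]] _].
exists (U' `*` setT); split => //; first exact: nbhs_setXT.
apply: diff_class_eq dfk; first exact: nbhs_setXT.
by move=> [y w] [/= U'y _]; rewrite (dderiveE (dfP y w U'y)).
Qed.

Lemma chart_open (X Y E F : topologicalType) (c : chart X E) (d : chart Y F) (f : X -> Y) :
  is_chart c -> is_chart d -> continuous f ->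
  open (cim c `&` [set y | cdom d (f (cinv c y))]).
Proof.
move=> [_ oc _ _ ic] [od _ _ _ _] cf; rewrite openE => y [cy dy].
apply: filterI; first exact: open_nbhs_nbhs.
have : {for y, continuous (f \o cinv c)}.
  by apply: continuous_comp; [exact: ic|exact: cf].
by apply; exact: open_nbhs_nbhs.
Qed.

Lemma smooth_fun_comp (n m : nat) (X : manifoldType R n) (Y : manifoldType R m)
    (V : lcsType R) (phi : X -> Y) (f : Y -> V) :
  smooth_map (atlas X) (atlas Y) phi -> smooth_fun (atlas Y) f ->
  smooth_fun (atlas X) (f \o phi).
Proof.
move=> [cphi sphi] sf c Ac k; apply: diff_class_local => y cy.
have [d Bd dy] := atlas_cover (phi (cinv c y)).
have [od od' dK cd cd'] := atlas_chart d Bd.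
set U' := cim c `&` [set y | cdom d (phi (cinv c y))].
have oU' : open U' by apply: chart_open => //; exact: atlas_chart.
exists U'; split => //.
apply: (@diff_class_eq _ _ _ _ _ ((f \o cinv d) \o (d \o phi \o cinv c))) => //.
  by move=> z [cz dz] /=; rewrite dK.
apply: diff_class_comp (sphi c d Ac Bd k) (sf d Bd k) => //.
by move=> z [cz dz] /=; exists (phi (cinv c z)).
Qed.

Lemma smooth_fun_linear (X : Type) (E : tvsType R) (A : set (chart X E))
    (V W : tvsType R) (L : V -> W) (f : X -> V) :
  linear L -> continuous L -> smooth_fun A f -> smooth_fun A (L \o f).
Proof.
move=> lL cL sf c Ac k.
have := @diff_class_comp R k E V W (cim c) setT (f \o cinv c) L openT
  (fun _ _ => I) (sf c Ac k) (diff_class_linear k setT lL cL).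
exact.
Qed.

Lemma smooth_fun_lin (X : Type) (E : tvsType R) (A : set (chart X E))
    (V : tvsType R) (a : R) (f g : X -> V) :
  smooth_fun A f -> smooth_fun A g -> smooth_fun A (fun x => a *: f x + g x).
Proof. by move=> sf sg c Ac; apply: smooth_on_lin; [exact: sf|exact: sg]. Qed.

Lemma smooth_fun0 (X : Type) (E : tvsType R) (A : set (chart X E)) (V : tvsType R) :
  smooth_fun A (fun _ : X => 0 : V).
Proof. by move=> c Ac k; exact: diff_class_cst. Qed.

End Locality.

Definition is_smooth (R : realType) (n : nat) (X : manifoldType R n)
    (V : lcsType R) : {pred X -> V} := [pred f | `[< smooth_fun (atlas X) f >]].

Arguments is_smooth {R n} X V.

Lemma is_smooth_submod_closed (R : realType) (n : nat) (X : manifoldType R n)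
    (V : lcsType R) : submod_closed (is_smooth X V).
Proof.
split; first by apply/asboolP; exact: smooth_fun0.
by move=> a f g /asboolP sf /asboolP sg; apply/asboolP; exact: smooth_fun_lin.
Qed.

HB.instance Definition _ (R : realType) (n : nat) (X : manifoldType R n)
    (V : lcsType R) :=
  GRing.isSubmodClosed.Build R (X -> V) (is_smooth X V)
    (is_smooth_submod_closed X V).

Record Cinf (R : realType) (n : nat) (X : manifoldType R n) (V : lcsType R) :=
  MkCinf { cinf_val :> X -> V; _ : cinf_val \in is_smooth X V }.

HB.instance Definition _ (R : realType) (n : nat) (X : manifoldType R n)
    (V : lcsType R) := [isSub for @cinf_val R n X V].
HB.instance Definition _ (R : realType) (n : nat) (X : manifoldType R n)
    (V : lcsType R) := [Choice of Cinf X V by <:].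
HB.instance Definition _ (R : realType) (n : nat) (X : manifoldType R n)
    (V : lcsType R) := [SubChoice_isSubLmodule of Cinf X V by <:].

Lemma finite_near (I T : Type) (G : set_system T) (FG : Filter G) (Q : set I)
    (P : I -> set T) : finite_set Q -> (forall q, Q q -> G (P q)) ->
  G [set t | forall q, Q q -> P q t].
Proof.
elim/Pchoice: I => I in Q P *; move=> /finite_seqP[s ->].
elim: s => [|q s IH] H; first by apply: filterS filterT => t _ q.
have Hq : G (P q) by apply: H; rewrite /= mem_head.
have Hs := IH (fun p (ps : p \in s) => H p (mem_behead (s := q :: s) ps)).
apply: filterS2 Hq Hs => t Pq Ps p /=; rewrite inE => /orP[/eqP->//|].
exact: Ps.
Qed.

Section CinfTopology.
Context {R : realType} {n : nat} (X : manifoldType R n) (V : lcsType R).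
Local Notation E := 'rV[R]_n.
Implicit Types (f g h : Cinf X V) (q : chart X E * seq E * set E).

Lemma cinfP f : smooth_fun (atlas X) f.
Proof. by case: f => f /= /asboolP. Qed.

(* The C^oo-topology: uniform convergence of all iterated directional derivatives
   in charts on compact subsets of the chart images. The indices are triples
   (chart, directions, compact set); the sets [cinf_ball Q N], with Q a finite set
   of indices and N a neighbourhood of 0 in V, are a neighbourhood base of 0. *)
Definition cinf_index : set (chart X E * seq E * set E) :=
  [set q | [/\ atlas X q.1.1, compact q.2 & q.2 `<=` cim q.1.1]].

Definition cinf_ball (Q : set (chart X E * seq E * set E)) (N : set V) : set (Cinf X V) :=
  [set h : Cinf X V | forall q, Q q -> forall y, q.2 y ->
     N (iter_dderive q.1.2 (h \o cinv q.1.1) y)].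

Definition cinf_nbhs f (A : set (Cinf X V)) : Prop :=
  exists Q N, [/\ finite_set Q, Q `<=` cinf_index, nbhs 0 N &
    forall h, cinf_ball Q N h -> A (f + h)].

Lemma cinf_chart q : cinf_index q -> open (cim q.1.1).
Proof. by move=> [/(atlas_chart q.1.1)[]]. Qed.

Lemma cinf_lin q y a f g : cinf_index q -> q.2 y ->
  iter_dderive q.1.2 ((a *: f + g) \o cinv q.1.1) y =
  a *: iter_dderive q.1.2 (f \o cinv q.1.1) y +
  iter_dderive q.1.2 (g \o cinv q.1.1) y.
Proof.
move=> qi qy; have [Aq _ /(_ _ qy) cy] := qi.
by apply: iter_dderive_lin (cinf_chart qi) _ _ _ cy; exact: cinfP.
Qed.

Lemma cinf_lin0 q y : cinf_index q -> q.2 y ->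
  iter_dderive q.1.2 ((0 : Cinf X V) \o cinv q.1.1) y = 0.
Proof.
move=> qi qy; have := cinf_lin 1 0 0 qi qy.
by rewrite scaler0 add0r scale1r -[X in X = _]addr0 => /addrI.
Qed.

Lemma cinf_ball0 Q (N : set V) : Q `<=` cinf_index -> nbhs 0 N -> cinf_ball Q N 0.
Proof.
by move=> Qi N0 q /Qi qi y qy; rewrite cinf_lin0//; exact: nbhs_singleton.
Qed.

Lemma cinf_ballD Q (M N : set V) f g : Q `<=` cinf_index ->
  (forall v w, M v -> M w -> N (v + w)) ->
  cinf_ball Q M f -> cinf_ball Q M g -> cinf_ball Q N (f + g).
Proof.
move=> Qi MN fM gM q Qq y qy; rewrite -[f]scale1r cinf_lin//; last exact: Qi.
by rewrite scale1r; apply: MN; [exact: fM|exact: gM].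
Qed.

Lemma half_nbhs (N : set V) : nbhs 0 N -> exists2 M : set V, nbhs 0 M &
  forall v w, M v -> M w -> N (v + w).
Proof.
move=> N0; have := @add_continuous V (0, 0) N.
rewrite /= addr0 => /(_ N0)[[M1 M2] /= [M10 M20] MN].
exists (M1 `&` M2); first exact: filterI.
by move=> v w [? _] [_ ?]; apply: (MN (v, w)).
Qed.

Lemma cinf_nbhs_filter f : ProperFilter (cinf_nbhs f).
Proof.
apply: Build_ProperFilter_ex.
  move=> A [Q [N [_ Qi N0 QA]]]; exists (f + 0); apply: QA; exact: cinf_ball0.
split.
- exists set0, setT; split => //; exact: filterT.
- move=> A B [Q [N [fQ Qi N0 QA]]] [P [M [fP Pi M0 PB]]].
  exists (Q `|` P), (N `&` M); split.
  + by rewrite finite_setU.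
  + by move=> q [/Qi|/Pi].
  + exact: filterI.
  move=> h hQ; split; [apply: QA|apply: PB].
    by move=> q Qq y qy; have [] := hQ q (or_introl Qq) y qy.
  by move=> q Qq y qy; have [] := hQ q (or_intror Qq) y qy.
- move=> A B AB [Q [N [fQ Qi N0 QA]]]; exists Q, N; split => // h hQ.
  by apply: AB; exact: QA.
Qed.

Lemma cinf_nbhs_singleton f (A : set (Cinf X V)) : cinf_nbhs f A -> A f.
Proof.
move=> [Q [N [_ Qi N0 QA]]]; rewrite -[f]addr0; apply: QA; exact: cinf_ball0.
Qed.

Lemma cinf_nbhs_nbhs f (A : set (Cinf X V)) :
  cinf_nbhs f A -> cinf_nbhs f (cinf_nbhs^~ A).
Proof.
move=> [Q [N [fQ Qi N0 QA]]]; have [M M0 MN] := half_nbhs N0.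
exists Q, M; split => // h hM; exists Q, M; split => // k kM.
by rewrite -addrA; apply: QA; exact: cinf_ballD MN hM kM.
Qed.

HB.instance Definition _ := hasNbhs.Build (Cinf X V) cinf_nbhs.
HB.instance Definition _ := Nbhs_isNbhsTopological.Build (Cinf X V)
  cinf_nbhs_filter cinf_nbhs_singleton cinf_nbhs_nbhs.

Lemma nbhs_cinf_ball f Q N : finite_set Q -> Q `<=` cinf_index -> nbhs 0 N ->
  nbhs f [set g | cinf_ball Q N (g - f)].
Proof.
move=> fQ Qi N0; exists Q, N; split => // h /=.
by rewrite [f + h]addrC addrK.
Qed.

Lemma cinf_add_continuous : continuous (fun p : Cinf X V * Cinf X V => p.1 + p.2).
Proof.
move=> [f g] A [Q [N [fQ Qi N0 QA]]]; have [M M0 MN] := half_nbhs N0.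
exists ([set f' | cinf_ball Q M (f' - f)], [set g' | cinf_ball Q M (g' - g)]).
  by split; exact: nbhs_cinf_ball.
move=> [f' g'] /= [fM gM].
have := QA _ (cinf_ballD Qi MN fM gM).
by rewrite addrACA ![_ + (_ - _)]addrC !subrK.
Qed.

Lemma cinf_absorb Q N f : finite_set Q -> Q `<=` cinf_index -> nbhs 0 N ->
  \forall t \near (0 : R), cinf_ball Q N (t *: f).
Proof.
move=> fQ Qi N0.
have H q : Q q -> \forall t \near (0 : R), forall y, q.2 y ->
    N (iter_dderive q.1.2 ((t *: f) \o cinv q.1.1) y).
  move=> /Qi qi; have [Aq cq qc] := qi.
  have su := smooth_on_iter q.1.2 (cinf_chart qi) (cinfP f Aq).
  have := (compact_near_coveringP _).1 cq R (nbhs (0 : R))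
    (fun t y => N (t *: iter_dderive q.1.2 (f \o cinv q.1.1) y)).
  move=> near_cov.
  have : \forall t \near (0 : R), q.2 `<=`
      (fun y => N (t *: iter_dderive q.1.2 (f \o cinv q.1.1) y)).
    apply: near_cov => // y qy.
    have /= cu := diff_class_cont (su 0%N) (qc _ qy).
    set u := iter_dderive _ _ in cu *.
    have : (fun p : 'rV[R]_n * R => p.2 *: u p.1) @ (y, (0 : R)) --> 0 *: u y.
      apply: scale_cvg; first exact: cvg_snd.
      by apply: (@cvg_comp _ _ _ fst u) cu; exact: cvg_fst.
    by rewrite scale0r; apply.
  apply: filterS => t tN y qy.
  by rewrite -[t *: f]addr0 cinf_lin// cinf_lin0// addr0; exact: tN.
exact: finite_near fQ H.
Qed.

Lemma cinf_ballZ Q (M N : set V) r f : Q `<=` cinf_index ->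
  (forall v, M v -> N (r *: v)) -> cinf_ball Q M f -> cinf_ball Q N (r *: f).
Proof.
move=> Qi MN fM q Qq y qy; rewrite -[r *: f]addr0 cinf_lin//; last exact: Qi.
by rewrite cinf_lin0 ?addr0; [exact: MN (fM _ Qq _ qy)|exact: Qi|].
Qed.

Lemma cinf_scale_continuous : continuous (fun p : R^o * Cinf X V => p.1 *: p.2).
Proof.
move=> [r f] A [Q [N [fQ Qi N0 QA]]]; have [M M0 MN] := half_nbhs N0.
have := @scale_continuous R V (r, 0) M.
rewrite /= scaler0 => /(_ M0)[[B M'] /= [Br M'0] BM].
have near_r : nbhs r [set r' : R | cinf_ball Q M ((r' - r) *: f)].
  have := cinf_absorb f fQ Qi M0; rewrite -(subrr r) => H.
  have : {for r, continuous (fun r' : R => r' - r)}.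
    by apply: add_cvg; [exact: cvg_id|exact: cvg_cst].
  by move=> /(_ _ H).
exists (B `&` [set r' : R | cinf_ball Q M ((r' - r) *: f)],
        [set g | cinf_ball Q M' (g - f)]).
  by split; [exact: filterI|exact: nbhs_cinf_ball].
move=> [s g] /= [[Bs sM] gM].
have sgM : cinf_ball Q M (s *: (g - f)).
  by apply: cinf_ballZ gM => // v M'v; apply: (BM (s, v)).
have := QA _ (cinf_ballD Qi MN sM sgM).
by rewrite addrA scalerBl [r *: f + _]addrC subrK scalerBr [s *: f + _]addrC subrK.
Qed.

Lemma cinf_locally_convex : exists2 B : set_system (Cinf X V),
  (forall b, b \in B -> convex_set b) & basis B.
Proof.
exists [set C | open C /\ convex_set C]; first by move=> C /[!inE] -[].
split; first by move=> C [].
move=> f A [Q [N [fQ Qi N0 QA]]].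
have [C0 [oC C00 CN cC]] := convex_nbhs N0.
pose C := [set g | cinf_ball Q C0 (g - f)].
have Cf : nbhs f C by apply: nbhs_cinf_ball => //; exact: open_nbhs_nbhs.
have cvxC g h t : C g -> C h -> 0 <= t <= 1 -> C (t *: g + (1 - t) *: h).
  move=> Cg Ch t01.
  change (cinf_ball Q C0 (t *: g + (1 - t) *: h - f)).
  have -> : (t *: g + (1 - t) *: h) - f = t *: (g - f) + (1 - t) *: (h - f).
    rewrite !scalerBr addrACA; congr (_ + _).
    by rewrite -opprD -scalerDl [t + _]addrC subrK scale1r.
  move=> q Qq y qy; have qi := Qi _ Qq; rewrite cinf_lin//.
  rewrite -[(1 - t) *: _]addr0 cinf_lin// cinf_lin0// addr0.
  by apply: cC => //; [exact: Cg|exact: Ch].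
exists C°; last first.
  move=> g /nbhs_singleton /= Cg; rewrite -(subrK f g) addrC; apply: QA.
  by move=> q Qq y qy; apply: CN; exact: Cg.
split; last exact: Cf.
split; first exact: open_interior.
move=> g h t /[!inE] -[Q1 [N1 [fQ1 Qi1 N10 Q1C]]] -[Q2 [N2 [fQ2 Qi2 N20 Q2C]]].
exists (Q1 `|` Q2), (N1 `&` N2); split => //.
- by rewrite finite_setU.
- by move=> q [/Qi1|/Qi2].
- exact: filterI.
move=> k kQ.
have k1 : cinf_ball Q1 N1 k by move=> q Qq y qy; have [] := kQ q (or_introl Qq) y qy.
have k2 : cinf_ball Q2 N2 k by move=> q Qq y qy; have [] := kQ q (or_intror Qq) y qy.
have := cvxC _ _ (t%:num) (Q1C _ k1) (Q2C _ k2).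
rewrite ge0 le1 => /(_ isT).
rewrite !scalerDr addrACA -scalerDl [t%:num + _]addrC subrK scale1r.
exact.
Qed.

HB.instance Definition _ := PreTopologicalLmod_isTvs.Build R (Cinf X V)
  cinf_add_continuous cinf_scale_continuous cinf_locally_convex.
HB.instance Definition _ := PreTopologicalNmodule_isTopologicalNmodule.Build
  (Cinf X V) cinf_add_continuous.
HB.instance Definition _ := TopologicalNmodule_isTopologicalLmodule.Build R
  (Cinf X V) cinf_scale_continuous.
HB.instance Definition _ := Uniform_isTvs.Build R (Cinf X V) cinf_locally_convex.

Lemma cinf_eval_continuous x : continuous (fun f : Cinf X V => f x).
Proof.
move=> f A Afx; have [c Ac cx] := atlas_cover x.
exists [set (c, [::], [set c x])], [set v | A (f x + v)]; split.
- exact: finite_set1.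
- move=> _ ->; split => //=; first exact: compact_set1.
  by move=> _ ->; exists x.
- have : {for (0 : V), continuous (fun v => f x + v)}.
    by apply: add_cvg; [exact: cvg_cst|exact: cvg_id].
  by move=> /(_ A); rewrite addr0; apply.
move=> h /(_ _ erefl (c x) erefl) /=.
by have [_ _ /(_ _ cx)->] := atlas_chart c Ac.
Qed.

Lemma cinf_hausdorff : hausdorff_space (Cinf X V).
Proof.
move=> f g fg; apply/val_inj/funext => x /=.
apply: (@tvs_hausdorff _ V) => A B fA gB.
have [h [Ah Bh]] := fg _ _ (cinf_eval_continuous fA) (cinf_eval_continuous gB).
by exists (h x).
Qed.

HB.instance Definition _ := Tvs_isHausdorff.Build R (Cinf X V) cinf_hausdorff.

End CinfTopology.


Record smooth_action (R : realType) (n m : nat) (G : lieGroupType R n)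
    (X : manifoldType R m) := SmoothAction {
  sact :> G -> X -> X;
  sact1 : forall x, sact 1%g x = x;
  sactM : forall g h x, sact (g * h)%g x = sact g (sact h x);
  sact_smooth : smooth_map (prod_atlas (atlas G) (atlas X)) (atlas X)
    (fun p : G * X => sact p.1 p.2)
}.

Definition proper_action (R : realType) (n m : nat) (G : lieGroupType R n)
    (X : manifoldType R m) (a : smooth_action G X) : Prop :=
  forall K : set (X * X), compact K ->
    compact ((fun p : G * X => (a p.1 p.2, p.2)) @^-1` K).

Record gmodule (R : realType) (n : nat) (G : lieGroupType R n) (V : lcsType R) :=
  Gmodule {
  gact :> G -> {linear V -> V};
  gact1 : forall v, gact 1%g v = v;
  gactM : forall g h v, gact (g * h)%g v = gact g (gact h v);
  gact_continuous : continuous (fun p : G * V => gact p.1 p.2)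
}.

(* [tvsType] does not force its uniform structure to be the translation-invariant
   one, so Cauchy filters are defined directly from neighbourhoods of 0. *)
Section QuasiComplete.
Context {R : realType} {V : lcsType R}.

Definition tvs_bounded (B : set V) : Prop :=
  forall N : set V, nbhs 0 N -> exists2 r : R, 0 < r & B `<=` *:%R r @` N.

Definition cauchy_filter (F : set_system V) : Prop :=
  forall N : set V, nbhs 0 N ->
    exists2 A, F A & forall x y, A x -> A y -> N (x - y).

Definition complete_set (B : set V) : Prop :=
  forall F : set_system V, ProperFilter F -> F B -> cauchy_filter F ->
    exists2 x, B x & F --> x.

End QuasiComplete.

Definition quasi_complete (R : realType) (V : lcsType R) : Prop :=
  forall B : set V, closed B -> tvs_bounded B -> complete_set B.

(* v |-> o_v with o_v(g) = g . v, as a map into C^oo(G, V) *)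
Definition orbit_map (R : realType) (n : nat) (G : lieGroupType R n)
    (V : lcsType R) (M : gmodule G V)
    (sM : forall v, smooth_fun (atlas G) (fun g => M g v)) (v : V) : Cinf G V :=
  MkCinf (asboolT (sM v)).

Record differentiable_gmodule (R : realType) (n : nat) (G : lieGroupType R n)
    (V : lcsType R) (M : gmodule G V) : Prop := DifferentiableGmodule {
  gmodule_quasi_complete : quasi_complete V;
  orbit_smooth : forall v, smooth_fun (atlas G) (fun g => M g v);
  orbit_map_smooth : smooth_on setT (orbit_map orbit_smooth)
}.

Section CinfAction.
Context {R : realType} {n m : nat} {G : lieGroupType R n} {X : manifoldType R m}.
Context {V : lcsType R} (a : smooth_action G X) (M : gmodule G V).

Lemma prod_chart_is_chart (X1 X2 E1 E2 : topologicalType) (c : chart X1 E1)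
  (d : chart X2 E2) : is_chart c -> is_chart d -> is_chart (prod_chart c d).
Proof.
move=> [oc oc' cK cc cc'] [od od' dK cd cd'].
have oX (T1 T2 : topologicalType) (A : set T1) (B : set T2) : open A -> open B ->
    open (A `*` B).
  move=> oA oB; rewrite openE => -[x y] [Ax By]; exists (A, B) => //.
  by split; exact: open_nbhs_nbhs.
have cimE : cim (prod_chart c d) = cim c `*` cim d.
  apply/seteqP; split => [_ [[x y] [/= cx dy] <-]|[_ _] [/= [x cx <-] [y dy <-]]].
    by split; [exists x|exists y].
  by exists (x, y).
split; rewrite ?cimE; try exact: oX.
- by move=> [x y] [/= /cK-> /dK->].
- move=> [x y] [/= /cc cx /cd dy]; apply: cvg_pair => /=.
    by apply: (@cvg_comp _ _ _ fst c) cx; exact: cvg_fst.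
  by apply: (@cvg_comp _ _ _ snd d) dy; exact: cvg_snd.
- move=> [x y] [/= /cc' cx /cd' dy]; apply: cvg_pair => /=.
    by apply: (@cvg_comp _ _ _ fst (cinv c)) cx; exact: cvg_fst.
  by apply: (@cvg_comp _ _ _ snd (cinv d)) dy; exact: cvg_snd.
Qed.

Lemma sact_section_smooth g : smooth_map (atlas X) (atlas X) (a g).
Proof.
have [ca sa] := sact_smooth a.
have cg : continuous (a g).
  move=> x; apply: (@continuous_comp _ _ _ (fun x => (g, x)) (fun p : G * X => a p.1 p.2)).
    by apply: cvg_pair; [exact: cvg_cst|exact: cvg_id].
  exact: ca.
split => // c d Ac Ad k; have [e Ae eg] := atlas_cover g.
have [_ _ eK _ _] := atlas_chart e Ae.
have Aec : prod_atlas (atlas G) (atlas X) (prod_chart e c).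
  by exists e => //; exists c.
have ic : is_chart (prod_chart e c).
  by apply: prod_chart_is_chart; exact: atlas_chart.
have := @diff_class_comp R k 'rV[R]_m ('rV[R]_n * 'rV[R]_m)%type 'rV[R]_m
  (cim c `&` [set y | cdom d (a g (cinv c y))]) _ (fun y => (e g, y)) _
  (chart_open ic (atlas_chart d Ad) ca) _ _ (sa _ _ Aec Ad k).
move=> H; apply: (@diff_class_eq _ _ _ _ _ _ _ _ _ (H _ _)).
- by apply: chart_open => //; exact: atlas_chart.
- by move=> y _ /=; rewrite eK.
- move=> y [[x cx <-] /= dx]; split; last by rewrite /= eK.
  by exists (g, x).
- apply: diff_class_pair; first exact: diff_class_cst.
  by apply: diff_class_linear => // x; exact: cvg_id.
Qed.

Lemma cinf_act_subproof g (f : Cinf X V) :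
  (fun x => M g (f (a g^-1%g x))) \in is_smooth X V.
Proof.
apply/asboolP; apply: (@smooth_fun_linear _ _ _ _ _ _ (M g) (f \o a g^-1%g)).
- exact: linearP.
- move=> v; apply: (@continuous_comp _ _ _ (fun v => (g, v)) (fun p : G * V => M p.1 p.2)).
    by apply: cvg_pair; [exact: cvg_cst|exact: cvg_id].
  exact: gact_continuous.
- by apply: smooth_fun_comp (cinfP f); exact: sact_section_smooth.
Qed.

(* (g . f)(x) = g . f(g^-1 . x) *)
Definition cinf_act g (f : Cinf X V) : Cinf X V := MkCinf (cinf_act_subproof g f).

Lemma cinf_act_linear g : linear (cinf_act g).
Proof. by move=> k f h; apply/val_inj/funext => x /=; exact: linearP. Qed.

HB.instance Definition _ g :=
  GRing.isLinear.Build R (Cinf X V) (Cinf X V) *:%R (cinf_act g) (cinf_act_linear g).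

Definition cinf_action (g : G) : {linear Cinf X V -> Cinf X V} := cinf_act g.

End CinfAction.

Definition cochain (G W : Type) (r : nat) : Type := ('I_r -> G) -> W.

HB.instance Definition _ (G : Type) (W : zmodType) (r : nat) :=
  GRing.Zmodule.copy (cochain G W r) (('I_r -> G) -> W).

Section Cochains.
Context {R : realType} {n : nat} {G : lieGroupType R n} {W : lcsType R}.
Variable act : G -> {linear W -> W}.

(* Arguments are numbered from 0: [face i a] replaces a_i, a_(i+1) by their product,
   so it enters [coboundary] with sign (-1)^(i+1). *)
Definition face (r : nat) (i : 'I_r) (a : 'I_r.+1 -> G) : 'I_r -> G := fun j =>
  if (j < i)%N then a (widen_ord (leqnSn r) j)
  else if j == i then (a (widen_ord (leqnSn r) j) * a (lift ord0 j))%g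
  else a (lift ord0 j).

Definition coboundary (r : nat) (l : cochain G W r) : cochain G W r.+1 := fun a =>
  act (a ord0) (l (fun j => a (lift ord0 j)))
  + \sum_(i < r) (-1) ^+ i.+1 *: l (face i a)
  + (-1) ^+ r.+1 *: l (fun j => a (widen_ord (leqnSn r) j)).

Lemma coboundaryB r (l l' : cochain G W r) :
  coboundary (l - l') = coboundary l - coboundary l'.
Proof.
apply/funext => a; rewrite /coboundary.
have E b : (l - l') b = l b - l' b by [].
have E' b : (coboundary l - coboundary l') b = coboundary l b - coboundary l' b by [].
rewrite E' /coboundary !E linearB scalerBr.
under eq_bigr do rewrite E scalerBr.
by rewrite sumrB [X in X + _ = _]addrACA [LHS]addrACA -!opprD.
Qed.

Lemma coboundary0 r : coboundary (0 : cochain G W r) = 0.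
Proof. by rewrite -(subrr 0) coboundaryB subrr. Qed.

Definition continuous_cochain (r : nat) : {pred cochain G W r} :=
  [pred l | `[< continuous (l : {ptws 'I_r -> G} -> W) >]].

Definition smooth_cochain (r : nat) : {pred cochain G W r} :=
  [pred l | `[< smooth_fun (pow_atlas (atlas G)) l >]].

Arguments continuous_cochain : clear implicits.
Arguments smooth_cochain : clear implicits.

Lemma continuous_cochain_zmod r : zmod_closed (continuous_cochain r).
Proof.
have c0 (T : topologicalType) : continuous (fun _ : T => 0 : W).
  by move=> x; exact: cvg_cst.
have cB (T : topologicalType) (f g : T -> W) : continuous f -> continuous g ->
    continuous (fun x => f x - g x).
  by move=> cf cg x; apply: add_cvg; [exact: cf|apply: opp_cvg; exact: cg].
split; first by apply/asboolP; exact: (c0 {ptws 'I_r -> G}).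
move=> f g /asboolP cf /asboolP cg; apply/asboolP.
exact: (cB {ptws 'I_r -> G} f g).
Qed.

Lemma smooth_cochain_zmod r : zmod_closed (smooth_cochain r).
Proof.
split; first by apply/asboolP; exact: smooth_fun0.
move=> f g /asboolP sf /asboolP sg; apply/asboolP.
have := smooth_fun_lin (-1) sg sf.
by congr smooth_fun; apply/funext => x; rewrite scaleN1r addrC.
Qed.

HB.instance Definition _ r :=
  GRing.isZmodClosed.Build _ (continuous_cochain r) (continuous_cochain_zmod r).
HB.instance Definition _ r :=
  GRing.isZmodClosed.Build _ (smooth_cochain r) (smooth_cochain_zmod r).

(* The cohomology of the subcomplex S of all cochains: cocycles in S r modulo the
   coboundaries of elements of S (r - 1). *)
Section Cohomology.
Variables (S : forall r, zmodClosed (cochain G W r)) (r : nat).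

Definition is_cocycle : {pred cochain G W r} :=
  [pred l | (l \in S r) && (coboundary l == 0)].

Lemma is_cocycle_zmod : zmod_closed is_cocycle.
Proof.
split; first by rewrite inE rpred0 coboundary0 eqxx.
move=> f g /andP[Sf /eqP f0] /andP[Sg /eqP g0].
by rewrite inE rpredB// coboundaryB f0 g0 subrr eqxx.
Qed.

HB.instance Definition _ := GRing.isZmodClosed.Build _ is_cocycle is_cocycle_zmod.

Record cocycle := Cocycle { cocycle_val :> cochain G W r; _ : cocycle_val \in is_cocycle }.
HB.instance Definition _ := [isSub for cocycle_val].
HB.instance Definition _ := [Choice of cocycle by <:].
HB.instance Definition _ := [SubChoice_isSubZmodule of cocycle by <:].

End Cohomology.

Definition coboundaries (S : forall r, zmodClosed (cochain G W r)) (r : nat) :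
    set (cochain G W r) :=
  match r with
  | 0 => [set 0]
  | s.+1 => [set l | exists2 k, k \in S s & l = coboundary k]
  end.

Definition is_exact (S : forall r, zmodClosed (cochain G W r)) (r : nat) :
  {pred cocycle S r} := [pred z | `[< coboundaries S (cocycle_val z) >]].

Lemma is_exact_zmod S r : zmod_closed (@is_exact S r).
Proof.
split.
  apply/asboolP; case: r => //= r; exists 0; first exact: rpred0.
  by rewrite coboundary0.
move=> f g /asboolP bf /asboolP bg; apply/asboolP.
case: r f g bf bg => [f g /= -> ->|r f g /= [k Sk ->] [k' Sk' ->]].
  by rewrite subrr.
by exists (k - k'); [exact: rpredB|rewrite coboundaryB].
Qed.

HB.instance Definition _ S r :=
  GRing.isZmodClosed.Build _ (@is_exact S r) (@is_exact_zmod S r).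

Definition cohomology S r : zmodType := Quotient.quot (@is_exact S r).

Definition continuous_cohomology := cohomology (fun r => continuous_cochain r).
Definition smooth_cohomology := cohomology (fun r => smooth_cochain r).

End Cochains.
Arguments continuous_cohomology {R n G W} act r.

(* Main.v *)
(* Properness gives a smooth chi >= 0 on X such that g |-> chi(g^-1 x) has compact
   support and left-invariant integral 1 for every x. For a cocycle l of degree q + 1,
   averaging over g the cocycle identity at (b_0, ..., b_q, (b_0 ... b_q)^-1 g), with
   weight chi(g^-1 x), shows that
     k(b)(x) = int chi(g^-1 x) l(b, (b_0 ... b_(q-1))^-1 g)(x) dg
   is a primitive of l up to sign, and k is continuous (smooth) when l is.
   The integral is built by hand: Weil's covering ratios and an ultrafilter give a
   left-invariant functional on compactly supported functions, which is the limit of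
   finite discrete measures; the sums of a V-valued function against these measures form
   a bounded Cauchy net, which converges because V is quasi-complete. *)
Require Import Defs.
From HB Require Import structures.
From mathcomp Require Import all_boot all_order all_algebra.
From mathcomp Require Import ring_quotient generic_quotient.
From mathcomp Require Import boolp classical_sets functions cardinality.
From mathcomp Require Import interval_inference reals topology tvs normedtype convex derive sequences exp.
From mathcomp Require Import ring lra.
Import Order.TTheory GRing.Theory Num.Theory.
Import numFieldNormedType.Exports.
Set Implicit Arguments.
Unset Strict Implicit.
Unset Printing Implicit Defensive.
Local Open Scope classical_set_scope.
Local Open Scope ring_scope.

(** * Bump functions *)

(** Quasi-completeness is given for [V], so integrals are taken in [V]: averages of
    [Cinf X V]-valued functions are formed pointwise in x. Two facts then have to be recovered. The
    average must be smooth in x, which is differentiation under the integral; and it must depend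
    continuously, or in class C^j, on the cochain arguments for the C^oo-topology. Both rest on one
    criterion: a map into [Cinf X V] is continuous exactly when its iterated derivatives in charts
    are jointly continuous in the point and the parameter. As [V] has no norm, estimates are phrased
    with a convex open neighbourhood C of 0: a bound by B means membership in B C, and compactness
    makes a pointwise condition in C uniform over a support. In the computation itself, left
    invariance of the integral makes averaging commute with the action, and the normalisation of chi
    makes the one term that does not involve g survive the average unchanged. *)

HB.instance Definition _ (R : realType) := Tvs_isHausdorff.Build R R^o (@Rhausdorff R).

(** An instance of the near-covering form of compactness, for the filter of finite sequences in [L]
    directed by inclusion. The centres come as a sequence so that sums can be taken over them. *)
Lemma compact_finite_subcover (T : topologicalType) (L : set T) (O : T -> set T) :
  compact L -> (forall x, L x -> nbhs x (O x)) ->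
  exists s : seq T, (forall x, x \in s -> L x) /\
    forall y, L y -> exists2 x, x \in s & O x y.
Proof.
move=> cL LO.
pose F := filter_from [set s : seq T | forall x, x \in s -> L x]
  (fun s0 => [set s : seq T | (forall x, x \in s -> L x) /\ {subset s0 <= s}]).
have FF : ProperFilter F.
  apply: filter_from_proper; last by move=> s sL; exists s; split.
  apply: filter_from_filter; first by exists [::].
  move=> s1 s2 s1L s2L; exists (s1 ++ s2).
    by move=> x /=; rewrite mem_cat => /orP[/s1L|/s2L].
  move=> s [sL ss]; split; split=> // x xs; apply: ss; rewrite mem_cat xs ?orbT//.
have := (compact_near_coveringP L).1 cL (seq T) F
  (fun s y => exists2 x, x \in s & O x y) _.
case.
  move=> x Lx; exists (O x, [set s : seq T | (forall x, x \in s -> L x) /\ {subset [:: x] <= s}]).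
    split; first exact: LO.
    by exists [:: x] => // y; rewrite inE => /eqP->.
  by move=> [y s] [/= Oy [_ xs]]; exists x => //; apply: xs; rewrite inE.
by move=> s sL cov; have := cov s (conj sL (fun x h => h)); exists s.
Qed.

Section ScalarCalculus.
Context {R : realType}.
Implicit Types E F : tvsType R.

Lemma line_dcvg E (x v : E) : (fun h : R => x + h *: v) @ (0 : R)^' --> x.
Proof. by move=> A /(@line_cvg _ _ x v) /nbhs_dnbhs. Qed.

Lemma is_dderive_scale E F (a : E -> R^o) (f : E -> F) x v (l : R^o) m :
  {for x, continuous f} -> is_dderive a x v l -> is_dderive f x v m ->
  is_dderive (fun y => a y *: f y) x v (l *: f x + a x *: m).
Proof.
move=> cf al fm; rewrite /is_dderive.
under eq_fun => h.
  have -> : h^-1 *: (a (x + h *: v) *: f (x + h *: v) - a x *: f x) =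
     (h^-1 *: (a (x + h *: v) - a x)) *: f (x + h *: v)
     + a x *: (h^-1 *: (f (x + h *: v) - f x)).
    rewrite -scalerA [a x *: (_ *: _)]scalerA [a x * _]mulrC -scalerA -scalerDr; congr (_ *: _).
    by rewrite scalerBl scalerBr addrA subrK.
  over.
apply: add_cvg; last by apply: scale_cvg => //; exact: cvg_cst.
apply: scale_cvg => //.
by apply: (@cvg_comp _ _ _ (fun h : R => x + h *: v) f _ _ _ (@line_dcvg _ x v) cf).
Qed.

Lemma diff_class_scale k E F U (a : E -> R^o) (f : E -> F) :
  diff_class k U a -> diff_class k U f -> diff_class k U (fun x => a x *: f x).
Proof.
have C E' (U' : set E') (a' : E' -> R^o) (f' : E' -> F) :
   (forall x, U' x -> {for x, continuous a'}) ->
   (forall x, U' x -> {for x, continuous f'}) ->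
   (forall x, U' x -> {for x, continuous (fun x => a' x *: f' x)}).
  by move=> ca cf x Ux; apply: scale_cvg; [exact: ca|exact: cf].
elim: k E U a f => [|k IH] E U a f; first by move=> [ca _] [cf _]; split => //; exact: C.
move=> Da Df; have [ca [da [daP dak]]] := Da; have [cf [df [dfP dfk]]] := Df.
have fstk (H : tvsType R) (h : E -> H) : diff_class k U h ->
    diff_class k (U `*` setT) (fun p : E * E => h p.1).
  move=> hk; apply: (@diff_class_sub _ _ _ _ (fst @^-1` U)); first by move=> [? ?] [].
  apply: (@diff_class_comp_linear _ k _ _ _ U fst h) => //.
  by move=> p; exact: cvg_fst.
split; first exact: C.
(* The factor [1] only brings the Leibniz formula to the shape of [diff_class_lin]. *)
exists (fun p => 1 *: (da p *: f p.1) + a p.1 *: df p); split.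
  by move=> x v Ux; rewrite scale1r; apply: is_dderive_scale; [exact: cf|exact: daP|exact: dfP].
apply: diff_class_lin.
  by apply: IH => //; apply: fstk; exact: diff_classW.
by apply: IH => //; apply: fstk; exact: diff_classW.
Qed.

Lemma diff_class_add k E F U (f g : E -> F) :
  diff_class k U f -> diff_class k U g -> diff_class k U (fun x => f x + g x).
Proof.
move=> fk gk; have := diff_class_lin 1 fk gk.
by congr diff_class; apply/funext => x; rewrite scale1r.
Qed.

Lemma diff_class_sum k E F U (I : Type) (s : seq I) (P : pred I) (f : I -> E -> F) :
  (forall i, P i -> diff_class k U (f i)) ->
  diff_class k U (fun x => \sum_(i <- s | P i) f i x).
Proof.
move=> fk; elim: s => [|i s IH].
  have := @diff_class_cst R k E F U 0.
  by congr diff_class; apply/funext => x; rewrite big_nil.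
case Pi: (P i); last first.
  by move: IH; congr diff_class; apply/funext => x; rewrite big_cons Pi.
have := diff_class_add (fk i Pi) IH.
by congr diff_class; apply/funext => x; rewrite big_cons Pi.
Qed.

Lemma is_dderive_inv E (a : E -> R^o) x v (l : R^o) :
  a x != 0 -> {for x, continuous a} -> is_dderive a x v l ->
  is_dderive (fun y => (a y)^-1 : R^o) x v (- ((a x)^-1 * (a x)^-1) *: l).
Proof.
move=> ax ca al; rewrite /is_dderive.
have cl : (fun h : R => a (x + h *: v)) @ (0:R)^' --> a x.
  by apply: (@cvg_comp _ _ _ (fun h : R => x + h *: v) a _ _ _ (@line_dcvg _ x v) ca).
have H : (fun h : R => - ((a (x + h *: v))^-1 * (a x)^-1) *: (h^-1 *: (a (x + h *: v) - a x))) @ (0:R)^'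
    --> - ((a x)^-1 * (a x)^-1) *: l.
  apply: scale_cvg => //; apply: cvgN; apply: cvgM; last exact: cvg_cst.
  exact: cvgV.
apply: cvg_trans H; apply: near_eq_cvg.
have : \forall h \near (0:R)^', a (x + h *: v) != 0.
  apply: (cl [set y : R | y != 0]); apply: open_nbhs_nbhs; split; last exact: ax.
  by have := @open_neq R 0; congr open; apply/funext => y /=; rewrite eq_sym.
have H2 (k b c : R) : b != 0 -> c != 0 -> - (b^-1 * c^-1) * (k * (b - c)) = k * (b^-1 - c^-1).
  by move=> b0 c0; field; rewrite b0 c0.
apply: filterS => h ah /=; exact: H2.
Qed.

Lemma diff_class_fst k E E' F (U : set E) (h : E -> F) :
  diff_class k U h -> diff_class k (U `*` setT) (fun p : E * E' => h p.1).
Proof.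
move=> hk; apply: (@diff_class_sub _ _ _ _ (fst @^-1` U)); first by move=> [? ?] [].
apply: (@diff_class_comp_linear _ k _ _ _ U fst h) => //.
by move=> p; exact: cvg_fst.
Qed.

Lemma diff_class_inv k E U (a : E -> R^o) : (forall x, U x -> a x != 0) ->
  diff_class k U a -> diff_class k U (fun x => (a x)^-1 : R^o).
Proof.
have C E' (U' : set E') (a' : E' -> R^o) : (forall x, U' x -> a' x != 0) ->
   (forall x, U' x -> {for x, continuous a'}) ->
   (forall x, U' x -> {for x, continuous (fun x => (a' x)^-1 : R^o)}).
  by move=> a0 ca x Ux; apply: cvgV; [exact: a0|exact: ca].
elim: k E U a => [|k IH] E U a a0; first by move=> [ca _]; split => //; exact: C.
move=> Da; have [ca [da [daP dak]]] := Da.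
split; first exact: C.
exists (fun p => (-1) *: ((a p.1)^-1 *: ((a p.1)^-1 *: da p)) + 0); split.
  move=> x v Ux; have := is_dderive_inv (a0 _ Ux) (ca _ Ux) (daP x v Ux). congr is_dderive.
  by rewrite addr0 !scalerA mulN1r.
apply: diff_class_lin; last exact: diff_class_cst.
have ik : diff_class k (U `*` setT) (fun p : E * E => (a p.1)^-1 : R^o).
  by apply: (@diff_class_fst k E E R^o U (fun x => (a x)^-1 : R^o)); apply: IH => //; exact: diff_classW.
by do 2! apply: diff_class_scale => //.
Qed.

Lemma is_dderive_expR (x v : R) : is_dderive (expR : R^o -> R^o) x v (expR x *: (v : R^o)).
Proof.
have dx : differentiable (expR : R^o -> R^o) (x : R^o) by apply/derivable1_diffP; exact: derivable_expR.
have := @diff_derivable _ _ _ (expR : R^o -> R^o) (x : R^o) (v : R^o) dx.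
rewrite /derivable => /cvg_ex /= [l H].
have E : 'D_v (expR : R^o -> R^o) x = l by apply/cvg_lim => //; exact: Rhausdorff.
have : is_dderive (expR : R^o -> R^o) x v l.
  rewrite /is_dderive; apply: cvg_trans H; apply: near_eq_cvg; apply: nearW => h /=.
  by rewrite [_ *: v + x]addrC.
congr is_dderive; rewrite -E deriveE// -[v in 'd _ _ v]mulr1 -[v * 1]/(v *: (1 : R^o)) linearZ.
rewrite -deriveE//; have -> : 'D_(1 : R^o) (expR : R^o -> R^o) x = expR x.
  exact: (congr1 (fun f => f x) (@derive_expR R)).
by rewrite /GRing.scale /= mulrC.
Qed.

(* The factor [t^-1 ^+ n] makes the family stable under differentiation, up to linear
   combinations. *)
Definition flat_exp (n : nat) (t : R) : R :=
  if 0 < t then t^-1 ^+ n * expR (- t^-1) else 0.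

(** With s = 1/t, one term of the exponential series gives exp s >= s^(n+1) / (n+1)!, hence s^n
    exp(-s) <= (n+1)! / s. A bound linear in t settles the limit at 0 for every n at once. *)
Lemma flat_exp_le n t : 0 <= flat_exp n t <= n.+1`!%:R * `|t|.
Proof.
rewrite /flat_exp; case: ifPn => [t0|_]; last by rewrite lexx mulr_ge0.
have s0 : 0 < t^-1 by rewrite invr_gt0.
apply/andP; split; first by apply: mulr_ge0; rewrite ?expR_ge0// exprn_ge0// ltW.
rewrite expRN ler_pdivrMr ?expR_gt0//.
rewrite gtr0_norm//.
have := @expR_ge1Dxn R (t^-1) n (ltW s0).
set e := expR _ => H.
have {}H : t^-1 ^+ n.+1 / n.+1`!%:R <= e by apply: le_trans H; rewrite lerDr.
have f0 : 0 < (n.+1`!%:R : R) by rewrite ltr0n fact_gt0.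
rewrite ler_pdivrMr// in H.
have : t * t^-1 ^+ n.+1 <= t * (e * n.+1`!%:R) by rewrite ler_wpM2l// ltW.
have -> : t * t^-1 ^+ n.+1 = t^-1 ^+ n by rewrite exprS mulrA mulfV ?mul1r// gt_eqF.
by have -> : t * (e * n.+1`!%:R) = n.+1`!%:R * t * e by ring.
Qed.

Lemma flat_exp_cvg0 n : flat_exp n @ (0:R) --> (0:R).
Proof.
have H : (fun t : R => n.+1`!%:R * `|t|) @ (0:R) --> (0:R).
  have E0 : n.+1`!%:R * `|0 : R| = 0 by rewrite normr0 mulr0.
  rewrite -[X in _ --> X]E0.
  by apply: cvgM; [exact: cvg_cst|apply: cvg_norm; exact: cvg_id].
apply: (squeeze_cvgr _ (@cvg_cst _ _ _ _ _) H).
by apply: nearW => t; exact: flat_exp_le.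
Qed.

Lemma flat_exp_pos n t : 0 < t -> 0 < flat_exp n t.
Proof. by move=> t0; rewrite /flat_exp t0 mulr_gt0 ?expR_gt0// exprn_gt0// invr_gt0. Qed.

Lemma flat_exp_neg n t : t <= 0 -> flat_exp n t = 0.
Proof. by rewrite /flat_exp leNgt; case: ifP. Qed.

Lemma is_dderive_flat_exp n (t v : R) :
  is_dderive (flat_exp n : R^o -> R^o) t v (v *: (flat_exp n.+2 t - n%:R * flat_exp n.+1 t : R^o)).
Proof.
have [t0|t0|t0] := ltgtP t 0.
- have -> : v *: (flat_exp n.+2 t - n%:R * flat_exp n.+1 t : R^o) = 0.
    by rewrite !flat_exp_neg ?ltW// mulr0 subr0 scaler0.
  have oU : open [set s : R^o | s < 0] by exact: (@open_lt R 0).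
  apply: (@is_dderive_eq _ _ _ _ (fun _ => 0 : R^o) _ _ _ _ oU t0).
    by move=> y /= y0; rewrite flat_exp_neg// ltW.
  rewrite /is_dderive; under eq_fun do rewrite subrr scaler0.
  exact: cvg_cst.
- pose U := [set s : R^o | 0 < s].
  have oU : open U by exact: (@open_gt R 0).
  have did (s w : R^o) : is_dderive (id : R^o -> R^o) s w w.
    rewrite /is_dderive; apply: (cvg_trans _ (@cvg_cst _ w _ (0:R)^' _)); apply: near_eq_cvg.
    apply: filterS (nbhs_dnbhs_neq (0:R)) => h h0 /=.
    by rewrite [s + _]addrC addrK scalerA mulVf// scale1r.
  have dinv (s w : R^o) : s != 0 -> is_dderive (fun s : R^o => s^-1 : R^o) s w (- (s^-1 * s^-1) *: w).
    by move=> s0; apply: (is_dderive_inv (a := id)) => //; exact: cvg_id.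
  have cinv0 (s : R^o) : s != 0 -> {for s, continuous (fun s : R^o => s^-1 : R^o)}.
    by move=> s0; apply: cvgV => //; exact: cvg_id.
  have tn0 : t != 0 by rewrite gt_eqF.
  have dpow m : {for (t : R^o), continuous (fun s : R^o => s^-1 ^+ m : R^o)} /\
      is_dderive (fun s : R^o => s^-1 ^+ m : R^o) t v (- (m%:R * t^-1 ^+ m.+1) * v).
    elim: m => [|m [cm dm]].
      split; first by apply: cvg_cst.
      rewrite mul0r oppr0 mul0r /is_dderive; under eq_fun do rewrite subrr scaler0.
      exact: cvg_cst.
    split.
      have -> : (fun s : R^o => s^-1 ^+ m.+1 : R^o) = (fun s => s^-1 * s^-1 ^+ m).
        by apply/funext => s; rewrite exprS.
      exact: (cvgM (cinv0 t tn0) cm).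
    have := is_dderive_scale cm (dinv t v tn0) dm.
    have -> : (- (t^-1 * t^-1) *: (v : R^o)) *: (t^-1 ^+ m : R^o) + t^-1 *: (- (m%:R * t^-1 ^+ m.+1) * v : R^o)
      = - (m.+1%:R * t^-1 ^+ m.+2) * v :> R^o.
      by rewrite /GRing.scale /= -natr1 !exprS; ring.
    by congr is_dderive; apply/funext => s; rewrite exprS.
  have dexp : is_dderive (fun s : R^o => expR (- s^-1) : R^o) t v (expR (- t^-1) * (t^-1 * t^-1 * v)).
    have H : is_dderive (fun s : R^o => - s^-1 : R^o) t v (t^-1 * t^-1 * v).
      have cst0 : is_dderive (fun _ : R^o => 0 : R^o) t v 0.
        by rewrite /is_dderive; under eq_fun do rewrite subrr scaler0; exact: cvg_cst.
      have := is_dderive_lin (a := -1) (dinv t v tn0) cst0.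
      have -> : -1 *: (- (t^-1 * t^-1) *: (v : R^o)) + 0 = t^-1 * t^-1 * v :> R^o.
        by rewrite /GRing.scale /=; ring.
      by congr is_dderive; apply/funext => s; rewrite addr0 scaleN1r.
    have := @is_dderive_comp R R^o R^o R^o setT (fun s : R^o => - s^-1) expR
      (fun p => expR p.1 *: (p.2 : R^o)) t v _ openT I.
    apply => //; first by move=> x w _; exact: is_dderive_expR.
    apply: scale_cvg; last exact: cvg_snd.
    apply: (@cvg_comp _ _ _ fst expR); first exact: cvg_fst.
    exact: continuous_expR.
  have [cn dn] := dpow n.
  have := is_dderive_scale (f := fun s : R^o => expR (- s^-1) : R^o) _ dn dexp.
  have -> : (- (n%:R * t^-1 ^+ n.+1) * v : R^o) *: (expR (- t^-1) : R^o)
     + t^-1 ^+ n *: (expR (- t^-1) * (t^-1 * t^-1 * v) : R^o) =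
     v *: (flat_exp n.+2 t - n%:R * flat_exp n.+1 t : R^o).
    by rewrite /flat_exp t0 /GRing.scale /= !exprS; ring.
  move=> H; apply: (is_dderive_eq oU _ _ (H _)) => //.
    by move=> s /= s0; rewrite /flat_exp s0.
  apply: (@cvg_comp _ _ _ (fun s : R^o => - s^-1) expR); last exact: continuous_expR.
  by apply: cvgN; exact: cinv0.
- rewrite t0 !flat_exp_neg// mulr0 subr0 scaler0 /is_dderive flat_exp_neg//.
  (* At t = 0 the difference quotient [flat_exp n (h * v)] / h equals [v * flat_exp n.+1 (h * v)]:
     the exponent absorbs the division by h, and both vanish when h v <= 0. *)
  have H : (fun h : R => v * flat_exp n.+1 (h * v)) @ (0:R)^' --> (0 : R).
    rewrite -[X in _ --> X](mulr0 v); apply: cvgM; first exact: cvg_cst.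
    apply: (@cvg_comp _ _ _ (fun h : R => h * v) (flat_exp n.+1)); last exact: flat_exp_cvg0.
    have := @line_dcvg R^o 0 v; apply: cvg_trans; apply: near_eq_cvg; apply: nearW => h.
    by rewrite /= add0r.
  apply: cvg_trans H; apply: near_eq_cvg.
  apply: filterS (nbhs_dnbhs_neq (0:R)) => h h0 /=.
  rewrite subr0 add0r /GRing.scale /= /flat_exp; case: ifPn => [hv0|_]; last by rewrite !mulr0.
  have v0 : v != 0 by apply: contraTneq hv0 => ->; rewrite mulr0 ltxx.
  by rewrite exprS; field; rewrite h0 v0.
Qed.

Lemma flat_exp_continuous n : continuous (flat_exp n : R^o -> R^o).
Proof.
move=> t; have := @is_dderive_flat_exp n t 1; set l := _ *: _ => H.
have K : (fun h : R => h *: (h^-1 *: (flat_exp n (t + h *: 1) - flat_exp n t)) + flat_exp n t : R^o) @ (0:R)^'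
   --> (flat_exp n t : R^o).
  rewrite -[X in _ --> X]add0r -[X in _ --> X + _](scale0r l).
  apply: add_cvg; last exact: cvg_cst.
  by apply: scale_cvg => //; exact: nbhs_dnbhs.
apply/continuous_withinNshiftx; apply: cvg_trans K; apply: near_eq_cvg.
apply: filterS (nbhs_dnbhs_neq (0:R)) => h h0 /=.
rewrite scalerA mulfV// scale1r subrK; congr flat_exp.
by rewrite /GRing.scale /= mulr1 addrC.
Qed.

Lemma diff_class_flat_exp k n U : diff_class k U (flat_exp n : R^o -> R^o).
Proof.
elim: k n U => [|k IH] n U; first by split => // x _; exact: flat_exp_continuous.
split; first by move=> x _; exact: flat_exp_continuous.
exists (fun p : R^o * R^o => p.2 *: ((- n%:R) *: (flat_exp n.+1 p.1 : R^o) + (flat_exp n.+2 p.1 : R^o))).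
  split; first by move=> x v _; have := @is_dderive_flat_exp n x v; congr is_dderive; rewrite addrC scaleNr.
apply: diff_class_scale.
  apply: diff_class_linear => // p; exact: cvg_snd.
by apply: diff_class_lin; apply: (@diff_class_fst k R^o R^o R^o U (flat_exp _ : R^o -> R^o)).
Qed.

End ScalarCalculus.

Section ManifoldBumps.
Context {R : realType}.

Lemma compact_image (T U : topologicalType) (f : T -> U) (A : set T) :
  (forall x, A x -> {for x, continuous f}) -> compact A -> compact (f @` A).
Proof.
move=> cf; apply: continuous_compact; apply: continuous_in_subspaceT.
by move=> x /set_mem; exact: cf.
Qed.

(** The squared Euclidean distance [q] is used because it is polynomial, whereas balls of ['rV[R]_m]
    are cubes. The closed cube of half-side d = e/2 is compact and lies in the ball of radius e, and
    q >= d^2 outside it. *)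
Lemma rV_bump m (z : 'rV[R]_m) (U : set 'rV[R]_m) : nbhs z U ->
  exists b : 'rV[R]_m -> R, [/\ forall k W, diff_class k W (b : _ -> R^o),
    forall y, 0 <= b y, 0 < b z &
    exists K, [/\ compact K, K `<=` U & forall y, ~ K y -> b y = 0]].
Proof.
move=> /nbhs_ballP[e /= e0 eU]; pose d := e / 2.
have d0 : 0 < d by rewrite divr_gt0.
pose q (y : 'rV[R]_m) : R := \sum_(i < m) (y 0 i - z 0 i) ^+ 2.
exists (fun y => flat_exp 0 (d ^+ 2 - q y)); split.
- move=> k W.
  have qk : diff_class k W (fun y => d ^+ 2 - q y : R^o).
    have ck i : diff_class k W (fun y => y 0 i - z 0 i : R^o).
      apply: diff_class_add; last exact: diff_class_cst.
      apply: diff_class_linear; last exact: coord_continuous.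
      by move=> a u v; rewrite !mxE.
    have := @diff_class_lin _ k _ _ W (-1) _ _
      (@diff_class_sum R k _ _ W _ (index_enum _) predT _ (fun i _ => diff_class_scale (ck i) (ck i)))
      (diff_class_cst k W (d ^+ 2 : R^o)).
    by congr diff_class; apply/funext => y; rewrite scaleN1r addrC.
  exact: (@diff_class_comp _ k _ _ _ W setT _ (flat_exp 0 : R^o -> R^o) openT _ qk (diff_class_flat_exp _ _ _)).
- by move=> y; have /andP[] := flat_exp_le 0 (d ^+ 2 - q y).
- apply: flat_exp_pos; rewrite /q big1 ?subr0 ?exprn_gt0// => i _.
  by rewrite subrr expr0n.
exists [set y | forall i, `[z 0 i - d, z 0 i + d]%classic (y ord0 i)]; split.
- apply: (@rV_compact R m (fun i => `[z 0 i - d, z 0 i + d]%classic)) => i.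
  exact: segment_compact.
- move=> y yK; apply: eU; split => // i j; rewrite ord1.
  have /= := yK j; rewrite in_itv /= /ball /= => /andP[y1 y2].
  rewrite ltr_distl; rewrite lerBlDr in y1.
  have de : d < e by rewrite /d ltr_pdivrMr// ltr_pMr// ltr1n.
  rewrite ltrBlDr (le_lt_trans y2) ?ltrD2l//=.
  by rewrite (le_lt_trans y1) ?ltrD2l.
- move=> y yK; apply: flat_exp_neg; rewrite subr_le0 leNgt; apply/negP => qd; apply: yK => i /=.
  rewrite in_itv /= -ler_distl distrC -ler_sqr ?nnegrE// ?(ltW d0)// real_normK ?num_real//.
  apply: le_trans (ltW qd).
  rewrite -sqrrN opprB /q (bigD1 i)//= lerDl; apply: sumr_ge0 => j _; exact: sqr_ge0.
Qed.

Lemma smooth_fun_continuous m (X : manifoldType R m) (F : tvsType R) (f : X -> F) :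
  smooth_fun (atlas X) f -> continuous f.
Proof.
move=> sf x; have [c Ac cx] := atlas_cover x.
have [oc oc' cK cc cc'] := atlas_chart c Ac.
have [cf _] := sf c Ac 0%N.
apply: (@for_cont_eq X F (cdom c) ((f \o cinv c) \o c)) => //.
  by move=> y cy /=; rewrite cK.
apply: continuous_comp; first exact: cc.
by apply: cf; exists x.
Qed.

(** A bump in one chart [c] is extended by zero. Smoothness in a chart [d] is checked locally: on
    the domain of [c] by compatibility of the charts, elsewhere because the function vanishes off
    the image of [K], which is closed since X is Hausdorff. *)
Lemma manifold_bump m (X : manifoldType R m) (x : X) (O : set X) : nbhs x O ->
  exists b : X -> R, [/\ smooth_fun (atlas X) (b : X -> R^o),
    forall y, 0 <= b y, 0 < b x &
    exists K, [/\ compact K, K `<=` O & forall y, ~ K y -> b y = 0]].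
Proof.
move=> xO; have [c Ac cx] := atlas_cover x.
have [oc oc' cK cc cc'] := atlas_chart c Ac.
have cimx : cim c (c x) by exists x.
have xU : nbhs (c x) (cim c `&` cinv c @^-1` O).
  apply: filterI; first exact: open_nbhs_nbhs.
  by apply: cc' => //; rewrite cK.
have [b [sb b0 bx [K [cptK KU Kb]]]] := rV_bump xU.
have cptK' : compact (cinv c @` K).
  by apply: compact_image => // y /KU[cy _]; exact: cc'.
have dK y : (cinv c @` K) y -> cdom c y.
  by move=> [z /KU[[w cw <-] _] <-]; rewrite cK.
pose B y := if `[< cdom c y >] then b (c y) else 0.
have BK y : ~ (cinv c @` K) y -> B y = 0.
  rewrite /B; case: asboolP => // cy nK; apply: Kb => Kcy; apply: nK.
  by exists (c y) => //; exact: cK.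
exists B; split.
- move=> d Ad k; apply: (@diff_class_local R k _ R^o) => y dy.
  have [od od' dKd cd cd'] := atlas_chart d Ad.
  have [cy|ncy] := pselect (cdom c (cinv d y)).
    have oU : open (d @` (cdom d `&` cdom c)).
      have -> : d @` (cdom d `&` cdom c) = cim d `&` [set y | cdom c (cinv d y)].
        apply/seteqP; split => [_ [z [dz cz] <-]|_ [[z dz <-] /=]].
          by split; [exists z|rewrite /= dKd].
        by rewrite dKd// => cz; exists z.
      apply: (@chart_open X X _ _ d c id) => //; try exact: atlas_chart.
      by move=> w; exact: cvg_id.
    exists (d @` (cdom d `&` cdom c)); split.
    + exact: oU.
    + by case: dy cy => z dz <-; rewrite dKd// => cz; exists z.
    + have H := atlas_compat d c Ad Ac k.
      have := @diff_class_comp _ k _ _ R^o _ setT _ b openT (fun _ _ => I) H (sb k setT).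
      apply: diff_class_eq.
        exact: oU.
      by move=> _ [z [dz cz] <-] /=; rewrite dKd// /B asboolT.
  have clK := compact_closed (@manifold_hausdorff _ _ X) cptK'.
  exists (cim d `&` cinv d @^-1` (~` (cinv c @` K))); split.
  + rewrite openE => z [dz nz]; apply: filterI; first exact: open_nbhs_nbhs.
    by apply: (cd' z dz); apply: open_nbhs_nbhs; split => //; exact: closed_openC.
  + by split => // /dK.
  + apply: (@diff_class_eq R k _ R^o _ (fun _ => 0)); last exact: diff_class_cst.
      rewrite openE => z [dz nz]; apply: filterI; first exact: open_nbhs_nbhs.
      by apply: (cd' z dz); apply: open_nbhs_nbhs; split => //; exact: closed_openC.
    by move=> z [dz nz] /=; rewrite BK.
- by move=> y; rewrite /B; case: asboolP.
- by rewrite /B asboolT.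
exists (cinv c @` K); split => // _ [y /KU[_ Oy] <-].
exact: Oy.
Qed.

Lemma manifold_compact_nbhs m (X : manifoldType R m) (x : X) (O : set X) : nbhs x O ->
  exists K, [/\ compact K, nbhs x K & K `<=` O].
Proof.
move=> /manifold_bump[b [sb b0 bx [K [cK KO Kb]]]]; exists K; split => //.
have : nbhs x [set y | 0 < b y].
  exact: (smooth_fun_continuous sb (open_nbhs_nbhs (conj (@open_gt R 0) bx))).
apply: filterS => y /= by0.
by apply: contrapT => /Kb by0'; rewrite by0' ltxx in by0.
Qed.

End ManifoldBumps.

Lemma cvg_le (R : realType) (T : Type) (F : set_system T) (FF : ProperFilter F)
  (f g : T -> R) (l m : R) : f @ F --> l -> g @ F --> m -> F [set t | f t <= g t] -> l <= m.
Proof.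
move=> fl gm fg; rewrite -subr_ge0.
apply: (@closed_cvg _ _ F FF (fun t => g t - f t) [set x : R | 0 <= x]).
- exact: closed_ge.
- by apply: filterS fg => t /=; rewrite subr_ge0.
- exact: cvgB.
Qed.

(** The cone of nonnegative functions on which the covering ratios and their limit [I] are studied;
    signed and vector-valued integrands are the functions of [csc]. *)
Definition compact_bump (R : realType) (T : topologicalType) : set (T -> R) :=
  [set f : T -> R | [/\ continuous f, forall x, 0 <= f x &
    exists2 L, compact L & forall x, ~ L x -> f x = 0]].
Arguments compact_bump {R T} f.

Section CompactBumps.
Context {R : realType} {T : topologicalType}.
Implicit Types f g : T -> R.

Lemma compact_bumpD f g : compact_bump f -> compact_bump g -> compact_bump (fun x => f x + g x).
Proof.
move=> [cf f0 [K cK Kf]] [cg g0 [L cL Lg]]; split.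
- by move=> x; apply: cvgD; [exact: cf|exact: cg].
- by move=> x; rewrite addr_ge0.
exists (K `|` L); first exact: compactU.
by move=> x /not_orP[/Kf-> /Lg->]; rewrite addr0.
Qed.

Lemma compact_bumpM f g : compact_bump f -> continuous g -> (forall x, 0 <= g x) ->
  compact_bump (fun x => g x * f x).
Proof.
move=> [cf f0 [K cK Kf]] cg g0; split.
- by move=> x; apply: cvgM; [exact: cg|exact: cf].
- by move=> x; rewrite mulr_ge0.
by exists K => // x /Kf->; rewrite mulr0.
Qed.

Lemma compact_bumpZ c f : 0 <= c -> compact_bump f -> compact_bump (fun x => c * f x).
Proof. by move=> c0 hf; apply: compact_bumpM => // x; exact: cvg_cst. Qed.

Lemma compact_bump0 : compact_bump (fun _ : T => 0 : R).
Proof.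
by split => //; [move=> x; exact: cvg_cst|exists set0 => //; exact: compact0].
Qed.

Lemma compact_bump_sum (I : Type) (s : seq I) (F : I -> T -> R) :
  (forall i, compact_bump (F i)) -> compact_bump (fun x => \sum_(i <- s) F i x).
Proof.
move=> hF; elim: s => [|i s IH].
  by under eq_fun do rewrite big_nil; exact: compact_bump0.
by under eq_fun do rewrite big_cons; exact: compact_bumpD.
Qed.

Lemma compact_bump_bounded f : compact_bump f -> exists2 B, 0 < B & forall x, f x <= B.
Proof.
move=> [cf f0 [L cL Lf]].
have [x Lx|s [_ sL]] := compact_finite_subcover (O := fun x => [set y | f y < f x + 1]) cL.
  apply: (cf x [set t : R | t < f x + 1]); apply: open_nbhs_nbhs; split; first exact: open_lt.
  by rewrite /= ltrDl.
exists (1 + \sum_(x <- s) (f x + 1)).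
  by apply: ltr_pwDl => //; apply: sumr_ge0 => x _; rewrite addr_ge0.
move=> y; have [/sL[x xs /= fy]|/Lf->] := pselect (L y); last first.
  by rewrite addr_ge0// sumr_ge0// => x _; rewrite addr_ge0.
apply: (le_trans (ltW fy)); rewrite (big_rem x)//=; set r := \sum_(_ <- _) _.
have r0 : 0 <= r by apply: sumr_ge0 => z _; rewrite addr_ge0.
by lra.
Qed.

End CompactBumps.

(** * The Haar functional *)

Section HaarFunctional.
Context {R : realType} {n : nat} {G : lieGroupType R n}.
Implicit Types (f g phi : G -> R) (s : seq (R * G)).

Lemma lie_mul_continuous : continuous (fun p : G * G => (p.1 * p.2)%g).
Proof. by have [] := @lie_mul_smooth R n G. Qed.

Lemma lie_inv_continuous : continuous (fun x : G => x^-1%g).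
Proof. by have [] := @lie_inv_smooth R n G. Qed.

Lemma lmul_continuous (t : G) : continuous (fun x : G => (t * x)%g).
Proof.
move=> x; apply: (@continuous_comp _ _ _ (fun x => (t, x)) (fun p : G * G => (p.1 * p.2)%g)).
  by apply: cvg_pair; [exact: cvg_cst|exact: cvg_id].
exact: lie_mul_continuous.
Qed.

Lemma compact_bump_lmul f t : compact_bump f -> compact_bump (fun x => f (t * x)%g).
Proof.
move=> [cf f0 [K cK Kf]]; split => //.
  by move=> x; apply: continuous_comp; [exact: lmul_continuous|exact: cf].
exists ((fun x => t^-1 * x)%g @` K).
  by apply: compact_image => // x _; exact: lmul_continuous.
move=> x nK; apply: Kf => Kx; apply: nK; exists (t * x)%g => //.
by rewrite mulgA mulVg mul1g.
Qed.

(* A finite sequence of pairs (c, g) encodes the combination of the translates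
   x |-> c phi(g x), and in [wsum] below the discrete measure of mass c at each g. *)
Definition mass s : R := \sum_(p <- s) p.1.

Definition dominated f phi s : Prop :=
  all (fun p => 0 <= p.1) s /\ forall x, f x <= \sum_(p <- s) p.1 * phi (p.2 * x)%g.

(** The Haar covering number (f : phi). The infimum of the empty set is 0, a degenerate case
    excluded below by asking that [phi] be positive at some point [x0]. *)
Definition cover_ratio f phi : R := inf [set mass s | s in dominated f phi].

Lemma mass_ge0 s : all (fun p => 0 <= p.1) s -> 0 <= mass s.
Proof. by move=> /allP s0; rewrite /mass big_seq sumr_ge0// => p /s0. Qed.

Lemma mass_cat s1 s2 : mass (s1 ++ s2) = mass s1 + mass s2.
Proof. by rewrite /mass big_cat. Qed.

Lemma dominated_exists f phi x0 : compact_bump f -> compact_bump phi -> 0 < phi x0 ->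
  exists s, dominated f phi s.
Proof.
move=> [cf f0 [L cL Lf]] [cp p0 _] px0; pose d := phi x0 / 2.
have d0 : 0 < d by rewrite divr_gt0.
have [x Lx|s [_ sL]] := compact_finite_subcover
    (O := fun x => [set y | f y < f x + 1] `&` [set y | d < phi (x0 * x^-1 * y)%g]) cL.
  apply: filterI.
    apply: (cf x [set t : R | t < f x + 1]); apply: open_nbhs_nbhs; split; first exact: open_lt.
    by rewrite /= ltrDl.
  have : {for x, continuous (fun y => phi (x0 * x^-1 * y)%g)}.
    by apply: continuous_comp; [exact: lmul_continuous|exact: cp].
  move=> /(_ [set t : R | t > d]); apply; apply: open_nbhs_nbhs; split; first exact: open_gt.
  by rewrite /= -mulgA mulVg mulg1 /d ltr_pdivrMr// ltr_pMr// ltr1n.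
(* Near x the translate phi(x0 x^-1 y) exceeds d and f is below f x + 1, so a single term with this
   coefficient already dominates f there. *)
exists [seq ((f x + 1) / d, (x0 * x^-1)%g) | x <- s]; split.
  by apply/allP => _ /mapP[x _ ->] /=; rewrite divr_ge0 ?addr_ge0// ltW.
have t0 x y : 0 <= (f x + 1) / d * phi (x0 * x^-1 * y)%g.
  by rewrite mulr_ge0// divr_ge0 ?addr_ge0// ltW.
move=> y; rewrite big_map /=; have [/sL[x xs /= [fy dy]]|/Lf->] := pselect (L y); last first.
  exact: sumr_ge0.
rewrite (big_rem x)//= -[leLHS]addr0; apply: lerD; last exact: sumr_ge0.
apply: (le_trans (ltW fy)); rewrite mulrAC ler_pdivlMr// ler_wpM2l ?addr_ge0// ltW//.
Qed.

Lemma cover_ratio_ge0 f phi : 0 <= cover_ratio f phi.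
Proof.
rewrite /cover_ratio; have [->|/set0P[x xS]] := eqVneq [set mass s | s in dominated f phi] set0.
  by rewrite inf0.
apply: lb_le_inf; first by exists x.
by move=> _ [s [s0 _] <-]; exact: mass_ge0.
Qed.

Lemma cover_ratio_le f phi s : dominated f phi s -> cover_ratio f phi <= mass s.
Proof.
move=> sf; apply: ge_inf; last by exists s.
by exists 0 => _ [s' [s0 _] <-]; exact: mass_ge0.
Qed.

Lemma cover_ratio_lb f phi x0 c : compact_bump f -> compact_bump phi -> 0 < phi x0 ->
  (forall s, dominated f phi s -> c <= mass s) -> c <= cover_ratio f phi.
Proof.
move=> hf hp px0 H; apply: lb_le_inf.
  by have [s sP] := dominated_exists hf hp px0; exists (mass s), s.
by move=> _ [s sP <-]; exact: H.
Qed.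

Section Ratio.
Variables (phi : G -> R) (x0 : G).
Hypotheses (hp : compact_bump phi) (px0 : 0 < phi x0).

Let phi0 x : 0 <= phi x. Proof. by case: hp. Qed.

Lemma cover_ratio_mono f g : compact_bump g -> (forall x, f x <= g x) ->
  cover_ratio f phi <= cover_ratio g phi.
Proof.
move=> hg fg; apply: (cover_ratio_lb hg hp px0) => s [s0 sg].
by apply: cover_ratio_le; split => // x; exact: le_trans (fg x) (sg x).
Qed.

Lemma cover_ratioD f g : compact_bump f -> compact_bump g ->
  cover_ratio (fun x => f x + g x) phi <= cover_ratio f phi + cover_ratio g phi.
Proof.
move=> hf hg; rewrite -lerBlDr; apply: (cover_ratio_lb hf hp px0) => s [s0 sf].
rewrite lerBlDr -lerBlDl; apply: (cover_ratio_lb hg hp px0) => t [t0 tg].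
rewrite lerBlDl -mass_cat; apply: cover_ratio_le; split; first by rewrite all_cat s0.
by move=> x; rewrite big_cat lerD.
Qed.

Lemma cover_ratio0 : cover_ratio (fun _ => 0) phi = 0.
Proof.
apply/eqP; rewrite eq_le cover_ratio_ge0 andbT.
rewrite -[leRHS](_ : mass [::] = 0); last by rewrite /mass big_nil.
by apply: cover_ratio_le; split => // x; rewrite big_nil.
Qed.

Lemma cover_ratioZ c f : 0 <= c -> compact_bump f ->
  cover_ratio (fun x => c * f x) phi <= c * cover_ratio f phi.
Proof.
move=> c0 hf; have [->|cn0] := eqVneq c 0.
  by under [X in cover_ratio X _]eq_fun do rewrite mul0r; rewrite cover_ratio0 mul0r.
have cp : 0 < c by rewrite lt_neqAle eq_sym cn0.
rewrite -ler_pdivrMl//; apply: (cover_ratio_lb hf hp px0) => s [s0 sf].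
rewrite ler_pdivrMl//.
have -> : c * mass s = mass [seq (c * p.1, p.2) | p <- s] by rewrite /mass big_map mulr_sumr.
apply: cover_ratio_le; split.
  by rewrite all_map; apply: sub_all s0 => p /= p0; rewrite mulr_ge0.
move=> x; rewrite big_map /=; under eq_bigr do rewrite -mulrA.
by rewrite -mulr_sumr ler_wpM2l.
Qed.

Lemma cover_ratio_lmul_le t f : compact_bump f ->
  cover_ratio (fun x => f (t * x)%g) phi <= cover_ratio f phi.
Proof.
move=> hf; apply: (cover_ratio_lb hf hp px0) => s [s0 sf].
have -> : mass s = mass [seq (p.1, (p.2 * t)%g) | p <- s] by rewrite /mass big_map.
apply: cover_ratio_le; split; first by rewrite all_map.
by move=> x; rewrite big_map /=; under eq_bigr do rewrite -mulgA.
Qed.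

Lemma cover_ratio_lmul t f : compact_bump f ->
  cover_ratio (fun x => f (t * x)%g) phi = cover_ratio f phi.
Proof.
move=> hf; apply/eqP; rewrite eq_le cover_ratio_lmul_le//=.
have := cover_ratio_lmul_le t^-1%g (compact_bump_lmul t hf).
by under [X in cover_ratio X _ <= _]eq_fun do rewrite mulgA mulgV mul1g.
Qed.

(** Submultiplicativity (f : phi) <= (f : g)(g : phi), kept at the level of one covering of f by g.
    The factor [mass s] is independent of [phi]: this bounds the normalised ratios, and later bounds
    their limit away from 0. *)
Lemma cover_ratio_comp f g s : compact_bump f -> compact_bump g -> dominated f g s ->
  cover_ratio f phi <= mass s * cover_ratio g phi.
Proof.
move=> hf hg [s0 sf].
have H : compact_bump (fun x => \sum_(p <- s) p.1 * g (p.2 * x)%g) /\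
    cover_ratio (fun x => \sum_(p <- s) p.1 * g (p.2 * x)%g) phi <= mass s * cover_ratio g phi.
  elim: s s0 {sf} => [_|p s IH /= /andP[p0 s0]].
    have -> : (fun x : G => \sum_(p <- [::]) p.1 * g (p.2 * x)%g) = (fun _ => 0 : R).
      by apply/funext => x; rewrite big_nil.
    by split; [exact: compact_bump0|rewrite cover_ratio0 /mass big_nil mul0r].
  have [hs sl] := IH s0; have hpg : compact_bump (fun x => p.1 * g (p.2 * x)%g).
    by apply: compact_bumpZ => //; exact: compact_bump_lmul.
  have E : (fun x => \sum_(q <- p :: s) q.1 * g (q.2 * x)%g) =
     (fun x => p.1 * g (p.2 * x)%g + \sum_(q <- s) q.1 * g (q.2 * x)%g).
    by apply/funext => x; rewrite big_cons.
  rewrite E; split; first exact: compact_bumpD.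
  apply: le_trans (cover_ratioD hpg hs) _.
  rewrite /mass big_cons mulrDl lerD//.
  apply: le_trans (cover_ratioZ p0 (compact_bump_lmul p.2 hg)) _.
  by rewrite cover_ratio_lmul.
by case: H => hs; apply: le_trans; exact: cover_ratio_mono.
Qed.

(** If B bounds [phi], every covering satisfies f x <= [mass s] B, so all masses are at least f x /
    B. *)
Lemma cover_ratio_gt0 f x : compact_bump f -> 0 < f x -> 0 < cover_ratio f phi.
Proof.
move=> hf fx; have [B B0 pB] := compact_bump_bounded hp.
apply: (@lt_le_trans _ _ (f x / B)); first by rewrite divr_gt0.
apply: (cover_ratio_lb hf hp px0) => s [s0 sf].
rewrite ler_pdivrMr//; apply: (le_trans (sf x)).
rewrite /mass mulr_suml big_seq [leRHS]big_seq; apply: ler_sum => p ps.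
by rewrite ler_wpM2l//; move/allP : s0 => /(_ _ ps).
Qed.

End Ratio.
End HaarFunctional.

Section HaarExistence.
Context {R : realType} {n : nat} {G : lieGroupType R n}.
Implicit Types (f g phi : G -> R) (s : seq (R * G)).

(** Only products z = x u in the support can violate the inequality, so z ranges over a compact set
    and is compared with z u^-1; compactness then gives one neighbourhood of u = 1 for all z. *)
Lemma uniform_continuous_bump (h : G -> R) (d : R) : compact_bump h -> 0 < d ->
  exists2 U, nbhs (1%g : G) U & forall u x : G, U u -> h (x * u)%g <= h x + d.
Proof.
move=> [ch h0 [L cL Lh]] d0.
have H : nbhs (1%g : G) [set u | L `<=` fun z => h z < h (z * u^-1)%g + d].
  apply: ((compact_near_coveringP L).1 cL G (nbhs (1%g : G)) (fun u z => h z < h (z * u^-1)%g + d)).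
  move=> z Lz.
  have : {for (z, (1 : G)%g), continuous (fun p : G * G => h (p.1 * p.2^-1)%g + d - h p.1)}.
    have cF : {for (z, (1 : G)%g), continuous (fun p : G * G => h (p.1 * p.2^-1)%g)}.
      apply: (@continuous_comp _ _ _ (fun p : G * G => (p.1 * p.2^-1)%g) h); last exact: ch.
      apply: (@continuous_comp _ _ _ (fun p : G * G => (p.1, p.2^-1%g)) (fun p : G * G => (p.1 * p.2)%g));
        last exact: lie_mul_continuous.
      apply: cvg_pair; first exact: cvg_fst.
      apply: (@cvg_comp _ _ _ snd (fun x : G => x^-1%g)); first exact: cvg_snd.
      exact: lie_inv_continuous.
    apply: cvgB.
      by apply: cvgD; [exact: cF|exact: cvg_cst].
    by apply: (@cvg_comp _ _ _ fst h); [exact: cvg_fst|exact: ch].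
  move=> /(_ [set t : R | 0 < t]) /=; rewrite invg1 mulg1 addrAC subrr add0r.
  move=> /(_ (open_nbhs_nbhs (conj (@open_gt R 0) d0))).
  apply: (@filterS _ (nbhs (z, 1%g : G)) _ [set p : G * G | 0 < h (p.1 * p.2^-1)%g + d - h p.1]).
  by move=> -[x u] /=; rewrite subr_gt0.
exists [set u | L `<=` fun z => h z < h (z * u^-1)%g + d] => // u x {}H.
have [/H|/Lh->] := pselect (L (x * u)%g).
  by rewrite -mulgA mulgV mulg1 => /ltW.
by rewrite addr_ge0// ltW.
Qed.

Lemma compact_bump_pos (L : set G) : compact L ->
  exists2 th : G -> R, compact_bump th & forall x, L x -> 0 < th x.
Proof.
move=> cL; pose P (x : G) (b : G -> R) := compact_bump b /\ 0 < b x.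
have /boolp.choice[b bP] : forall x, exists b, P x b.
  move=> x; have [b [sb b0 bx [K [cK _ Kb]]]] := manifold_bump (@filterT _ (nbhs x) _).
  exists b; split => //; split => //; last by exists K.
  exact: (smooth_fun_continuous sb).
have [x Lx|s [sL Ls]] := compact_finite_subcover (O := fun x => [set y | 0 < b x y]) cL.
  have [[cb _ _] bx] := bP x.
  exact: (cb x _ (open_nbhs_nbhs (conj (@open_gt R 0) bx))).
exists (fun y => \sum_(x <- s) b x y).
  by apply: compact_bump_sum => x; have [] := bP x.
move=> y /Ls[x xs /= bxy]; rewrite (big_rem x)//= ltr_pwDl//.
by apply: sumr_ge0 => z _; have [[]] := bP z.
Qed.

(* Weil's argument: with F = f + g + d th, the weights f / F and g / F are nearly constant
   on translates of a small support, so they split a covering of F into ones of f and g. *)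
Lemma cover_ratio_superadditive f g : compact_bump f -> compact_bump g ->
  exists2 th : G -> R, compact_bump th & forall d : R, 0 < d ->
  exists2 U : set G, nbhs (1%g : G) U &
    forall phi x0, compact_bump phi -> 0 < phi x0 -> (forall x, phi x != 0 -> U x) ->
    cover_ratio f phi + cover_ratio g phi <=
    (1 + d *+ 2) * (cover_ratio (fun x => f x + g x) phi + d * cover_ratio th phi).
Proof.
move=> hf hg; have [cf f0 [K1 cK1 K1f]] := hf; have [cg g0 [K2 cK2 K2g]] := hg.
pose L := K1 `|` K2; have cL : compact L by exact: compactU.
have clL : closed L := compact_closed (@manifold_hausdorff _ _ G) cL.
have [th hth thL] := compact_bump_pos cL; have [cth th0 _] := hth.
exists th => // d d0.
pose F x := (f x + g x) + d * th x.
have hF : compact_bump F by apply: compact_bumpD; [exact: compact_bumpD|apply: compact_bumpZ => //; exact: ltW].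
have [cF F0 _] := hF.
(* On [L] the term d th keeps F positive; on the open complement the quotient is identically 0,
   because k is. *)
have quot_bump k : compact_bump k -> (forall x, ~ L x -> k x = 0) -> compact_bump (fun x => k x / F x).
  move=> [ck k0 [K cK Kk]] Lk; split; last 2 first.
  - by move=> x; rewrite divr_ge0.
  - by exists K => // x /Kk->; rewrite mul0r.
  move=> x; have [Lx|nLx] := pselect (L x).
    apply: cvgM; first exact: ck.
    apply: cvgV; last exact: cF.
    by rewrite gt_eqF// /F ltr_wpDl ?addr_ge0// mulr_gt0// thL.
  have oL : open (~` L) by exact: closed_openC.
  apply: (for_cont_eq (f := fun _ => 0 : R) oL nLx); last exact: cvg_cst.
  by move=> y nLy; rewrite Lk// mul0r.
have hf1 := quot_bump f hf (fun x nL => K1f x (fun k => nL (or_introl k))).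
have hg1 := quot_bump g hg (fun x nL => K2g x (fun k => nL (or_intror k))).
have [U1 U1n HU1] := uniform_continuous_bump hf1 d0.
have [U2 U2n HU2] := uniform_continuous_bump hg1 d0.
exists (U1 `&` U2); first exact: filterI.
move=> phi x0 hp px0 phiU; have phi0 x : 0 <= phi x by case: hp.
have FE k (x : G) : 0 <= k x -> k x <= F x -> k x = F x * (k x / F x).
  have [->|Fn0 _ _] := eqVneq (F x) 0; last by rewrite mulrCA mulfV// mulr1.
  by move=> k1 k2; apply/eqP; rewrite mul0r eq_le k1 k2.
have fF x : f x <= F x by rewrite /F -addrA lerDl addr_ge0// mulr_ge0// ltW.
have gF x : g x <= F x by rewrite /F; have := mulr_ge0 (ltW d0) (th0 x); have := f0 x; lra.
(* If phi(p.2 x) is nonzero then u = p.2 x lies in [U] and x = p.2^-1 u, so the quotient k / F at x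
   exceeds its value at the centre p.2^-1 by at most d. Multiplying each coefficient by that value
   plus d turns a covering of F into one of k. *)
have bnd k (U : set G) s : (forall u x, U u -> k (x * u)%g / F (x * u)%g <= k x / F x + d) ->
    (forall x, 0 <= k x) -> (forall x, k x <= F x) -> (forall x, phi x != 0 -> U x) ->
    dominated F phi s -> cover_ratio k phi <= \sum_(p <- s) p.1 * (k p.2^-1%g / F p.2^-1%g + d).
  move=> HU k0 kF pU [s0 sF].
  have -> : \sum_(p <- s) p.1 * (k p.2^-1%g / F p.2^-1%g + d) =
      mass [seq (p.1 * (k p.2^-1%g / F p.2^-1%g + d), p.2) | p <- s] by rewrite /mass big_map.
  apply: cover_ratio_le; split.
    rewrite all_map; apply: sub_all s0 => p /= p0.
    by rewrite mulr_ge0// addr_ge0 ?(ltW d0)// divr_ge0.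
  move=> x; rewrite FE// big_map /=.
  apply: (@le_trans _ _ ((\sum_(p <- s) p.1 * phi (p.2 * x)%g) * (k x / F x))).
    by rewrite ler_wpM2r ?divr_ge0.
  rewrite mulr_suml big_seq [leRHS]big_seq; apply: ler_sum => p ps.
  have p0 : 0 <= p.1 by move/allP : s0 => /(_ _ ps).
  have [->|pn0] := eqVneq (phi (p.2 * x)%g) 0; first by rewrite !mulr0 mul0r.
  rewrite mulrAC ler_wpM2r// ler_wpM2l//.
  by have := HU _ p.2^-1%g (pU _ pn0); rewrite mulgA mulVg mul1g.
have d2 : 0 < 1 + d *+ 2 by rewrite ltr_wpDr// mulrn_wge0// ltW.
have : cover_ratio f phi + cover_ratio g phi <= (1 + d *+ 2) * cover_ratio F phi.
  rewrite -ler_pdivrMl//; apply: (cover_ratio_lb hF hp px0) => s sF.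
  rewrite ler_pdivrMl//.
  have := lerD (bnd f U1 s HU1 f0 fF (fun x h => (phiU x h).1) sF)
    (bnd g U2 s HU2 g0 gF (fun x h => (phiU x h).2) sF).
  move=> /le_trans; apply; rewrite -big_split /= /mass mulr_sumr.
  have [/allP s0 _] := sF; rewrite big_seq [leRHS]big_seq; apply: ler_sum => p ps.
  (* Since f + g <= F, the two weights at one centre add up to at most 1 + 2 d. *)
  rewrite -mulrDr [leRHS]mulrC ler_wpM2l ?s0// addrACA -mulr2n lerD2r -mulrDl.
  set y := p.2^-1%g; have [->|Fn0] := eqVneq (F y) 0; first by rewrite invr0 mulr0.
  rewrite ler_pdivrMr ?lt_neqAle 1?eq_sym ?Fn0 ?F0// mul1r /F lerDl.
  by rewrite mulr_ge0// ltW.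
move=> /le_trans; apply; rewrite ler_wpM2l ?(ltW d2)//.
have hfg := compact_bumpD hf hg; have hdt := compact_bumpZ (ltW d0) hth.
apply: le_trans (cover_ratioD hp px0 hfg hdt) _.
by rewrite lerD2l (cover_ratioZ hp px0)// ltW.
Qed.

End HaarExistence.

Record haar_functional (R : realType) (n : nat) (G : lieGroupType R n) (I : (G -> R) -> R) : Prop :=
  HaarFunctional {
  haarD : forall f g, compact_bump f -> compact_bump g -> I (fun x => f x + g x) = I f + I g;
  haarZ : forall c f, 0 <= c -> compact_bump f -> I (fun x => c * f x) = c * I f;
  haar_ge0 : forall f, compact_bump f -> 0 <= I f;
  haar_lmul : forall t f, compact_bump f -> I (fun x => f (t * x)%g) = I f;
  haar_gt0 : forall f x, compact_bump f -> 0 < f x -> 0 < I f }.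

Section HaarExists.
Context {R : realType} {n : nat} {G : lieGroupType R n}.
Implicit Types (f g phi : G -> R) (s : seq (R * G)).

Let tests (U : set G) : set (G -> R) :=
  [set phi | [/\ compact_bump phi, exists x, 0 < phi x & forall x, phi x != 0 -> U x]].

(* The functional is the limit of f |-> (f : phi) / (f0 : phi) along an ultrafilter of
   bumps phi whose supports shrink to 1. *)
Lemma haar_exists : exists I : (G -> R) -> R, haar_functional I.
Proof.
have bump1 U : nbhs (1%g : G) U -> exists b : G -> R, tests U b /\ 0 < b 1%g.
  move=> /manifold_bump[b [sb b0 bx [K [cK KU Kb]]]]; exists b; split => //; split.
  - by split => //; [exact: (smooth_fun_continuous sb)|exists K].
  - by exists 1%g.
  - by move=> x bx0; apply: KU; apply: contrapT => /Kb /eqP; apply/negP.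
have [f0 [[hf0 _ _] f01]] := bump1 setT (@filterT _ _ _).
pose F := filter_from (nbhs (1%g : G)) tests.
have FF : ProperFilter F.
  apply: filter_from_proper; last by move=> U /bump1[b [hb _]]; exists b.
  apply: filter_from_filter; first by exists setT; exact: filterT.
  move=> U V nU nV; exists (U `&` V); first exact: filterI.
  by move=> b [hb bx bUV]; split; split => // x /bUV[].
have [UU [ultU FU]] := ultraFilterLemma FF.
have PU : ProperFilter UU := @ultra_proper _ _ ultU.
have FUU : Filter UU by case: PU.
have near_tests U : nbhs (1%g : G) U -> UU (tests U).
  by move=> nU; apply: FU; exists U.
have nT : UU (tests setT) by apply: near_tests; exact: filterT.
pose J f phi := cover_ratio f phi / cover_ratio f0 phi.
have Jcvg f : compact_bump f -> exists l : R, J f @ UU --> l.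
  move=> hf; have [s sf] := dominated_exists hf hf0 f01.
  (* The upper end does not depend on [phi], so the values stay in one compact segment, where an
     ultrafilter converges. *)
  have memJ : UU (J f @^-1` `[0, mass s]%classic).
    apply: filterS nT => phi [hp [x px] _] /=.
    have c0 := cover_ratio_gt0 hp px hf0 f01.
    rewrite in_itv /= /J divr_ge0 ?cover_ratio_ge0//= ler_pdivrMr//.
    exact: (cover_ratio_comp hp px).
  have [l [_ Hl]] := @segment_compact R 0 (mass s) (J f @ UU) _ memJ.
  exists l => A nA; have [//|nU] := in_ultra_setVsetC (J f @^-1` A) ultU.
  by have [y [nAy Ay]] := Hl (~` A) A nU nA.
pose I f := xget 0 [set l : R | J f @ UU --> l].
have Icvg f : compact_bump f -> J f @ UU --> I f.
  by move=> /Jcvg[l Hl]; rewrite /I; exact: (@xgetPex _ 0 [set l : R | J f @ UU --> l] (ex_intro _ l Hl)).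
have uniq (k : (G -> R) -> R) (l m : R) : k @ UU --> l -> k @ UU --> m -> l = m.
  move=> kl km; have kk : UU [set phi | k phi <= k phi] by apply: filterE => phi /=.
  by apply/eqP; rewrite eq_le (cvg_le PU kl km kk) (cvg_le PU km kl kk).
exists I.
have I0 f : compact_bump f -> 0 <= I f.
  move=> /Icvg Hf; apply: (cvg_le PU (@cvg_cst _ (0 : R) _ UU _) Hf).
  by apply: filterE => phi /=; rewrite divr_ge0 ?cover_ratio_ge0.
have IZle c f : 0 <= c -> compact_bump f -> I (fun x => c * f x) <= c * I f.
  move=> c0 hf; apply: (cvg_le PU (Icvg _ (compact_bumpZ c0 hf))).
    by apply: cvgM; [exact: cvg_cst|exact: Icvg].
  apply: filterS nT => phi [hp [x px] _] /=; rewrite /J mulrA ler_wpM2r ?invr_ge0 ?cover_ratio_ge0//.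
  exact: (cover_ratioZ hp px).
split => //.
- move=> f g hf hg; have hfg := compact_bumpD hf hg.
  apply/eqP; rewrite eq_le; apply/andP; split.
    apply: (cvg_le PU (Icvg _ hfg)); first by apply: cvgD; exact: Icvg.
    apply: filterS nT => phi [hp [x px] _] /=.
    by rewrite /J -mulrDl ler_wpM2r ?invr_ge0 ?cover_ratio_ge0// (cover_ratioD hp px).
  have [th hth H] := cover_ratio_superadditive hf hg.
  set b := I (fun x => f x + g x); have b0 : 0 <= b by exact: I0.
  have t0 := I0 _ hth.
  suff le_d (d : R) : 0 < d -> I f + I g <= (1 + d *+ 2) * (b + d * I th).
    (* For d <= 1 the excess of (1 + 2 d)(b + d t) over b is d (2 b + t + 2 d t) <= d (2 b + 3 t),
       where t is [I th]; the added 1 makes [c] positive. *)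
    apply/ler_addgt0Pr => e e0; pose c := 2 * b + 3 * I th + 1.
    have c0 : 0 < c by rewrite /c; lra.
    pose d := Num.min 1 (e / c).
    have d0 : 0 < d by rewrite lt_min ltr01 divr_gt0.
    have d1 : d <= 1 by rewrite ge_min lexx.
    have dc : d * c <= e by rewrite -ler_pdivlMr// ge_min lexx orbT.
    apply: (le_trans (le_d d d0)).
    have dt : d * (d * I th) <= d * I th by rewrite ler_wpM2l ?(ltW d0)// ler_piMl.
    have dt0 : 0 <= d * I th by rewrite mulr_ge0// ltW.
    by rewrite /c in dc; nra.
  move=> d0; have {H}[U nU H] := H _ d0.
  have L1 : (fun phi => J f phi + J g phi) @ UU --> I f + I g by apply: cvgD; exact: Icvg.
  apply: (cvg_le PU L1 (g := fun phi => (1 + d *+ 2) * (J (fun x => f x + g x) phi + d * J th phi))).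
    apply: cvgM; first exact: cvg_cst.
    apply: cvgD; first exact: Icvg.
    by apply: cvgM; [exact: cvg_cst|exact: Icvg].
  apply: filterS (near_tests U nU) => phi [hp [x px] pU] /=.
  rewrite /J [d * _]mulrA -!mulrDl mulrA ler_wpM2r ?invr_ge0 ?cover_ratio_ge0//.
  exact: (H phi x).
- move=> c f c0 hf; apply/eqP; rewrite eq_le IZle//=.
  have [->|cn0] := eqVneq c 0; first by rewrite mul0r; apply: I0; exact: compact_bumpZ.
  have cp : 0 < c by rewrite lt_neqAle eq_sym cn0.
  rewrite -ler_pdivlMl//.
  have := IZle c^-1 (fun x => c * f x); rewrite invr_ge0 c0 => /(_ isT (compact_bumpZ c0 hf)).
  by under [X in I X <= _]eq_fun do rewrite mulrA mulVf// mul1r.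
- move=> t f hf; apply: (uniq _ _ _ (Icvg _ (compact_bump_lmul t hf))).
  apply: cvg_trans (Icvg _ hf); apply: near_eq_cvg.
  apply: filterS nT => phi [hp [x px] _] /=.
  by rewrite /J (cover_ratio_lmul hp px).
(* Translates of f cover f0, so 1 = [J f0 phi] <= [mass s * J f phi] for every admissible phi, and
   the bound passes to the limit. *)
- move=> f x hf fx; have [s sf] := dominated_exists hf0 hf fx.
  have : 1 <= mass s * I f.
    apply: (cvg_le PU (@cvg_cst _ (1 : R) _ UU _)).
      by apply: cvgM; [exact: cvg_cst|exact: Icvg].
    apply: filterS nT => phi [hp [y py] _] /=.
    have c0 := cover_ratio_gt0 hp py hf0 f01.
    by rewrite /J mulrA ler_pdivlMr// mul1r (cover_ratio_comp hp py).
  by rewrite lt_neqAle I0// andbT eq_sym; apply: contraTneq => ->; rewrite mulr0 -ltNge ltr01.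
Qed.

End HaarExists.

(** * Partitions of unity and approximation of the Haar functional by discrete measures *)

Section Discretization.
Context {R : realType}.

(** The bumps are divided by max(S, e), where S is their sum and e > 0 a lower bound of S on [L].
    The denominator never vanishes and equals S on [L], so the total is at most 1 everywhere and
    exactly 1 on [L]. The maximum costs smoothness, but continuity is enough for integration. *)
Lemma partition_of_unity m (X : manifoldType R m) (L : set X) (O : X -> set X) :
  compact L -> (forall x, L x -> nbhs x (O x)) ->
  exists s (psi : X -> X -> R), [/\ forall x, x \in s -> L x,
    forall x, compact_bump (psi x), forall x y, x \in s -> psi x y != 0 -> O x y,
    forall y, \sum_(x <- s) psi x y <= 1 & forall y, L y -> \sum_(x <- s) psi x y = 1].
Proof.
move=> cL LO; pose P x (b : X -> R) := [/\ compact_bump b, 0 < b x & forall y : X, L x -> b y != 0 -> O x y].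
have /boolp.choice[b bP] : forall x, exists b : X -> R, P x b.
  move=> x; have [Lx|nLx] := pselect (L x).
    have [b [sb b0 bx [K [cK KO Kb]]]] := manifold_bump (LO x Lx).
    exists b; split => //.
      by split => //; [exact: (smooth_fun_continuous sb)|exists K].
    by move=> y _ by0; apply: KO; apply: contrapT => /Kb /eqP; apply/negP.
  have [|b [sb b0 bx [K [cK KO Kb]]]] := @manifold_bump _ _ _ x setT; first exact: filterT.
  by exists b; split => //; split => //; [exact: (smooth_fun_continuous sb)|exists K].
have [x Lx|s [sL Ls]] := compact_finite_subcover (O := fun x => [set y | 0 < b x y]) cL.
  have [[cb _ _] bx _] := bP x.
  exact: (cb x _ (open_nbhs_nbhs (conj (@open_gt R 0) bx))).
have b0 x y : 0 <= b x y by have [[]] := bP x.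
pose S y := \sum_(x <- s) b x y.
have [cS S0 _] : compact_bump S by apply: compact_bump_sum => x; have [] := bP x.
have Spos y : L y -> 0 < S y.
  by move=> /Ls[x xs /= bxy]; rewrite /S (big_rem x)//= ltr_pwDl// sumr_ge0.
have [e e0 eS] : exists2 e : R, 0 < e & forall y, L y -> e <= S y.
  have : nbhs (0 : R) [set e | L `<=` fun y => e < S y].
    apply: ((compact_near_coveringP L).1 cL R (nbhs (0 : R)) (fun e y => e < S y)) => y Ly.
    have H : (fun p : X * R => S p.1 - p.2) @ (y, (0 : R)) --> S y - 0.
      by apply: cvgB; [apply: (@cvg_comp _ _ _ (fst : X * R -> X) S _ (nbhs y)); [exact: cvg_fst|exact: cS]|exact: cvg_snd].
    have Sy0 : 0 < S y - 0 by rewrite subr0 Spos.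
    apply: (@filterS _ (nbhs (y, (0 : R))) _ _ _ _ (H _ (open_nbhs_nbhs (conj (@open_gt R 0) Sy0)))).
    by move=> [z t] /=; rewrite subr_gt0.
  move=> /nbhs_ballP[e /= e0 eP]; exists (e / 2); first by rewrite divr_gt0.
  move=> y Ly; apply: ltW; apply: (eP (e / 2)) => //.
  by rewrite /ball /= sub0r normrN gtr0_norm ?divr_gt0// ltr_pdivrMr// ltr_pMr// ltr1n.
have m0 y : 0 < Num.max (S y) e by rewrite lt_max e0 orbT.
exists s, (fun x y => (Num.max (S y) e)^-1 * b x y); split => //.
- move=> x; have [hb _ _] := bP x; apply: compact_bumpM => // y; last by rewrite invr_ge0 ltW.
  apply: cvgV; first by rewrite gt_eqF.
  by apply: continuous_max => //; [exact: cS|exact: cvg_cst].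
- move=> x y xs; rewrite mulf_eq0 negb_or => /andP[_ bxy].
  by have [_ _] := bP x; apply => //; exact: sL.
- by move=> y; rewrite -mulr_sumr ler_pdivrMl// mulr1 le_max lexx.
- move=> y Ly; rewrite -mulr_sumr max_l ?eS// mulVf// gt_eqF// Spos//.
Qed.

Context {n : nat} {G : lieGroupType R n}.

Definition wsum (F : lmodType R) (mu : seq (R * G)) (f : G -> F) : F :=
  \sum_(p <- mu) p.1 *: f p.2.

Lemma wsum_lin (F : lmodType R) mu (c : R) (f g : G -> F) :
  wsum mu (fun x => c *: f x + g x) = c *: wsum mu f + wsum mu g.
Proof.
rewrite /wsum scaler_sumr -big_split /=; apply: eq_bigr => p _.
by rewrite scalerDr !scalerA mulrC.
Qed.

Lemma compact_unit (L : set G) : compact L -> exists2 th : G -> R, compact_bump th &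
  (forall x, th x <= 1) /\ forall x, L x -> th x = 1.
Proof.
move=> cL; have [x Lx|s [psi [_ hpsi _ p1 pL]]] := @partition_of_unity _ G L (fun _ => setT) cL.
  exact: filterT.
by exists (fun y => \sum_(x <- s) psi x y) => //; exact: compact_bump_sum.
Qed.

Lemma finite_compact_support (S : set (G -> R)) : finite_set S -> (forall f, S f -> compact_bump f) ->
  exists2 L, compact L & forall f x, S f -> ~ L x -> f x = 0.
Proof.
move=> fS hS.
pose F := filter_from [set K : set G | compact K] (fun K => [set K' | compact K' /\ K `<=` K']).
have FF : ProperFilter F.
  apply: filter_from_proper; last by move=> K cK; exists K; split.
  apply: filter_from_filter; first by exists set0; exact: compact0.
  move=> K K' cK cK'; exists (K `|` K'); first exact: compactU.
  by move=> K2 [cK2 KK2]; split; split => // x Kx; apply: KK2; [left|right].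
have HF : F [set L | compact L /\ forall f, S f -> forall x, ~ L x -> f x = 0].
  apply: filterI; first by exists set0; [exact: compact0|move=> K []].
  apply: (finite_near (P := fun f L => forall x, ~ L x -> f x = 0) _ fS) => f /hS[_ _ [K cK Kf]].
  by exists K => // K' [_ KK'] x nK'; apply: Kf => Kx; apply: nK'; exact: KK'.
have [L [cL Lf]] := filter_ex HF.
by exists L => // f x Sf; exact: Lf.
Qed.

Lemma haar_sum (I : (G -> R) -> R) (A : Type) (s : seq A) (F : A -> G -> R) : haar_functional I ->
  (forall a, compact_bump (F a)) ->
  I (fun x => \sum_(a <- s) F a x) = \sum_(a <- s) I (F a).
Proof.
move=> hI hF; elim: s => [|a s IH].
  have := haarZ hI (lexx 0) (@compact_bump0 R G); rewrite [RHS]mul0r big_nil => {2}<-.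
  by congr I; apply/funext => x; rewrite big_nil mul0r.
rewrite big_cons -IH -(haarD hI)//; last exact: compact_bump_sum.
by congr I; apply/funext => x; rewrite big_cons.
Qed.

Lemma haar_mono (I : (G -> R) -> R) (f g : G -> R) : haar_functional I ->
  compact_bump f -> compact_bump g -> (forall x, f x <= g x) -> I f <= I g.
Proof.
move=> hI hf hg fg; have [cf f0 [K cK Kf]] := hf; have [cg g0 [L cL Lg]] := hg.
have hgf : compact_bump (fun x => g x - f x).
  split; first by move=> x; apply: cvgB; [exact: cg|exact: cf].
    by move=> x; rewrite subr_ge0.
  exists (K `|` L); first exact: compactU.
  by move=> x /not_orP[/Kf-> /Lg->]; rewrite subr0.
have -> : g = (fun x => f x + (g x - f x)) by apply/funext => x; rewrite addrC subrK.
by rewrite (haarD hI)// lerDl (haar_ge0 hI).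
Qed.

(* A filter of discrete positive measures converging to I: it plays the role of Haar
   measure, vector-valued integrals being limits of finite sums along it. *)
Record haar_net (I : (G -> R) -> R) (FF : set_system (seq (R * G))) : Prop := HaarNet {
  haar_net_filter : ProperFilter FF;
  haar_net_ge0 : FF [set mu | all (fun p => 0 <= p.1) mu];
  haar_net_cvg : forall f, compact_bump f -> (fun mu => wsum mu (f : G -> R^o)) @ FF --> (I f : R^o) }.

(** The filter is generated by the weak neighbourhoods of [I] among positive discrete measures. That
    they are nonempty is the point: for a partition of unity fine enough for finitely many
    functions, put the mass [I (psi x)] at each centre x. *)
Lemma haar_net_exists (I : (G -> R) -> R) : haar_functional I -> exists FF, haar_net I FF.
Proof.
move=> hI.
pose D := [set q : set (G -> R) * R | [/\ finite_set q.1, forall f, q.1 f -> compact_bump f & 0 < q.2]].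
pose B (q : set (G -> R) * R) := [set mu : seq (R * G) | all (fun p => 0 <= p.1) mu /\
  forall f, q.1 f -> `|I f - wsum mu (f : G -> R^o)| < q.2].
have D1 f e : compact_bump f -> 0 < e -> D ([set f], e).
  by move=> hf e0; split => /=; [exact: finite_set1|move=> _ ->|].
suff FB : ProperFilter (filter_from D B).
  exists (filter_from D B); split => //.
    by exists (set0, 1); [split|move=> mu []].
  move=> f hf; apply/cvgrPdist_lt => e e0; exists ([set f], e); first exact: D1.
  by move=> mu [_]; apply.
apply: filter_from_proper; first apply: filter_from_filter.
- by exists (set0, 1); split.
- move=> [S e] [S' e'] [/= fS hS e0] [/= fS' hS' e'0].
  exists (S `|` S', Num.min e e').
    split => /=; first by rewrite finite_setU.
      by move=> f [/hS|/hS'].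
    by rewrite lt_min e0.
  move=> mu [mu0 H]; split; split => // f Sf /=.
    by apply: lt_le_trans (H f (or_introl Sf)) _; rewrite /= ge_min lexx.
  by apply: lt_le_trans (H f (or_intror Sf)) _; rewrite /= ge_min lexx orbT.
move=> [S e] [/= fS hS e0].
have [L cL LS] := finite_compact_support fS hS.
have [th hth [th1 thL]] := compact_unit cL.
have [cth th0 _] := hth.
have It := haar_ge0 hI hth.
(* The functions psi are supported where th > 1/2 and sum to at most 1, so their total mass is at
   most 2 [I th]. An oscillation below d thus costs at most 2 d [I th], which is less than e. *)
pose d := e / (2 * I th + 1).
have k0 : 0 < 2 * I th + 1 by rewrite ltr_wpDl// mulr_ge0.
have d0 : 0 < d by rewrite divr_gt0.
have [x Lx|s [psi [sL hpsi psiO psi1 psiL]]] := @partition_of_unity _ G L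
    (fun x => [set y | forall f, S f -> `|f x - f y| < d] `&` [set y | 1 / 2 < th y]) cL.
  apply: filterI.
    apply: (finite_near (P := fun f y => `|f x - f y| < d) _ fS) => f /hS[cf _ _].
    by have /cvgrPdist_lt := cf x; apply.
  have tx : 1 / 2 < th x by rewrite thL// ltr_pdivrMr// mul1r ltr1n.
  exact: (cth x _ (open_nbhs_nbhs (conj (@open_gt R (1 / 2)) tx))).
have psi0 x y : 0 <= psi x y by have [] := hpsi x.
exists [seq (I (psi x), x) | x <- s]; split.
  by rewrite all_map; apply/allP => x _ /=; exact: (haar_ge0 hI).
move=> f Sf /=; rewrite /wsum big_map /=; have hf := hS f Sf; have [cf f0 _] := hf.
have -> : I f = \sum_(x <- s) I (fun y => f y * psi x y).
  rewrite -haar_sum//; last by move=> x; exact: compact_bumpM.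
  congr I; apply/funext => y; rewrite -mulr_sumr.
  have [Ly|nLy] := pselect (L y); first by rewrite psiL// mulr1.
  by rewrite (LS f)// mul0r.
have -> : \sum_(x <- s) I (psi x) *: (f x : R^o) = \sum_(x <- s) f x * I (psi x).
  by apply: eq_bigr => x _; rewrite /GRing.scale /= mulrC.
rewrite -sumrB.
have bnd x : x \in s -> `|I (fun y => f y * psi x y) - f x * I (psi x)| <= d * I (psi x).
  move=> xs; have hfp : compact_bump (fun y => f y * psi x y) by exact: compact_bumpM.
  have near_x y : psi x y != 0 -> `|f x - f y| < d by move=> /(psiO _ _ xs)[/(_ _ Sf)].
  have hd := compact_bumpZ (ltW d0) (hpsi x).
  have hx := compact_bumpZ (f0 x) (hpsi x).
  rewrite ler_distl lerBlDr -(haarZ hI (ltW d0))// -(haarZ hI (f0 x))// -!(haarD hI)//.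
  apply/andP; split; apply: (haar_mono hI); try exact: compact_bumpD; try by [].
    move=> y; have [->|/near_x] := eqVneq (psi x y) 0; first by rewrite !mulr0 addr0.
    by rewrite -mulrDl ltr_distl => /andP[_ /ltW H]; rewrite ler_wpM2r.
  move=> y; have [->|/near_x] := eqVneq (psi x y) 0; first by rewrite !mulr0 addr0.
  by rewrite distrC -mulrDl ltr_distl => /andP[_ /ltW H]; rewrite ler_wpM2r.
apply: (@le_lt_trans _ _ (d * (2 * I th))); last first.
  by rewrite /d mulrAC ltr_pdivrMr// ltr_pM2l// ltrDl.
apply: (@le_trans _ _ (\sum_(x <- s) d * I (psi x))).
  apply: le_trans (ler_norm_sum _ _ _) _; rewrite big_seq [leRHS]big_seq.
  by apply: ler_sum => x; exact: bnd.
rewrite -mulr_sumr ler_wpM2l ?(ltW d0)// -haar_sum// -(haarZ hI)//.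
apply: (haar_mono hI); [exact: compact_bump_sum|exact: compact_bumpZ|].
move=> y; have [H|H] := pselect (exists2 x, x \in s & psi x y != 0).
  have [x xs /(psiO _ _ xs)[_ /= ty]] := H; apply: le_trans (psi1 y) _.
  by rewrite -ler_pdivrMl// mulr1 -div1r ltW.
rewrite big1_seq ?mulr_ge0// => x /= xs; apply/eqP; apply/negPn/negP => px.
by apply: H; exists x.
Qed.

End Discretization.

Section Conic.
Context {R : realType} {F : lmodType R} (C : set F).
Hypothesis C0 : C 0.
Hypothesis cC : forall y z (t : R), C y -> C z -> 0 <= t <= 1 -> C (t *: y + (1 - t) *: z).

(** Convexity in the form of a weighted mean: the point c0 is the barycentre of the c x. Terms of
    weight 0 carry no condition, which suits partition functions, where c x is controlled only where
    the weight is nonzero. *)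
Lemma conic_sum (A : eqType) (s : seq A) (a : A -> R) (c : A -> F) :
  (forall x, x \in s -> 0 <= a x) -> (forall x, x \in s -> a x != 0 -> C (c x)) ->
  exists2 c0, C c0 & \sum_(x <- s) a x *: c x = (\sum_(x <- s) a x) *: c0.
Proof.
elim: s => [_ _|x s IH a0 Cc]; first by exists 0; rewrite // !big_nil scaler0.
have [c0 Cc0 E] : exists2 c0, C c0 & \sum_(x <- s) a x *: c x = (\sum_(x <- s) a x) *: c0.
  by apply: IH => y ys; [apply: a0|apply: Cc]; rewrite inE ys orbT.
have ax := a0 x (mem_head _ _).
have S0 : 0 <= \sum_(y <- s) a y.
  by rewrite big_seq sumr_ge0// => y ys; apply: a0; rewrite inE ys orbT.
have [ax0|axn] := eqVneq (a x) 0.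
  by exists c0 => //; rewrite !big_cons E ax0 scale0r !add0r.
rewrite !big_cons E; set S := \sum_(_ <- _) _ in S0 *.
have axp : 0 < a x by rewrite lt_neqAle eq_sym axn.
have Ap : 0 < a x + S by rewrite ltr_pwDl.
exists ((a x / (a x + S)) *: c x + (1 - a x / (a x + S)) *: c0).
  apply: cC => //; first by apply: Cc; rewrite ?mem_head.
  by rewrite divr_ge0 ?ler_pdivrMr ?mul1r ?lerDl// ltW.
rewrite scalerDr !scalerA mulrBr mulr1 mulrCA mulfV ?gt_eqF// mulr1.
by rewrite [a x + S]addrC addrK.
Qed.

Lemma conic_sum_le (A : eqType) (s : seq A) (a : A -> R) (c : A -> F) (B : R) :
  (forall x, x \in s -> 0 <= a x) -> (forall x, x \in s -> a x != 0 -> C (c x)) ->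
  \sum_(x <- s) a x <= B -> 0 < B ->
  exists2 c0, C c0 & \sum_(x <- s) a x *: c x = B *: c0.
Proof.
move=> a0 Cc SB B0; have [c0 Cc0 ->] := conic_sum a0 Cc.
set S := \sum_(_ <- _) _ in SB *.
have S0 : 0 <= S by rewrite /S big_seq sumr_ge0.
exists ((S / B) *: c0 + (1 - S / B) *: 0).
  by apply: cC => //; rewrite divr_ge0 ?ler_pdivrMr ?mul1r// ltW.
by rewrite scaler0 addr0 scalerA mulrCA mulfV ?gt_eqF// mulr1.
Qed.

End Conic.

(** * Integration of vector-valued functions *)

Section VectorIntegral.
Context {R : realType} {n : nat} {G : lieGroupType R n}.

(** The name abbreviates: continuous with compact support. *)
Definition csc (T : topologicalType) (F : lcsType R) (f : T -> F) : Prop :=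
  continuous f /\ exists2 L, compact L & forall x, ~ L x -> f x = 0.

Lemma csc_lin (T : topologicalType) (F : lcsType R) a (f g : T -> F) : csc f -> csc g ->
  csc (fun x => a *: f x + g x).
Proof.
move=> [cf [K cK Kf]] [cg [L cL Lg]]; split.
  move=> x; apply: add_cvg; last exact: cg.
  by apply: scale_cvg; [exact: cvg_cst|exact: cf].
exists (K `|` L); first exact: compactU.
by move=> x /not_orP[/Kf-> /Lg->]; rewrite scaler0 addr0.
Qed.

Lemma nbhs0_scale (F : tvsType R) (N : set F) (r : R) : nbhs 0 N -> nbhs 0 [set v | N (r *: v)].
Proof.
move=> N0; have : (fun v : F => r *: v) @ (0 : F) --> r *: (0 : F).
  by apply: scale_cvg; [exact: cvg_cst|exact: cvg_id].
by rewrite scaler0; apply.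
Qed.

Lemma nbhs0_sub (F : lcsType R) (N : set F) : nbhs 0 N ->
  exists2 M : set F, nbhs 0 M & forall v w, M v -> M w -> N (v - w).
Proof.
move=> N0; have [M M0 MN] := half_nbhs N0.
exists (M `&` [set v | M (-1 *: v)]); first by apply: filterI => //; exact: nbhs0_scale.
by move=> v w [Mv _] [_ Mw]; rewrite -scaleN1r; exact: MN.
Qed.

Lemma nbhs_shift (F : tvsType R) (v : F) (A : set F) : nbhs v A -> nbhs 0 [set w | A (v + w)].
Proof.
move=> vA; have : (fun w : F => v + w) @ (0 : F) --> v + 0.
  by apply: add_cvg; [exact: cvg_cst|exact: cvg_id].
by rewrite addr0; apply.
Qed.

Variables (I : (G -> R) -> R) (FF : set_system (seq (R * G))).
Hypotheses (hI : haar_functional I) (hFF : haar_net I FF).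

Let PFF : ProperFilter FF := haar_net_filter hFF.
Local Existing Instance PFF.

(** The estimate |int f| <= int |f| <= int h <= B for a discrete measure, with the convex set C in
    the role of the unit ball and h in that of a bound for |f|. *)
Lemma wsum_conic (F : lmodType R) (C : set F) (mu : seq (R * G)) (f : G -> F) (h : G -> R) (B : R) :
  C 0 -> (forall y z (t : R), C y -> C z -> 0 <= t <= 1 -> C (t *: y + (1 - t) *: z)) ->
  all (fun p => 0 <= p.1) mu -> (forall g, 0 <= h g) ->
  (forall g, exists2 c, C c & f g = h g *: c) ->
  wsum mu (h : G -> R^o) <= B -> 0 < B -> exists2 c, C c & wsum mu f = B *: c.
Proof.
move=> C0 cC /allP mu0 h0 fh hB B0.
have /boolp.choice[c cP] : forall g, exists c, C c /\ f g = h g *: c.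
  by move=> g; have [c Cc E] := fh g; exists c.
have [||c0 Cc0 E] := @conic_sum_le R F C C0 cC _ mu (fun p => p.1 * h p.2) (fun p => c p.2) B _ _ hB B0.
- by move=> p /mu0 p0; rewrite mulr_ge0.
- by move=> p _ _; case: (cP p.2).
exists c0 => //; rewrite -E; apply: eq_bigr => p _.
by rewrite -scalerA; have [_ <-] := cP p.2.
Qed.

Lemma wsum_eventually_le (h : G -> R) (B : R) : compact_bump h -> I h < B ->
  FF [set mu | all (fun p => 0 <= p.1) mu /\ wsum mu (h : G -> R^o) <= B].
Proof.
move=> hh hB; apply: filterI; first exact: haar_net_ge0 hFF.
have H : FF [set mu | wsum mu (h : G -> R^o) < B].
  exact: (haar_net_cvg hFF hh (open_nbhs_nbhs (conj (@open_lt R B) hB))).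
by apply: filterS H => mu /ltW.
Qed.

Lemma sum_scale_cvg (A : Type) (s : seq A) (F : tvsType R) (a : A -> seq (R * G) -> R)
  (b : A -> R) (v : A -> F) : (forall x, a x @ FF --> b x) ->
  (fun mu => \sum_(x <- s) a x mu *: v x) @ FF --> \sum_(x <- s) b x *: v x.
Proof.
move=> ab; elim: s => [|x s IH].
  by under eq_fun do rewrite big_nil; rewrite big_nil; exact: cvg_cst.
under eq_fun do rewrite big_cons; rewrite big_cons; apply: add_cvg => //.
by apply: scale_cvg; [exact: ab|exact: cvg_cst].
Qed.

Lemma wsum_sum (A : Type) (s : seq A) (F : lmodType R) mu (f : G -> F) (a : A -> G -> R) (v : A -> F) :
  wsum mu (fun g => f g - \sum_(x <- s) a x g *: v x) =
  wsum mu f - \sum_(x <- s) wsum mu (a x : G -> R^o) *: v x.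
Proof.
rewrite /wsum; under eq_bigr do rewrite scalerBr; rewrite sumrB; congr (_ - _).
under eq_bigr do rewrite scaler_sumr; rewrite exchange_big /=.
apply: eq_bigr => x _; rewrite scaler_suml; apply: eq_bigr => p _.
by rewrite scalerA.
Qed.

(* As v0 is the same for all t, this gives both the Cauchy property and left invariance of
   the integral. *)
Lemma riemann_sum (V : lcsType R) (f : G -> V) (N : set V) : csc f -> nbhs 0 N ->
  exists v0, forall t, FF [set mu | N (wsum mu (fun x => f (t * x)%g) - v0)].
Proof.
move=> [cf [L cL Lf]] N0; have [M M0 MN] := half_nbhs N0.
have [th hth [th1 thL]] := compact_unit cL; have [cth th0 _] := hth.
(* The partition below lives where th > 1/2, so the error of replacing f by the sum of the psi x
   f(x) takes values in 2 th C. Late in the net the sum of 2 th is at most [B], and C is chosen so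
   that B C lies in M. *)
pose B := 2 * I th + 1.
have B0 : 0 < B by rewrite ltr_wpDl// mulr_ge0// (haar_ge0 hI).
have [C [oC C0 CM cC]] := convex_nbhs (nbhs0_scale B M0).
have [x Lx|s [psi [sL hpsi psiO psi1 psiL]]] := @partition_of_unity _ _ G L
    (fun x => [set y | C (f y - f x)] `&` [set y | 1 / 2 < th y]) cL.
  apply: filterI.
    have : (fun y => f y - f x) @ x --> f x - f x.
      by apply: add_cvg; [exact: cf|exact: cvg_cst].
    by rewrite subrr; apply; exact: open_nbhs_nbhs.
  have tx : 1 / 2 < th x by rewrite thL// ltr_pdivrMr// mul1r ltr1n.
  exact: (cth x _ (open_nbhs_nbhs (conj (@open_gt R (1 / 2)) tx))).
have psi0 x y : 0 <= psi x y by have [] := hpsi x.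
exists (\sum_(x <- s) I (psi x) *: f x) => t.
have hpt x : compact_bump (fun y => psi x (t * y)%g) by exact: compact_bump_lmul.
(* Invariance of [I] gives the translated partition functions the same limits [I (psi x)], whatever
   t: this is why v0 can be fixed before t. *)
have step1 : FF [set mu | M (\sum_(x <- s) wsum mu (fun y => psi x (t * y)%g : R^o) *: f x
     - \sum_(x <- s) I (psi x) *: f x)].
  have H : (fun mu => \sum_(x <- s) wsum mu (fun y => psi x (t * y)%g : R^o) *: f x) @ FF -->
      \sum_(x <- s) I (psi x) *: f x.
    apply: sum_scale_cvg => x; rewrite -(haar_lmul hI t (hpsi x)).
    exact: (haar_net_cvg hFF (hpt x)).
  have : (fun mu => \sum_(x <- s) wsum mu (fun y => psi x (t * y)%g : R^o) *: f x
     - \sum_(x <- s) I (psi x) *: f x) @ FF --> \sum_(x <- s) I (psi x) *: f x - \sum_(x <- s) I (psi x) *: f x.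
    by apply: add_cvg => //; exact: cvg_cst.
  by rewrite subrr; apply.
have hth2 : compact_bump (fun y => 2 * th (t * y)%g) by apply: compact_bumpZ => //; exact: compact_bump_lmul.
have IB : I (fun y => 2 * th (t * y)%g) < B.
  by rewrite (haarZ hI)//; [rewrite (haar_lmul hI)// /B ltrDl|exact: compact_bump_lmul].
have step2 := wsum_eventually_le hth2 IB.
apply: filterS2 step1 step2 => mu M1 [mu0 muB] /=.
rewrite -(subrKA (\sum_(x <- s) wsum mu (fun y => psi x (t * y)%g : R^o) *: f x)).
apply: MN; last exact: M1.
rewrite -wsum_sum.
have [c Cc ->] : exists2 c, C c &
    wsum mu (fun g => f (t * g)%g - \sum_(x <- s) psi x (t * g)%g *: f x) = B *: c; last exact: CM.
apply: (wsum_conic C0 cC mu0 _ _ muB B0) => [g|g]; first by rewrite mulr_ge0.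
set z := (t * g)%g.
  have -> : f z - \sum_(x <- s) psi x z *: f x = \sum_(x <- s) psi x z *: (f z - f x).
    under [RHS]eq_bigr do rewrite scalerBr.
    rewrite sumrB -scaler_suml; congr (_ - _).
    have [Lz|/Lf->] := pselect (L z); first by rewrite psiL// scale1r.
    by rewrite scaler0.
  have psith : \sum_(x <- s) psi x z <= 2 * th z.
    have [[x xs px]|H] := pselect (exists2 x, x \in s & psi x z != 0).
      have [_ /= ty] := psiO _ _ xs px; apply: le_trans (psi1 z) _.
      by rewrite -ler_pdivrMl// mulr1 -div1r ltW.
    rewrite big1_seq ?mulr_ge0// => x /= xs; apply/eqP; apply/negPn/negP => px.
    by apply: H; exists x.
  have [th00|thn0] := eqVneq (th z) 0.
    exists 0 => //; rewrite scaler0 big1_seq// => x /= xs.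
    have := psith; rewrite th00 mulr0 => S0.
    have : psi x z <= 0 by apply: le_trans S0; rewrite (big_rem x)//= lerDl sumr_ge0.
    by rewrite le_eqVlt ltNge psi0 orbF => /eqP->; rewrite scale0r.
  apply: conic_sum_le => //.
    by move=> x xs px; have [] := psiO x z xs px.
  by rewrite mulr_gt0// lt_neqAle eq_sym thn0 th0.
Qed.

End VectorIntegral.

Section Integral.
Context {R : realType} {n : nat} {G : lieGroupType R n}.
Variables (I : (G -> R) -> R) (FF : set_system (seq (R * G))).
Hypotheses (hI : haar_functional I) (hFF : haar_net I FF).

Let PFF : ProperFilter FF := haar_net_filter hFF.
Local Existing Instance PFF.

Definition is_integral (V : lcsType R) (f : G -> V) (v : V) : Prop :=
  (fun mu => wsum mu f) @ FF --> v.

Definition integral (V : lcsType R) (f : G -> V) : V := xget 0 [set v | is_integral f v].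

(** Existence is isolated as a property of the space of values: it is proved for [R^o] and for
    quasi-complete spaces, and everything after that uses only this property. *)
Definition has_integrals (V : lcsType R) : Prop :=
  forall f : G -> V, csc f -> exists v, is_integral f v.

Lemma is_integral_unique (V : lcsType R) (f : G -> V) v w :
  is_integral f v -> is_integral f w -> v = w.
Proof. exact: (cvg_unique (@tvs_hausdorff _ V)). Qed.

Lemma integralE (V : lcsType R) (f : G -> V) v : is_integral f v -> integral f = v.
Proof.
by move=> fv; rewrite /integral; case: xgetP => [w _ fw|/(_ _ fv)//]; exact: is_integral_unique fw fv.
Qed.

Lemma integralP (V : lcsType R) (f : G -> V) : has_integrals V -> csc f -> is_integral f (integral f).
Proof. by move=> hV /hV[v fv]; rewrite (integralE fv). Qed.

Lemma is_integral_lin (V : lcsType R) a (f g : G -> V) v w : is_integral f v -> is_integral g w ->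
  is_integral (fun x => a *: f x + g x) (a *: v + w).
Proof.
move=> fv gw; rewrite /is_integral; under eq_fun do rewrite wsum_lin.
by apply: add_cvg => //; apply: scale_cvg => //; exact: cvg_cst.
Qed.

Lemma integral_lin (V : lcsType R) a (f g : G -> V) : has_integrals V -> csc f -> csc g ->
  integral (fun x => a *: f x + g x) = a *: integral f + integral g.
Proof. by move=> hV cf cg; apply: integralE; apply: is_integral_lin; exact: integralP. Qed.

Lemma is_integral_lmul (V : lcsType R) (f : G -> V) v t : csc f -> is_integral f v ->
  is_integral (fun x => f (t * x)%g) v.
Proof.
move=> cf fv.
have d0 : (fun mu => wsum mu (fun x => f (t * x)%g) - wsum mu f) @ FF --> (0 : V).
  move=> N N0; have [M M0 MN] := nbhs0_sub N0.
  have [v0 v0P] := riemann_sum hI hFF cf M0.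
  have v01 : FF [set mu | M (wsum mu f - v0)].
    have := v0P 1%g; have -> // : (fun x => f (1 * x)%g) = f.
    by apply/funext => x; rewrite mul1g.
  suff H : FF [set mu | N (wsum mu (fun x => f (t * x)%g) - wsum mu f)] by exact: H.
  apply: filterS2 (v0P t) v01 => mu Mt M1 /=.
  by have := MN _ _ Mt M1; rewrite opprB addrA subrK.
have K : (fun mu => (wsum mu (fun x => f (t * x)%g) - wsum mu f) + wsum mu f) @ FF --> 0 + v.
  exact: add_cvg d0 fv.
rewrite add0r in K.
apply: cvg_trans K; apply: near_eq_cvg; apply: nearW => mu /=.
by rewrite subrK.
Qed.

Lemma integral_lmul (V : lcsType R) (f : G -> V) t : has_integrals V -> csc f ->
  integral (fun x => f (t * x)%g) = integral f.
Proof. by move=> hV cf; apply: integralE; apply: is_integral_lmul => //; exact: integralP. Qed.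

Lemma is_integral_map (V W : lcsType R) (L : {linear V -> W}) (f : G -> V) v : continuous L ->
  is_integral f v -> is_integral (L \o f) (L v).
Proof.
move=> cL fv; rewrite /is_integral.
have E mu : wsum mu (L \o f) = L (wsum mu f).
  by rewrite /wsum linear_sum; apply: eq_bigr => p _; rewrite linearZ.
under eq_fun do rewrite E.
exact: (@cvg_comp _ _ _ (fun mu => wsum mu f) L _ _ _ fv (cL v)).
Qed.

Lemma is_integral_scalar (V : lcsType R) (h : G -> R) (v : V) : compact_bump h ->
  is_integral (fun x => h x *: v) (I h *: v).
Proof.
move=> hh; rewrite /is_integral.
have E mu : wsum mu (fun x => h x *: v) = wsum mu (h : G -> R^o) *: v.
  by rewrite /wsum scaler_suml; apply: eq_bigr => p _; rewrite scalerA.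
under eq_fun do rewrite E.
by apply: scale_cvg; [exact: (haar_net_cvg hFF hh)|exact: cvg_cst].
Qed.

(** Convergence of the net is known on nonnegative functions; a signed function is the difference of
    its positive and negative parts. *)
Lemma has_integrals_regular : has_integrals R^o.
Proof.
move=> f [cf [L cL Lf]].
have part (g : R -> R) : continuous g -> (forall x, 0 <= g x) -> g 0 = 0 ->
    compact_bump (fun x => g (f x)).
  move=> cg g0 g00; split => //.
    by move=> x; apply: (@continuous_comp _ _ _ f g); [exact: cf|exact: cg].
  by exists L => // x /Lf->.
have h1 : compact_bump (fun x => Num.max (f x) 0).
  apply: (part (fun r => Num.max r 0)); rewrite ?maxxx//; last by move=> x; rewrite le_max lexx orbT.
  by move=> x; apply: continuous_max; [exact: cvg_id|exact: cvg_cst].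
have h2 : compact_bump (fun x => Num.max (- f x) 0).
  apply: (part (fun r => Num.max (- r) 0)); rewrite ?oppr0 ?maxxx//; last by move=> x; rewrite le_max lexx orbT.
  by move=> x; apply: continuous_max; [apply: cvgN; exact: cvg_id|exact: cvg_cst].
exists (-1 *: (I (fun x => Num.max (- f x) 0) : R^o) + (I (fun x => Num.max (f x) 0) : R^o)).
have := is_integral_lin (V := R^o) (a := -1) (haar_net_cvg hFF h2) (haar_net_cvg hFF h1).
have maxB (z : R) : - Num.max (- z) 0 + Num.max z 0 = z; last first.
  by congr is_integral; apply/funext => x; rewrite scaleN1r; exact: maxB.
have [f0|/ltW f0] := leP z 0.
  have nf0 : 0 <= - z by rewrite oppr_ge0.
  by rewrite (max_l nf0) opprK addr0.
have nf0 : - z <= 0 by rewrite oppr_le0.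
by rewrite (max_r nf0) oppr0 add0r.
Qed.

(** The bound on the sum of [th] controls the mass of mu on the support [L]. By compactness some t >
    0 brings t f(L) into a convex C, so the sums lie in (B / t) C. A point of the closure differs
    from an actual sum by one more small set, whence M + M inside N. *)
Lemma wsum_bounded (V : lcsType R) (f : G -> V) (B : R) (th : G -> R) (L : set G) :
  0 < B -> compact L -> continuous f -> (forall x, ~ L x -> f x = 0) ->
  (forall x, 0 <= th x) -> (forall x, L x -> th x = 1) ->
  tvs_bounded (closure [set wsum mu f | mu in [set mu | all (fun p => 0 <= p.1) mu /\
     wsum mu (th : G -> R^o) <= B]]).
Proof.
move=> B0 cL cf Lf th0 thL N N0.
have [M M0 MN] := half_nbhs N0; have [C [oC C0 CM cC]] := convex_nbhs M0.
have : nbhs (0 : R) [set t | L `<=` fun x => C (t *: f x)].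
  apply: ((compact_near_coveringP L).1 cL R (nbhs (0 : R)) (fun t x => C (t *: f x))) => x Lx.
  have H : (fun p : G * R => p.2 *: f p.1) @ (x, (0 : R)) --> 0 *: f x.
    apply: scale_cvg; first exact: cvg_snd.
    by apply: (@cvg_comp _ _ _ (fst : G * R -> G) f _ (nbhs x)); [exact: cvg_fst|exact: cf].
  rewrite scale0r in H.
  exact: (H _ (open_nbhs_nbhs (conj oC C0))).
move=> /nbhs_ballP[e /= e0 eP]; pose t := e / 2.
have t0 : 0 < t by rewrite divr_gt0.
have tC x : L x -> C (t *: f x).
  move=> Lx; apply: (eP t) => //; rewrite /ball /= sub0r normrN gtr0_norm//.
  by rewrite /t ltr_pdivrMr// ltr_pMr// ltr1n.
exists (t^-1 * B); first by rewrite mulr_gt0// invr_gt0.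
move=> v clv.
have r0 : t^-1 * B != 0 by rewrite gt_eqF// mulr_gt0// invr_gt0.
have nv : nbhs v [set w | M ((t^-1 * B)^-1 *: (v - w))].
  have H : (fun w => (t^-1 * B)^-1 *: (v - w)) @ v --> (t^-1 * B)^-1 *: (v - v).
    apply: scale_cvg; first exact: cvg_cst.
    by apply: add_cvg; [exact: cvg_cst|apply: opp_cvg; exact: cvg_id].
  by rewrite subrr scaler0 in H; exact: H.
have [_ [[mu [mu0 muB] <-] /= Mv]] := clv _ nv.
have [||||c Cc E] := @wsum_conic _ _ _ V C mu f (fun x => t^-1 * th x) (t^-1 * B) C0 cC mu0.
- by move=> x; rewrite mulr_ge0// invr_ge0 ltW.
- move=> x; have [Lx|nLx] := pselect (L x).
    exists (t *: f x); first exact: tC.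
    by rewrite thL// mulr1 scalerA mulVf ?scale1r// gt_eqF.
  by exists 0 => //; rewrite Lf// scaler0.
- have -> : wsum mu (fun x => t^-1 * th x : R^o) = t^-1 * wsum mu (th : G -> R^o).
    rewrite /wsum mulr_sumr; apply: eq_bigr => p _.
    by rewrite /GRing.scale /= mulrCA.
  by rewrite ler_wpM2l// invr_ge0 ltW.
- by rewrite mulr_gt0// invr_gt0.
exists ((t^-1 * B)^-1 *: v); last by rewrite scalerA mulfV// scale1r.
rewrite E in Mv; rewrite -(subrK (t^-1 * B *: c) v) scalerDr scalerA mulVf// scale1r.
by apply: MN => //; exact: CM.
Qed.

Lemma has_integrals_quasi_complete (V : lcsType R) : quasi_complete V -> has_integrals V.
Proof.
move=> qc f csf; have [cf [L cL Lf]] := csf.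
have [th hth [th1 thL]] := compact_unit cL; have [cth th0 _] := hth.
pose B := I th + 1.
have B0 : 0 < B by rewrite ltr_wpDl// (haar_ge0 hI).
have bB := wsum_bounded B0 cL cf Lf th0 thL.
set S := closure _ in bB.
have IB : I th < B by rewrite /B ltrDl.
have [||v _ fv] := qc S (@closed_closure _ _) bB ((fun mu => wsum mu f) @ FF).

- have H : FF [set mu | S (wsum mu f)].
    apply: filterS (wsum_eventually_le hFF hth IB) => mu muP.
    by apply: subset_closure; exists mu.
  exact: H.
- move=> N N0; have [M M0 MN] := nbhs0_sub N0.
  have [v0 v0P] := riemann_sum hI hFF csf M0.
  have v01 : FF [set mu | M (wsum mu f - v0)].
    have := v0P 1%g; have -> // : (fun x => f (1 * x)%g) = f.
    by apply/funext => x; rewrite mul1g.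
  exists [set v | M (v - v0)] => // x y Mx My.
  by have := MN _ _ Mx My; rewrite opprB addrA subrK.
by exists v.
Qed.

(** For b near a the difference f b - f a takes values in C on the compact [L], uniformly, and
    vanishes off it, so its late sums lie in B C. The difference of the integrals is within M of
    such a sum. *)
Lemma integral_continuous (A : topologicalType) (V : lcsType R) (U : set A) (f : A -> G -> V) :
  has_integrals V -> open U ->
  (forall a g, U a -> {for (a, g), continuous (fun p : A * G => f p.1 p.2)}) ->
  (forall a, U a -> exists N L, [/\ nbhs a N, compact L & forall b g, N b -> ~ L g -> f b g = 0]) ->
  forall a, U a -> csc (f a) /\ {for a, continuous (fun b => integral (f b))}.
Proof.
move=> hV oU cf sf.
have cscf a : U a -> csc (f a).
  move=> Ua; have [N [L [aN cL NL]]] := sf a Ua; split.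
    move=> g; apply: (@cvg_comp _ _ _ (fun g => (a, g)) (fun p : A * G => f p.1 p.2) _ (nbhs (a, g))).
      by apply: cvg_pair; [exact: cvg_cst|exact: cvg_id].
    exact: cf.
  by exists L => // g; apply: NL; exact: nbhs_singleton.
move=> a Ua; split; first exact: cscf.
have [N [L [aN cL NL]]] := sf a Ua.
have [th hth [th1 thL]] := compact_unit cL; have [cth th0 _] := hth.
pose B := I th + 1.
have B0 : 0 < B by rewrite ltr_wpDl// (haar_ge0 hI).
have IB : I th < B by rewrite /B ltrDl.
move=> D /nbhs_shift /half_nbhs[M M0 MD].
have [C [oC C0 CM cC]] := convex_nbhs (nbhs0_scale B M0).
have nC : nbhs a [set b | L `<=` fun g => C (f b g - f a g)].
  apply: ((compact_near_coveringP L).1 cL A (nbhs a) (fun b g => C (f b g - f a g))) => g Lg.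
  have H : (fun p : G * A => f p.2 p.1 - f a p.1) @ (g, a) --> f a g - f a g.
    apply: add_cvg.
      apply: (@cvg_comp _ _ _ (fun p : G * A => (p.2, p.1)) (fun p : A * G => f p.1 p.2) _ (nbhs (a, g))).
        by apply: cvg_pair; [exact: cvg_snd|exact: cvg_fst].
      exact: cf.
    apply: opp_cvg; apply: (@cvg_comp _ _ _ (fst : G * A -> G) (f a) _ (nbhs g)); first exact: cvg_fst.
    by have [cfa _] := cscf a Ua; exact: cfa.
  rewrite subrr in H; exact: (H _ (open_nbhs_nbhs (conj oC C0))).
have nU : nbhs a U by exact: open_nbhs_nbhs.
suff H : nbhs a [set b | D (integral (f b))] by exact: H.
apply: filterS (filterI nU (filterI aN nC)) => b [Ub [Nb Cb]] /=.
have := is_integral_lin (a := -1) (integralP hV (cscf a Ua)) (integralP hV (cscf b Ub)).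
rewrite scaleN1r [- _ + _]addrC => H.
rewrite -[integral (f b)](subrK (integral (f a))) addrC.
set w := _ - _ in H *.
have nw : nbhs w [set w' | M (w - w')].
  have K : (fun w' => w - w') @ w --> w - w.
    by apply: add_cvg; [exact: cvg_cst|apply: opp_cvg; exact: cvg_id].
  by rewrite subrr in K; exact: K.
have Hw : FF [set mu | M (w - wsum mu (fun x => -1 *: f a x + f b x))] by exact: (H _ nw).
have [mu [Mw [mu0 muB]]] := filter_ex (filterI Hw (wsum_eventually_le hFF hth IB)).
rewrite -(subrK (wsum mu (fun x => -1 *: f a x + f b x)) w).
apply: MD => //.
have [c Cc ->] : exists2 c, C c & wsum mu (fun x => -1 *: f a x + f b x) = B *: c; last exact: CM.
apply: (wsum_conic C0 cC mu0 th0 _ muB B0) => g.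
have [Lg|nLg] := pselect (L g).
  by exists (f b g - f a g); [exact: Cb|rewrite thL// scale1r scaleN1r addrC].
by exists 0 => //; rewrite scaler0 !NL// ?scaler0 ?addr0//; exact: nbhs_singleton.
Qed.

End Integral.

(** * Difference quotients and differentiation under the integral *)

Section Quotients.
Context {R : realType}.

Lemma open_neq0 : open [set r : R | r != 0].
Proof. by have := @open_neq R 0; congr open; apply/funext => y /=; rewrite eq_sym. Qed.

(** By the mean value inequality the quotient at h stays in any open convex set that contains the
    velocities c' t s for s between 0 and h. This set can be chosen before t, which gives
    convergence jointly in the parameter t. *)
Lemma curve_quotient_cvg (T : Type) (Ft : set_system T) (FFt : Filter Ft) (F : tvsType R)
  (c c' : T -> R -> F) (l : F) (A : set T) (e : R) :
  (fun p : T * R => c' p.1 p.2) @ filter_prod Ft (nbhs (0 : R)) --> l ->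
  Ft A -> 0 < e ->
  (forall t s, A t -> `|s| < e -> (fun h : R => h^-1 *: (c t (s + h) - c t s)) @ (0 : R)^' --> c' t s) ->
  (fun p : T * R => p.2^-1 *: (c p.1 p.2 - c p.1 0)) @ filter_prod Ft (0 : R)^' --> l.
Proof.
move=> cl FA e0 dc N Nl.
have [C [oC Cl CN cC]] := convex_nbhs Nl.
have [[A1 D] /= [FA1 D0] A1D] := cl C (open_nbhs_nbhs (conj oC Cl)).
case/nbhs_ballP: D0 => d /= d0 dD.
exists (A `&` A1, [set h : R | `|h| < Num.min e d /\ h != 0]) => /=.
  split; first exact: filterI.
  apply/nbhs_ballP; exists (Num.min e d); first by rewrite /= lt_min e0.
  by move=> h; rewrite /ball /= sub0r normrN => he h0; split.
move=> [t h] /= [[At A1t] [hed h0]]; apply: CN.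
have small s : 0 <= s <= 1 -> `|s * h| < e /\ `|s * h| < d.
  move=> /andP[s0 s1]; apply/andP; rewrite -lt_min normrM ger0_norm//.
  by apply: le_lt_trans hed; rewrite ler_piMl.
have := @mean_value R F (fun s => h^-1 *: c t (s * h)) (fun s => c' t (s * h)) C oC cC.
rewrite mul1r mul0r -scalerBr; apply.
  move=> s /small[_ sd]; apply: (A1D (t, s * h)); split => //; apply: dD.
  by rewrite /ball /= sub0r normrN.
move=> s /small[se _].
have K : (fun k : R => k * h) @ (0:R)^' --> (0:R)^'.
  move=> B /nbhs_ballP[r /= r0 rB]; apply/nbhs_ballP.
  exists (r / `|h|); first by rewrite /= divr_gt0// normr_gt0.
  move=> k; rewrite /ball /= sub0r normrN ltr_pdivlMr ?normr_gt0// -normrM => kr k0.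
  by apply: rB; [rewrite /ball /= sub0r normrN|rewrite mulf_neq0].
have := cvg_comp _ _ K (dc t (s * h) At se); apply: cvg_trans; apply: near_eq_cvg.
apply: filterS (nbhs_dnbhs_neq (0:R)) => k k0 /=.
by rewrite -scalerBr scalerA invfM mulrDl mulrC.
Qed.

Lemma is_dderive_dirZ (E F : tvsType R) (f : E -> F) x v l (a : R) :
  is_dderive f x v l -> is_dderive f x (a *: v) (a *: l).
Proof.
move=> fl; rewrite /is_dderive; have [->|a0] := eqVneq a 0.
  rewrite !scale0r; under eq_fun do rewrite !scaler0 addr0 subrr scaler0.
  exact: cvg_cst.
have K : (fun h : R => h * a) @ (0:R)^' --> (0:R)^'.
  move=> B /nbhs_ballP[r /= r0 rB]; apply/nbhs_ballP.
  exists (r / `|a|); first by rewrite /= divr_gt0// normr_gt0.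
  move=> k; rewrite /ball /= sub0r normrN ltr_pdivlMr ?normr_gt0// -normrM => kr k0.
  by apply: rB; [rewrite /ball /= sub0r normrN|rewrite mulf_neq0].
have H : (fun h : R => a *: ((h * a)^-1 *: (f (x + (h * a) *: v) - f x))) @ (0:R)^' --> a *: l.
  apply: scale_cvg; first exact: cvg_cst.
  exact: (cvg_comp _ _ K fl).
apply: cvg_trans H; apply: near_eq_cvg.
apply: filterS (nbhs_dnbhs_neq (0:R)) => k k0 /=.
by rewrite !scalerA invfM mulrCA mulfV// mulr1.
Qed.

(** The increment splits into one along v at x and one along w at the moving point x + h v. The
    second needs the parametrised quotient limit, read on the diagonal, and there continuity of the
    derivative [D] along w enters. *)
Lemma is_dderive_dirD (E F : tvsType R) (U : set E) (f : E -> F) (D : E -> F) x v w l :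
  open U -> U x -> (forall y, U y -> is_dderive f y w (D y)) -> {for x, continuous D} ->
  is_dderive f x v l -> is_dderive f x (v + w) (l + D x).
Proof.
move=> oU Ux fD cD fl; rewrite /is_dderive.
have c2 : (fun p : R * R => x + p.1 *: v + p.2 *: w) @ ((0:R), (0:R)) --> x.
  have : (fun p : R * R => x + p.1 *: v + p.2 *: w) @ ((0:R), (0:R)) --> x + 0 *: v + 0 *: w.
    apply: add_cvg; last by apply: scale_cvg; [exact: cvg_snd|exact: cvg_cst].
    apply: add_cvg; first exact: cvg_cst.
    by apply: scale_cvg; [exact: cvg_fst|exact: cvg_cst].
  by rewrite !scale0r !addr0.
have nU : nbhs x U by exact: open_nbhs_nbhs.
have [[A B] /= [A0 B0] AB] := c2 U nU.
case/nbhs_ballP: B0 => e /= e0 eB.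
have H1 : (fun p : R * R => p.2^-1 *: (f (x + p.1 *: v + p.2 *: w) - f (x + p.1 *: v + 0 *: w)))
    @ filter_prod (0:R)^' (0:R)^' --> D x.
  apply: (@curve_quotient_cvg R (0:R)^' _ F (fun t s => f (x + t *: v + s *: w))
    (fun t s => D (x + t *: v + s *: w)) (D x) A e).
  - apply: (@cvg_comp _ _ _ (fun p : R * R => x + p.1 *: v + p.2 *: w) D _ (nbhs x)) => //.
    move=> N Nx; have [[A' B'] /= [A'0 B'0] A'B'] := c2 N Nx.
    by exists (A', B') => //; split => //=; exact: nbhs_dnbhs.
  - exact: nbhs_dnbhs.
  - by [].
  - move=> t s At se; have Uts : U (x + t *: v + s *: w).
      by apply: (AB (t, s)); split => //; apply: eB; rewrite /ball /= sub0r normrN.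
    by have := fD _ Uts; rewrite /is_dderive; under eq_fun do rewrite -addrA -scalerDl.
have diag : (fun h : R => (h, h)) @ (0:R)^' --> filter_prod (0:R)^' (0:R)^' by exact: cvg_pair cvg_id cvg_id.
have K : (fun h : R => h^-1 *: (f (x + h *: v) - f x) +
    h^-1 *: (f (x + h *: v + h *: w) - f (x + h *: v + 0 *: w))) @ (0:R)^' --> l + D x.
  apply: add_cvg => //.
  exact: (@cvg_comp _ _ _ (fun h : R => (h, h)) (fun p : R * R =>
    p.2^-1 *: (f (x + p.1 *: v + p.2 *: w) - f (x + p.1 *: v + 0 *: w))) _ _ _ diag H1).
apply: cvg_trans K; apply: near_eq_cvg; apply: nearW => h /=.
rewrite scale0r addr0 -scalerDr; congr (_ *: _).
by rewrite addrC addrA subrK scalerDr addrA.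
Qed.

(** [diff_class] postulates derivatives direction by direction; linearity in the direction is
    obtained here by adding the basis directions one at a time. *)
Lemma dderive_basis m (F : lcsType R) (U : set 'rV[R]_m) (f : 'rV[R]_m -> F) x v :
  open U -> smooth_on U f -> U x ->
  dderive f x v = \sum_i v 0 i *: dderive f x (delta_mx 0 i).
Proof.
move=> oU sf Ux; apply: dderiveE.
have der w y : U y -> is_dderive f y w (dderive f y w).
  by have [H _] := smooth_on_dderive w oU sf; exact: H.
have cder w : {for x, continuous (fun y => dderive f y w)}.
  have [_ H] := smooth_on_dderive w oU sf.
  exact: (diff_class_cont (H 0%N) Ux).
rewrite [X in is_dderive _ _ X _](row_sum_delta v).
elim: (index_enum _) => [|i s IH].
  by rewrite !big_nil /is_dderive; under eq_fun do rewrite scaler0 addr0 subrr scaler0; exact: cvg_cst.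
rewrite !big_cons addrC [X in is_dderive _ _ _ X]addrC.
apply: (@is_dderive_dirD _ _ U f (fun y => v 0 i *: dderive f y (delta_mx 0 i))) => //.
- by move=> y Uy; apply: is_dderive_dirZ; exact: der.
- apply: (@scale_cvg R _ (nbhs x) _ F (fun _ => v 0 i)); [exact: cvg_cst|exact: cder].
Qed.

(* Extended by the derivative at h = 0, the difference quotient is jointly continuous, so
   differentiation under the integral reduces to continuity under the integral. *)
Lemma difference_quotient_continuous (E F : tvsType R) (T : topologicalType) (U : set E) (f f' : E -> T -> F) x v :
  open U -> U x ->
  (forall y t, U y -> {for (y, t), continuous (fun p : E * T => f p.1 p.2)}) ->
  (forall y t, U y -> {for (y, t), continuous (fun p : E * T => f' p.1 p.2)}) ->
  (forall y t, U y -> is_dderive (f^~ t) y v (f' y t)) ->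
  forall (h : R) t, U (x + h *: v) -> {for (h, t), continuous (fun p : R * T =>
    if p.1 == 0 then f' x p.2 else p.1^-1 *: (f (x + p.1 *: v) p.2 - f x p.2))}.
Proof.
move=> oU Ux cf cf' ff' h t Uh.
have lin (h0 : R) : (fun p : R * T => (x + p.1 *: v, p.2)) @ (h0, t) --> (x + h0 *: v, t).
  apply: cvg_pair; last exact: cvg_snd.
  apply: add_cvg; first exact: cvg_cst.
  by apply: scale_cvg; [exact: cvg_fst|exact: cvg_cst].
have [h0|hn0] := eqVneq h 0; last first.
  have cq : {for (h, t), continuous (fun p : R * T => p.1^-1 *: (f (x + p.1 *: v) p.2 - f x p.2))}.
    apply: scale_cvg; first by apply: cvgV => //; exact: cvg_fst.
    apply: add_cvg.
      apply: (@cvg_comp _ _ _ (fun p : R * T => (x + p.1 *: v, p.2)) (fun p : E * T => f p.1 p.2) _ (nbhs (x + h *: v, t))).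
        exact: lin.
      exact: cf.
    apply: opp_cvg.
    apply: (@cvg_comp _ _ _ (fun p : R * T => (x, p.2)) (fun p : E * T => f p.1 p.2) _ (nbhs (x, t))).
      by apply: cvg_pair; [exact: cvg_cst|exact: cvg_snd].
    exact: cf.
  have oV : open [set p : R * T | p.1 != 0].
    rewrite openE => -[k s] /= k0; exists ([set r : R | r != 0], setT) => /=; last by move=> [r s'] [].
    split; last exact: filterT.
    exact: (open_nbhs_nbhs (conj open_neq0 k0)).
  apply: (@for_cont_eq _ F _ _ _ (h, t) oV _ _ cq) => // -[k s] /= k0.
  by rewrite (negbTE k0).
rewrite {}h0 in Uh *; move=> N /=; rewrite eqxx => Nl.
have [[T1 B1] /= [T1t B10] TB1] : filter_prod (nbhs t) (0:R)^' [set p : T * R |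
    N (p.2^-1 *: (f (x + p.2 *: v) p.1 - f x p.1))].
  have nU : nbhs (x + (0:R) *: v, t) [set p : E * T | U p.1].
    rewrite scale0r addr0; exists (U, setT) => //=; last by move=> [? ?] [].
    by split; [exact: open_nbhs_nbhs|exact: filterT].
  have [[B A] /= [B0 tA] AB] := lin 0 _ nU.
  case/nbhs_ballP: B0 => e /= e0 eB.
  have E0 : (fun p : T * R => p.2^-1 *: (f (x + p.2 *: v) p.1 - f x p.1)) =
      (fun p : T * R => p.2^-1 *: (f (x + p.2 *: v) p.1 - f (x + 0 *: v) p.1)).
    by apply/funext => p; rewrite scale0r addr0.
  suff H : (fun p : T * R => p.2^-1 *: (f (x + p.2 *: v) p.1 - f x p.1)) @ filter_prod (nbhs t) (0:R)^' --> f' x t.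
    exact: H Nl.
  rewrite E0.
  apply: (@curve_quotient_cvg T (nbhs t) _ F (fun t s => f (x + s *: v) t)
    (fun t s => f' (x + s *: v) t) (f' x t) A e) => //.
  - apply: (@cvg_comp _ _ _ (fun p : T * R => (x + p.2 *: v, p.1)) (fun p : E * T => f' p.1 p.2) _ (nbhs (x, t))).
      rewrite -[x in (x, t)]addr0 -[X in (_ + X, t)](scale0r v).
      apply: cvg_pair; last exact: cvg_fst.
      apply: add_cvg; first exact: cvg_cst.
      by apply: scale_cvg; [exact: cvg_snd|exact: cvg_cst].
    exact: cf'.
  - move=> s r As re.
    have Ur : U (x + r *: v) by apply: (AB (r, s)); split => //; apply: eB; rewrite /ball /= sub0r normrN.
    by have := ff' _ s Ur; rewrite /is_dderive; under eq_fun do rewrite -addrA -scalerDl.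
have [[A2 T2] /= [A2x T2t] AT2] := cf' x t Ux N Nl.
(* [B1] is only a punctured neighbourhood of 0; at r = 0 the value is f' x, and its continuity in t
   takes over. *)
exists ([set r : R | r != 0 -> B1 r], T1 `&` T2) => /=.
  by split; [exact: B10|exact: filterI].
move=> [r s] /= [rB [T1s T2s]]; case: eqVneq => [_|rn0].
  by apply: (AT2 (x, s)); split => //; exact: nbhs_singleton.
by apply: (TB1 (s, r)); split => //; exact: rB.
Qed.

End Quotients.

Section IterDerive.
Context {R : realType}.

Lemma dderive_unique (E : tvsType R) (F : lcsType R) (f : E -> F) x v l m :
  is_dderive f x v l -> is_dderive f x v m -> l = m.
Proof. exact: (cvg_unique (@tvs_hausdorff _ F)). Qed.

Lemma is_dderive_cst0 (E F : tvsType R) x v (a : F) : is_dderive (fun _ : E => a) x v 0.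
Proof. by rewrite /is_dderive; under eq_fun do rewrite subrr scaler0; exact: cvg_cst. Qed.

Lemma dderive_eq_on (E : tvsType R) (F : lcsType R) (O : set E) (f g : E -> F) x v :
  open O -> O x -> (forall y, O y -> f y = g y) -> dderive f x v = dderive g x v.
Proof.
move=> oO Ox fg; rewrite /dderive; congr xget; apply/seteqP; split => l /=.
  exact: (is_dderive_eq oO Ox fg).
by apply: (is_dderive_eq oO Ox) => y Oy; rewrite fg.
Qed.

Lemma iter_dderive_eq_on (E : tvsType R) (F : lcsType R) (O : set E) (f g : E -> F) s x :
  open O -> O x -> (forall y, O y -> f y = g y) -> iter_dderive s f x = iter_dderive s g x.
Proof.
move=> oO Ox fg; elim: s x Ox => [|v s IH] x Ox /=; first exact: fg.
exact: (dderive_eq_on v oO Ox).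
Qed.

Lemma iter_dderive0 (E : tvsType R) (F : lcsType R) s (x : E) : iter_dderive s (fun _ => 0 : F) x = 0.
Proof.
elim: s x => [//|v s IH] x /=.
have -> : iter_dderive s (fun _ => 0 : F) = (fun _ => 0) by exact/funext.
exact: dderiveE (is_dderive_cst0 _ _ _).
Qed.

Lemma iter_dderive_cat (E : tvsType R) (F : lcsType R) s s' (f : E -> F) :
  iter_dderive (s ++ s') f = iter_dderive s (iter_dderive s' f).
Proof. by rewrite /iter_dderive foldr_cat. Qed.

(** Smoothness in y with mere continuity in the parameter t, which ranges over a topological space.
    Asking joint continuity of all iterated derivatives makes the notion stable under
    differentiation in y. *)
Definition jointly_smooth (E : tvsType R) (T : topologicalType) (F : lcsType R) (U : set E)
    (f : E -> T -> F) : Prop :=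
  (forall t, smooth_on U (f^~ t)) /\
  forall s y t, U y -> {for (y, t), continuous (fun p : E * T => iter_dderive s (f^~ p.2) p.1)}.

Definition locally_supported (A T : topologicalType) (F : zmodType) (U : set A) (f : A -> T -> F) : Prop :=
  forall a, U a -> exists N L, [/\ nbhs a N, compact L & forall b t, N b -> ~ L t -> f b t = 0].

Lemma jointly_smooth_iter (E : tvsType R) (T : topologicalType) (F : lcsType R) (U : set E)
    (f : E -> T -> F) s : open U -> jointly_smooth U f ->
  jointly_smooth U (fun y t => iter_dderive s (f^~ t) y).
Proof.
move=> oU [sf cf]; split; first by move=> t; exact: (smooth_on_iter s oU (sf t)).
move=> s' y t Uy.
have -> : (fun p : E * T => iter_dderive s' (fun y => iter_dderive s (f^~ p.2) y) p.1) =
    (fun p : E * T => iter_dderive (s' ++ s) (f^~ p.2) p.1).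
  by apply/funext => p; rewrite iter_dderive_cat.
exact: cf.
Qed.

Lemma locally_supported_iter (E : tvsType R) (T : topologicalType) (F : lcsType R) (U : set E)
    (f : E -> T -> F) s : locally_supported U f ->
  locally_supported U (fun y t => iter_dderive s (f^~ t) y).
Proof.
move=> sf a Ua; have [N [L [aN cL NL]]] := sf a Ua.
(* A derivative at b involves the values near b, hence the interior. *)
exists N^°, L; split => //; first by apply: open_nbhs_nbhs; split; [exact: open_interior|exact: aN].
move=> b t Nb nLt; rewrite (@iter_dderive_eq_on _ _ N^° _ (fun _ => 0))//.
- exact: iter_dderive0.
- exact: open_interior.
- by move=> y Ny; apply: NL => //; exact: interior_subset.
Qed.

End IterDerive.

Section DerivativeUnderIntegral.
Context {R : realType} {n : nat} {G : lieGroupType R n}.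
Variables (I : (G -> R) -> R) (FF : set_system (seq (R * G))).
Hypotheses (hI : haar_functional I) (hFF : haar_net I FF).
Context {V : lcsType R}.
Hypothesis hV : has_integrals FF V.

Let PFF : ProperFilter FF := haar_net_filter hFF.
Local Existing Instance PFF.

Lemma csc0 (T : topologicalType) (F : lcsType R) : csc (fun _ : T => 0 : F).
Proof. by split; [move=> x; exact: cvg_cst|exists set0 => //; exact: compact0]. Qed.

Lemma cscZ (T : topologicalType) (F : lcsType R) (a : R) (f : T -> F) : csc f -> csc (fun x => a *: f x).
Proof.
move=> cf; have := csc_lin a cf (csc0 T F).
by congr csc; apply/funext => x; rewrite addr0.
Qed.

Lemma integral_zero : integral FF (fun _ => 0 : V) = 0.
Proof.
apply: (integralE hFF); rewrite /is_integral.
have E mu : wsum mu (fun _ : G => 0 : V) = 0 by rewrite /wsum big1// => p _; rewrite scaler0.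
by under eq_fun do rewrite E; exact: cvg_cst.
Qed.

Lemma integralZ a (f : G -> V) : csc f -> integral FF (fun x => a *: f x) = a *: integral FF f.
Proof.
move=> cf; have := integral_lin hFF a hV cf (csc0 G V); rewrite integral_zero addr0 => <-.
by congr integral; apply/funext => x; rewrite addr0.
Qed.

Lemma csc_sum (A : Type) (s : seq A) (P : pred A) (f : A -> G -> V) : (forall i, P i -> csc (f i)) ->
  csc (fun x => \sum_(i <- s | P i) f i x).
Proof.
move=> cf; elim: s => [|i s IH]; first by under eq_fun do rewrite big_nil; exact: csc0.
case Pi: (P i); last by move: IH; congr csc; apply/funext => x; rewrite big_cons Pi.
by have := csc_lin 1 (cf i Pi) IH; congr csc; apply/funext => x; rewrite big_cons Pi scale1r.
Qed.

Lemma integralD (f g : G -> V) : csc f -> csc g ->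
  integral FF (fun x => f x + g x) = integral FF f + integral FF g.
Proof.
move=> cf cg; have := integral_lin hFF 1 hV cf cg; rewrite scale1r => <-.
by congr integral; apply/funext => x; rewrite scale1r.
Qed.

Lemma integral_sum (A : Type) (s : seq A) (P : pred A) (f : A -> G -> V) : (forall i, P i -> csc (f i)) ->
  integral FF (fun x => \sum_(i <- s | P i) f i x) = \sum_(i <- s | P i) integral FF (f i).
Proof.
move=> cf; elim: s => [|i s IH].
  by rewrite big_nil -[RHS]integral_zero; congr integral; apply/funext => x; rewrite big_nil.
case Pi: (P i); rewrite big_cons Pi; last first.
  by rewrite -IH; congr integral; apply/funext => x; rewrite big_cons Pi.
rewrite -IH -integralD; [|exact: cf|exact: csc_sum].
by congr integral; apply/funext => x; rewrite big_cons Pi.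
Qed.

Lemma integral_dderive (E : tvsType R) (U : set E) (f f' : E -> G -> V) x v :
  open U -> U x ->
  (forall y t, U y -> {for (y, t), continuous (fun p : E * G => f p.1 p.2)}) ->
  (forall y t, U y -> {for (y, t), continuous (fun p : E * G => f' p.1 p.2)}) ->
  (forall y t, U y -> is_dderive (f^~ t) y v (f' y t)) ->
  locally_supported U f ->
  is_dderive (fun y => integral FF (f y)) x v (integral FF (f' x)).
Proof.
move=> oU Ux cf cf' ff' sf.
pose q (h : R) (t : G) := if h == 0 then f' x t else h^-1 *: (f (x + h *: v) t - f x t).
pose A := [set h : R | U (x + h *: v)].
have oA : open A.
  rewrite openE => h Ah.
  have H : (fun h : R => x + h *: v) @ h --> x + h *: v.
    apply: add_cvg; first exact: cvg_cst.
    by apply: scale_cvg; [exact: cvg_id|exact: cvg_cst].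
  exact: (H _ (open_nbhs_nbhs (conj oU Ah))).
have cq (h : R) t : A h -> {for (h, t), continuous (fun p : R * G => q p.1 p.2)}.
  by move=> Ah; exact: (difference_quotient_continuous oU Ux cf cf' ff').
have sq (h : R) : A h -> exists N L, [/\ nbhs h N, compact L & forall k g, N k -> ~ L g -> q k g = 0].
  move=> Ah; have [N1 [L1 [xN1 cL1 NL1]]] := sf x Ux.
  have [N2 [L2 [hN2 cL2 NL2]]] := sf _ Ah.
  exists [set k : R | N2 (x + k *: v)], (L1 `|` L2); split; last 1 first.
  - move=> k g Nk /not_orP[nL1 nL2]; rewrite /q; case: eqP => [_|_].
      (* At h = 0 the value f' x g is the derivative of a function that vanishes near x, hence 0. *)
      apply: (dderive_unique (ff' x g Ux)).
      apply: (@is_dderive_eq _ _ _ N1^° (fun _ => 0)); last exact: is_dderive_cst0.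
      - exact: open_interior.
      - exact: xN1.
      - by move=> y Ny; rewrite NL1//; exact: interior_subset.
    by rewrite NL2// NL1//; [rewrite subr0 scaler0|exact: nbhs_singleton].
  - have H : (fun h : R => x + h *: v) @ h --> x + h *: v.
      apply: add_cvg; first exact: cvg_cst.
      by apply: scale_cvg; [exact: cvg_id|exact: cvg_cst].
    exact: (H _ hN2).
  - exact: compactU.
have A0 : A 0 by rewrite /A /= scale0r addr0.
have [_ c0] := integral_continuous hI hFF hV oA cq sq A0.
have q0 : q 0 = f' x by apply/funext => g; rewrite /q eqxx.
have {}c0 : (fun h => integral FF (q h)) @ (0:R)^' --> integral FF (f' x).
  by move=> N; rewrite -q0 => /c0; exact: nbhs_dnbhs.
apply: cvg_trans c0; apply: near_eq_cvg.
have nA : (0:R)^' A by apply: nbhs_dnbhs; exact: open_nbhs_nbhs.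
apply: filterS2 (nbhs_dnbhs_neq (0:R)) nA => h h0 Ah /=.
have csf y : U y -> csc (f y) by move=> Uy; have [] := integral_continuous hI hFF hV oU cf sf Uy.
rewrite /q (negbTE h0) integralZ; last first.
  have := csc_lin (-1) (csf x Ux) (csf _ Ah).
  by congr csc; apply/funext => g; rewrite scaleN1r addrC.
congr (_ *: _); have E0 := integral_lin hFF (-1) hV (csf x Ux) (csf _ Ah).
rewrite scaleN1r in E0; rewrite [RHS]addrC -E0.
by congr integral; apply/funext => g; rewrite scaleN1r addrC.
Qed.

Section Smooth.
Context {m : nat} (U : set 'rV[R]_m).
Hypothesis oU : open U.

Lemma jointly_smooth_continuous (f : 'rV[R]_m -> G -> V) s y t : jointly_smooth U f -> U y ->
  {for (y, t), continuous (fun p : 'rV[R]_m * G => iter_dderive s (f^~ p.2) p.1)}.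
Proof. by move=> [_ cf]; exact: cf. Qed.

Lemma integral_is_dderive (f : 'rV[R]_m -> G -> V) y v : jointly_smooth U f -> locally_supported U f ->
  U y -> is_dderive (fun y => integral FF (f y)) y v (integral FF (fun g => dderive (f^~ g) y v)).
Proof.
move=> jf sf Uy; apply: (@integral_dderive _ U f (fun y g => dderive (f^~ g) y v)) => //.
- by move=> z t Uz; exact: (@jointly_smooth_continuous _ [::] _ t jf Uz).
- by move=> z t Uz; exact: (@jointly_smooth_continuous _ [:: v] _ t jf Uz).
- move=> z t Uz; have [sfz _] := jf.
  by have [H _] := smooth_on_dderive v oU (sfz t); exact: H.
Qed.

Lemma integral_jointly_continuous (f : 'rV[R]_m -> G -> V) y : jointly_smooth U f ->
  locally_supported U f -> U y -> csc (f y) /\ {for y, continuous (fun y => integral FF (f y))}.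
Proof.
move=> jf sf Uy; apply: (integral_continuous hI hFF hV oU _ sf Uy) => a g Ua.
exact: (@jointly_smooth_continuous _ [::] _ g jf Ua).
Qed.

(** The derivative has to be of class C^k jointly in (y, v). Expanding v in the basis leaves the
    linear coordinates of v and the integrals of the partial derivatives, which are families over
    the same U, so that the induction applies to them. *)
Lemma integral_smooth k (f : 'rV[R]_m -> G -> V) : jointly_smooth U f -> locally_supported U f ->
  diff_class k U (fun y => integral FF (f y)).
Proof.
elim: k f => [|k IH] f jf sf.
  by split => // y Uy; have [_ c] := integral_jointly_continuous jf sf Uy; exact: c.
split.
  by move=> y Uy; have [_ c] := integral_jointly_continuous jf sf Uy; exact: c.
pose fi i (y : 'rV[R]_m) g := dderive (f^~ g) y (delta_mx 0 i).
have jfi i : jointly_smooth U (fi i) by exact: (jointly_smooth_iter [:: delta_mx 0 i] oU jf).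
have sfi i : locally_supported U (fi i) by exact: (locally_supported_iter [:: delta_mx 0 i] sf).
exists (fun p : 'rV[R]_m * 'rV[R]_m => \sum_i (p.2 0 i : R^o) *: integral FF (fi i p.1)); split.
  move=> y v Uy /=; have := @integral_is_dderive f y v jf sf Uy; congr is_dderive.
  have cfi i : csc (fi i y) by have [] := integral_jointly_continuous (jfi i) (sfi i) Uy.
  rewrite -(eq_bigr _ (fun i _ => integralZ _ (cfi i))) -integral_sum.
    congr integral; apply/funext => g; have [sfg _] := jf.
    exact: (dderive_basis v oU (sfg g) Uy).
  by move=> i _; exact: cscZ.
apply: diff_class_sum => i _; apply: diff_class_scale.
  apply: diff_class_linear.
    by move=> a [u v] [w z] /=; rewrite !mxE.
  move=> p; apply: (@cvg_comp _ _ _ snd (fun v : 'rV[R]_m => v 0 i)); first exact: cvg_snd.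
  exact: coord_continuous.
by apply: (@diff_class_fst _ k _ _ V U (fun y => integral FF (fi i y))); exact: IH.
Qed.

Lemma integral_iter_dderive (f : 'rV[R]_m -> G -> V) s y : jointly_smooth U f -> locally_supported U f ->
  U y -> iter_dderive s (fun y => integral FF (f y)) y = integral FF (fun g => iter_dderive s (f^~ g) y).
Proof.
move=> jf sf; elim: s y => [//|v s IH] y Uy /=.
rewrite (dderive_eq_on v oU Uy IH); apply: dderiveE.
apply: (@integral_is_dderive _ y v (jointly_smooth_iter s oU jf) (locally_supported_iter s sf) Uy).
Qed.

End Smooth.
End DerivativeUnderIntegral.

(** * Continuity of maps into spaces of smooth functions *)

Section CinfContinuity.
Context {R : realType} {m : nat} {X : manifoldType R m}.
Local Notation E := 'rV[R]_m.

Lemma rV_compact_nbhs (z : E) (U : set E) : nbhs z U ->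
  exists K, [/\ compact K, nbhs z K & K `<=` U].
Proof.
move=> /rV_bump[b [sb b0 bz [K [cK KU Kb]]]]; exists K; split => //.
have [cb _] := sb 0%N setT.
have H : nbhs z [set y | 0 < b y].
  exact: (cb z I _ (open_nbhs_nbhs (conj (@open_gt R 0) bz))).
apply: filterS H => y /= by0; apply: contrapT => /Kb by0'.
by rewrite by0' ltxx in by0.
Qed.

(** Continuity is asked at one parameter t only. Read in all charts, the condition characterises
    continuity at t of a map into [Cinf X V], as the two lemmas on [cinf] below show. *)
Definition jointly_smooth_at (F : tvsType R) (T : topologicalType) (W : lcsType R) (U : set F)
    (f : F -> T -> W) (t : T) : Prop :=
  (forall t, smooth_on U (f^~ t)) /\
  forall s y, U y -> {for (y, t), continuous (fun p : F * T => iter_dderive s (f^~ p.2) p.1)}.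

Lemma iter_dderive_cinfB (V : lcsType R) (c : chart X E) s (f g : Cinf X V) y : atlas X c -> cim c y ->
  iter_dderive s ((f - g) \o cinv c) y =
  iter_dderive s (f \o cinv c) y - iter_dderive s (g \o cinv c) y.
Proof.
move=> Ac cy; have := @cinf_lin R m X V (c, s, [set y]) y (-1) g f.
rewrite scaleN1r [- g + f]addrC => -> //; first by rewrite scaleN1r addrC.
by split => //=; [exact: compact_set1|move=> _ ->].
Qed.

(** The seminorm index (c, s, K), with K a compact neighbourhood of the point, compares w t with w
    t0 uniformly on K; continuity of the single derivative [u0] does the rest. *)
Lemma cinf_jointly_smooth_at (V : lcsType R) (T : topologicalType) (w : T -> Cinf X V) t0 c :
  {for t0, continuous w} -> atlas X c -> jointly_smooth_at (cim c) (fun y t => w t (cinv c y)) t0.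
Proof.
move=> cw Ac; have [_ oc _ _ _] := atlas_chart c Ac; split.
  by move=> t; exact: cinfP.
move=> s y0 cy0 A /nbhs_shift /half_nbhs[M M0 MA].
have [K [cK nK Kc]] := rV_compact_nbhs (open_nbhs_nbhs (conj oc cy0)).
pose Q := [set (c, s, K)] : set (chart X E * seq E * set E).
have Qi : Q `<=` @cinf_index R m X by move=> _ ->.
have nT : nbhs t0 [set t | cinf_ball Q M (w t - w t0)].
  exact: (cw _ (nbhs_cinf_ball (w t0) (finite_set1 _) Qi M0)).
pose u0 := iter_dderive s (w t0 \o cinv c).
have cu0 : {for y0, continuous u0}.
  have su := smooth_on_iter s oc (cinfP (w t0) Ac).
  exact: (diff_class_cont (su 0%N) cy0).
have nY : nbhs y0 [set y | M (u0 y - u0 y0)].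
  have H : (fun y => u0 y - u0 y0) @ y0 --> u0 y0 - u0 y0.
    by apply: (@add_cvg R E (nbhs y0) _ V u0 (fun _ => - u0 y0)); [exact: cu0|exact: cvg_cst].
  by rewrite subrr in H; exact: H.
exists ([set y | M (u0 y - u0 y0)] `&` K, [set t | cinf_ball Q M (w t - w t0)]) => /=.
  by split => //; exact: filterI.
move=> [y t] /= [[My Ky] wt].
have := wt _ erefl y Ky; rewrite /= iter_dderive_cinfB//; last exact: Kc.
move=> Mw; have e (p q r : V) : r + (p - q + (q - r)) = p by rewrite subrKA addrC subrK.
by have := MA _ _ Mw My; rewrite /= e.
Qed.

(** For each index, joint continuity at the points of the compact set becomes closeness uniform on
    it; a basic neighbourhood involves finitely many indices. *)
Lemma cinf_continuous_at (V : lcsType R) (T : topologicalType) (w : T -> Cinf X V) t0 :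
  (forall c, atlas X c -> jointly_smooth_at (cim c) (fun y t => w t (cinv c y)) t0) ->
  {for t0, continuous w}.
Proof.
move=> jw A [Q [N [fQ Qi N0 QA]]].
have H q : Q q -> \forall t \near t0, forall y, q.2 y ->
    N (iter_dderive q.1.2 ((w t - w t0) \o cinv q.1.1) y).
  move=> /Qi qi; have [Aq cq qc] := qi; have [_ jq] := jw _ Aq.
  have K : nbhs t0 [set t | q.2 `<=` fun y =>
      N (iter_dderive q.1.2 ((w t - w t0) \o cinv q.1.1) y)].
    apply: ((compact_near_coveringP _).1 cq T (nbhs t0)
      (fun t y => N (iter_dderive q.1.2 ((w t - w t0) \o cinv q.1.1) y))) => y qy.
    have cy := qc _ qy.
    have oc : open (cim q.1.1) := cinf_chart qi.
    pose u (y : E) t := iter_dderive q.1.2 (w t \o cinv q.1.1) y.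
    have cu : (fun p : E * T => u p.1 p.2 - u p.1 t0) @ (y, t0) --> u y t0 - u y t0.
      have c1 : (fun p : E * T => u p.1 p.2) @ (y, t0) --> u y t0 by exact: jq.
      have c2 : (fun p : E * T => u p.1 t0) @ (y, t0) --> u y t0.
        apply: (@cvg_comp _ _ _ (fun p : E * T => (p.1, t0)) (fun p : E * T => u p.1 p.2) _ (nbhs (y, t0))); last exact: c1.
        by apply: (@cvg_pair (E * T)%type E T (nbhs (y, t0)) (nbhs y) (nbhs t0)); [exact: cvg_fst|exact: cvg_cst].
      exact: (add_cvg _ c1 (opp_cvg _ c2)).
    rewrite subrr in cu.
    have [[B1 B2] /= [B1y B2t] BN] := cu N N0.
    exists (B1 `&` cim q.1.1, B2) => /=.
      by split => //; apply: filterI => //; exact: open_nbhs_nbhs.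
    move=> [z t] /= [[B1z cz] B2t']; rewrite iter_dderive_cinfB//.
    exact: (BN (z, t)).
  by apply: filterS K => t tN y qy; exact: tN.
have HQ : nbhs t0 [set t | forall q, Q q -> forall y, q.2 y ->
    N (iter_dderive q.1.2 ((w t - w t0) \o cinv q.1.1) y)].
  exact: (finite_near (P := fun q t => forall y, q.2 y ->
    N (iter_dderive q.1.2 ((w t - w t0) \o cinv q.1.1) y)) _ fQ H).
suff G : nbhs t0 [set t | A (w t)] by exact: G.
apply: filterS HQ => t wt /=.
by rewrite -[w t](subrK (w t0)) addrC; apply: QA.
Qed.

Lemma jointly_smooth_at_iter (F : tvsType R) (T : topologicalType) (W : lcsType R) (U : set F)
    (f : F -> T -> W) t s : open U -> jointly_smooth_at U f t ->
  jointly_smooth_at U (fun y t => iter_dderive s (f^~ t) y) t.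
Proof.
move=> oU [sf cf]; split; first by move=> t'; exact: (smooth_on_iter s oU (sf t')).
move=> s' y Uy.
have -> : (fun p : F * T => iter_dderive s' (fun y => iter_dderive s (f^~ p.2) y) p.1) =
    (fun p : F * T => iter_dderive (s' ++ s) (f^~ p.2) p.1).
  by apply/funext => p; rewrite iter_dderive_cat.
exact: cf.
Qed.

Lemma jointly_smooth_at_scale (F : tvsType R) (T : topologicalType) (W : lcsType R) (U : set F)
    (a : F -> T -> R^o) (f : F -> T -> W) t : open U ->
  jointly_smooth_at U a t -> jointly_smooth_at U f t ->
  jointly_smooth_at U (fun y t => a y t *: f y t) t.
Proof.
move=> oU ja jf; split.
  by move=> t'; have [sa _] := ja; have [sf _] := jf => k; apply: diff_class_scale; [exact: sa|exact: sf].
(* The last direction is differentiated first: the product rule then yields two products, and the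
   induction hypothesis applies to each, without a closed Leibniz formula. *)
move=> s; elim/last_ind: s a f ja jf => [|s v IH] a f ja jf y Uy.
  have [_ ca] := ja; have [_ cf] := jf.
  by apply: scale_cvg; [exact: (ca [::])|exact: (cf [::])].
have ja' := jointly_smooth_at_iter [:: v] oU ja.
have jf' := jointly_smooth_at_iter [:: v] oU jf.
have [sa _] := ja; have [sf _] := jf; have [sa' _] := ja'; have [sf' _] := jf'.
have c1 := IH _ _ ja' jf y Uy; have c2 := IH _ _ ja jf' y Uy.
have oUT : open (U `*` [set: T]) by exact: nbhs_setXT.
have c12 : {for (y, t), continuous (fun p : F * T =>
    iter_dderive s (fun x => dderive (a^~ p.2) x v *: f x p.2) p.1 +
    iter_dderive s (fun x => a x p.2 *: dderive (f^~ p.2) x v) p.1)} by exact: add_cvg c1 c2.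
apply: (@for_cont_eq _ W _ _ _ (y, t) oUT _ _ c12) => //.
move=> [z u] [/= Uz _].
rewrite -cats1 iter_dderive_cat /=.
have s1 : smooth_on U (fun x => dderive (a^~ u) x v *: f x u).
  by move=> k; apply: diff_class_scale; [exact: sa'|exact: sf].
have s2 : smooth_on U (fun x => a x u *: dderive (f^~ u) x v).
  by move=> k; apply: diff_class_scale; [exact: sa|exact: sf'].
have := @iter_dderive_lin R F W U 1 _ _ s oU s1 s2 z Uz; rewrite scale1r => <-.
apply: (iter_dderive_eq_on s oU Uz) => x Ux.
rewrite scale1r; apply: esym; apply: dderiveE.
have [da _] := smooth_on_dderive v oU (sa u).
have [df _] := smooth_on_dderive v oU (sf u).
apply: is_dderive_scale; [|exact: da|exact: df].
exact: (diff_class_cont (sf u 0%N) Ux).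
Qed.

Context {V : lcsType R}.

Lemma cinf_mul_subproof (a : Cinf X R^o) (f : Cinf X V) : (fun x => a x *: f x) \in is_smooth X V.
Proof.
by apply/asboolP => c Ac k; apply: diff_class_scale; exact: cinfP.
Qed.

Definition cinf_mul (a : Cinf X R^o) (f : Cinf X V) : Cinf X V := MkCinf (cinf_mul_subproof a f).

Lemma cinf_mul_continuous_at (T : topologicalType) (a : T -> Cinf X R^o) (f : T -> Cinf X V) t :
  {for t, continuous a} -> {for t, continuous f} ->
  {for t, continuous (fun t => cinf_mul (a t) (f t))}.
Proof.
move=> ca cf; apply: cinf_continuous_at => c Ac.
have [_ oc _ _ _] := atlas_chart c Ac.
apply: (jointly_smooth_at_scale oc (cinf_jointly_smooth_at ca Ac) (cinf_jointly_smooth_at cf Ac)).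
Qed.

End CinfContinuity.

Section Translates.
Context {R : realType} {n m : nat} {G : lieGroupType R n} {X : manifoldType R m}.
Variable a : smooth_action G X.

Lemma smooth_fun_prod_comp (V : lcsType R) (f : X -> V) : smooth_fun (atlas X) f ->
  smooth_fun (prod_atlas (atlas G) (atlas X)) (fun p : G * X => f (a p.1 p.2)).
Proof.
move=> sf _ [e Ae [c Ac <-]] k; have [ca sa] := sact_smooth a.
have ice : is_chart (prod_chart e c) by apply: prod_chart_is_chart; exact: atlas_chart.
apply: diff_class_local => p cp.
have [d Ad dx] := atlas_cover (a (cinv (prod_chart e c) p).1 (cinv (prod_chart e c) p).2).
have [od od' dK cd cd'] := atlas_chart d Ad.
set U' := cim (prod_chart e c) `&` [set q | cdom d ((fun p : G * X => a p.1 p.2) (cinv (prod_chart e c) q))].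
have oU' : open U' by apply: chart_open => //; exact: atlas_chart.
exists U'; split => //.
apply: (@diff_class_eq _ _ _ _ _ ((f \o cinv d) \o (d \o (fun p : G * X => a p.1 p.2) \o cinv (prod_chart e c)))) => //.
  by move=> q [_ dq] /=; rewrite dK.
have Aec : prod_atlas (atlas G) (atlas X) (prod_chart e c) by exists e => //; exists c.
apply: diff_class_comp (sa _ _ Aec Ad k) (sf d Ad k) => //.
by move=> q [_ dq] /=; eexists; first exact: dq.
Qed.

(** Partial derivatives along v are derivatives along (0, v), so smoothness on a product makes them
    jointly continuous in both variables. *)
Lemma iter_dderive_partial (E F : tvsType R) (V : lcsType R) (H : E * F -> V) s z y :
  iter_dderive s (fun y => H (z, y)) y = iter_dderive [seq (0, v) | v <- s] H (z, y).
Proof.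
elim: s y => [//|v s IH] y /=.
have -> : iter_dderive s (fun y => H (z, y)) = (fun y => iter_dderive [seq (0, v) | v <- s] H (z, y)).
  exact/funext.
rewrite /dderive; congr xget; apply/funext => l; rewrite /= /is_dderive.
have -> // : (fun h : R => h^-1 *: (iter_dderive [seq (0, v0) | v0 <- s] H (z, y + h *: v) -
   iter_dderive [seq (0, v0) | v0 <- s] H (z, y))) =
  (fun h : R => h^-1 *: (iter_dderive [seq (0, v0) | v0 <- s] H ((z, y) + h *: (0, v)) -
   iter_dderive [seq (0, v0) | v0 <- s] H (z, y))).
apply/funext => h; congr (_ *: (iter_dderive _ _ _ - _)).
by congr pair; rewrite /= ?scaler0 ?addr0.
Qed.

Variables (chi : X -> R).
Hypothesis schi : smooth_fun (atlas X) (chi : X -> R^o).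

Lemma translate_subproof g : (fun x => chi (a g^-1%g x) : R^o) \in is_smooth X R^o.
Proof.
apply/asboolP; exact: (smooth_fun_comp (sact_section_smooth a g^-1%g) schi).
Qed.

Definition translate (g : G) : Cinf X R^o := MkCinf (translate_subproof g).

Lemma translate_continuous : continuous translate.
Proof.
(* After inversion the function is chi(g x), the pull-back of chi by the action itself, which is
   smooth on [G * X]; composing with inversion gives back [translate]. *)
have cV : continuous (fun g => translate g^-1%g).
  move=> g0; apply: cinf_continuous_at => c Ac; split.
    by move=> g; exact: cinfP.
  move=> s y0 cy0; have [e Ae eg0] := atlas_cover g0.
  have [oe oe' eK ce ce'] := atlas_chart e Ae.
  have [oc oc' cK cc cc'] := atlas_chart c Ac.
  have Aec : prod_atlas (atlas G) (atlas X) (prod_chart e c) by exists e => //; exists c.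
  have ice : is_chart (prod_chart e c) by apply: prod_chart_is_chart; exact: atlas_chart.
  have [_ oec _ _ _] := ice.
  pose H (p : 'rV[R]_n * 'rV[R]_m) : R^o := chi (a (cinv e p.1) (cinv c p.2)).
  have sH : smooth_on (cim (prod_chart e c)) H by exact: (smooth_fun_prod_comp schi Aec).
  have sHs := smooth_on_iter [seq (0, v) | v <- s] oec sH.
  pose O := [set: 'rV[R]_m] `*` cdom e.
  have oO : open O.
    rewrite openE => -[y g] [_ eg]; exists (setT, cdom e) => //.
    by split; [exact: filterT|exact: open_nbhs_nbhs].
  have cH : {for (y0, g0), continuous (fun p : 'rV[R]_m * G =>
      iter_dderive [seq (0, v) | v <- s] H (e p.2, p.1))}.
    apply: (@cvg_comp _ _ _ (fun p : 'rV[R]_m * G => (e p.2, p.1)) (iter_dderive [seq (0, v) | v <- s] H) _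
      (nbhs (e g0, y0))).
      apply: (@cvg_pair ('rV[R]_m * G)%type 'rV[R]_n 'rV[R]_m (nbhs (y0, g0)) (nbhs (e g0)) (nbhs y0)); last exact: cvg_fst.
      apply: (@cvg_comp _ _ _ (snd : 'rV[R]_m * G -> G) e _ (nbhs g0)); first exact: cvg_snd.
      exact: ce.
    apply: (diff_class_cont (sHs 0%N)).
    case: cy0 => x cx <-; exists (g0, x) => //.
  apply: (@for_cont_eq _ R^o O _ _ (y0, g0) oO _ _ cH) => //.
  move=> [y g] [_ /= eg]; rewrite -iter_dderive_partial.
  congr iter_dderive; apply/funext => z; rewrite /H /= eK//.
  by have -> : ((g^-1)^-1)%g = g by rewrite invgK.
move=> g; have -> : translate = (fun g => translate g^-1%g) \o (fun g => g^-1%g).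
  by apply/funext => h /=; rewrite invgK.
apply: continuous_comp; [exact: lie_inv_continuous|exact: cV].
Qed.

End Translates.

(** * Averages over the group *)

Section Averaging.
Context {R : realType} {n m : nat} {G : lieGroupType R n} {X : manifoldType R m} {V : lcsType R}.
Variables (I : (G -> R) -> R) (FF : set_system (seq (R * G))).
Hypotheses (hI : haar_functional I) (hFF : haar_net I FF) (hV : has_integrals FF V).
Variable k : G -> Cinf X R^o.
Hypothesis ck : continuous k.
Hypothesis sk : locally_supported setT (fun x g => k g x).

(* The default value 0 of [insubd] is not reached when u is continuous, see [averageE]. *)
Definition average (u : G -> Cinf X V) : Cinf X V :=
  insubd (0 : Cinf X V) (fun x => integral FF (fun g => (k g x : R) *: u g x)).

(** The weight [k] alone provides the compact support, so [N] and [L] are common to all values of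
    the parameter t. *)
Lemma average_supported (T : Type) (u : T -> G -> Cinf X V) c y s : atlas X c -> cim c y ->
  exists N L, [/\ nbhs y N, compact L & forall z t g, N z -> ~ L g ->
    iter_dderive s (fun z => cinf_mul (k g) (u t g) (cinv c z)) z = 0].
Proof.
move=> Ac cy; have [_ _ _ _ cc'] := atlas_chart c Ac.
have [N [L [nN cL NL]]] := sk (a := cinv c y) Logic.I.
have nN' : nbhs y [set z | N (cinv c z)] by exact: (cc' y cy N nN).
exists [set z | N (cinv c z)]^°, L; split => //.
  by apply: open_nbhs_nbhs; split; [exact: open_interior|exact: nN'].
move=> z t g Nz nLg; rewrite (@iter_dderive_eq_on _ _ _ [set z | N (cinv c z)]^° _ (fun _ => 0))//.
- exact: iter_dderive0.
- exact: open_interior.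
- by move=> w /interior_subset Nw /=; rewrite NL// scale0r.
Qed.

Lemma average_integrand_smooth (u : G -> Cinf X V) c : continuous u -> atlas X c ->
  jointly_smooth (cim c) (fun y g => cinf_mul (k g) (u g) (cinv c y)) /\
  locally_supported (cim c) (fun y g => cinf_mul (k g) (u g) (cinv c y)).
Proof.
move=> cu Ac; split.
  have cw g : {for g, continuous (fun g => cinf_mul (k g) (u g))}.
    by apply: cinf_mul_continuous_at; [exact: ck|exact: cu].
  have H g := cinf_jointly_smooth_at (cw g) Ac.
  by split; [move=> g; have [] := H g|move=> s y g cy; have [_ c2] := H g; exact: c2].
move=> y cy; have [N [L [nN cL NL]]] := average_supported (fun _ : unit => u) [::] Ac cy.
by exists N, L; split => // z g Nz nLg; exact: (NL z tt g Nz nLg).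
Qed.

Lemma averageE (u : G -> Cinf X V) x : continuous u ->
  average u x = integral FF (fun g => (k g x : R) *: u g x).
Proof.
move=> cu; have H : (fun x => integral FF (fun g => (k g x : R) *: u g x)) \in is_smooth X V.
  apply/asboolP => c Ac j; have [_ oc _ _ _] := atlas_chart c Ac.
  have [j1 j2] := average_integrand_smooth cu Ac.
  exact: (integral_smooth hI hFF hV oc j j1 j2).
have : val (average u) x = integral FF (fun g => (k g x : R) *: u g x) by rewrite /average val_insubd H.
exact.
Qed.

Lemma average_csc (u : G -> Cinf X V) x : continuous u -> csc (fun g => (k g x : R) *: u g x).
Proof.
move=> cu; have [N [L [nN cL NL]]] := sk (a := x) Logic.I; split; last first.
  exists L => // g nLg; rewrite (NL x g _ nLg) ?scale0r//; exact: nbhs_singleton.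
have ev (W : lcsType R) (w : G -> Cinf X W) : continuous w -> continuous (fun g => w g x).
  move=> cw g; apply: (@cvg_comp _ _ _ w (fun f : Cinf X W => f x) _ (nbhs (w g))); first exact: cw.
  exact: cinf_eval_continuous.
move=> g; apply: scale_cvg; [exact: (ev _ k ck)|exact: (ev _ u cu)].
Qed.

(** By the criterion for maps into [Cinf X V], the derivatives of the average must be continuous in
    (y, b). They are integrals of the derivatives of the integrand, so continuity under the integral
    is applied with the pair (y, b) as parameter. *)
Lemma average_continuous (A : topologicalType) (U : set A) (u : A -> G -> Cinf X V) : open U ->
  (forall b g, U b -> {for (b, g), continuous (fun p : A * G => u p.1 p.2)}) ->
  forall b, U b -> {for b, continuous (fun b => average (u b))}.
Proof.
move=> oU cu b Ub.
have cub d : U d -> continuous (u d).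
  move=> Ud g; apply: (@cvg_comp _ _ _ (fun g => (d, g)) (fun p : A * G => u p.1 p.2) _ (nbhs (d, g))).
    by apply: (@cvg_pair G A G (nbhs g) (nbhs d) (nbhs g)); [exact: cvg_cst|exact: cvg_id].
  exact: cu.
apply: cinf_continuous_at => c Ac; have [_ oc _ _ _] := atlas_chart c Ac.
split; first by move=> d; exact: cinfP.
move=> s y0 cy0.
pose f (p : 'rV[R]_m * A) (g : G) : V :=
  iter_dderive s (fun z => cinf_mul (k g) (u p.2 g) (cinv c z)) p.1.
pose O := cim c `*` U.
have oO : open O.
  rewrite openE => -[y d] [cy Ud]; exists (cim c, U) => //.
  by split; exact: open_nbhs_nbhs.
have cf (p : 'rV[R]_m * A) g : O p -> {for (p, g), continuous (fun q : ('rV[R]_m * A) * G => f q.1 q.2)}.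
  case: p => y d [/= cy Ud].
  have cw : {for (d, g), continuous (fun q : A * G => cinf_mul (k q.2) (u q.1 q.2))}.
    apply: cinf_mul_continuous_at; last exact: cu.
    by apply: (@cvg_comp _ _ _ (snd : A * G -> G) k _ (nbhs g)); [exact: cvg_snd|exact: ck].
  have [_ j] := cinf_jointly_smooth_at cw Ac.
  apply: (@cvg_comp _ _ _ (fun q : ('rV[R]_m * A) * G => (q.1.1, (q.1.2, q.2)))
    (fun p : 'rV[R]_m * (A * G) => iter_dderive s (fun z => cinf_mul (k p.2.2) (u p.2.1 p.2.2) (cinv c z)) p.1) _
    (nbhs (y, (d, g)))); last exact: j.
  apply: (@cvg_pair (('rV[R]_m * A) * G)%type 'rV[R]_m (A * G)%type (nbhs ((y, d), g)) (nbhs y) (nbhs (d, g))).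
    apply: (@cvg_comp _ _ _ (fst : ('rV[R]_m * A) * G -> 'rV[R]_m * A) fst _ (nbhs (y, d))); exact: cvg_fst.
  apply: (@cvg_pair (('rV[R]_m * A) * G)%type A G (nbhs ((y, d), g)) (nbhs d) (nbhs g)); last exact: cvg_snd.
  by apply: (@cvg_comp _ _ _ (fst : ('rV[R]_m * A) * G -> 'rV[R]_m * A) snd _ (nbhs (y, d))); [exact: cvg_fst|exact: cvg_snd].
have sf (p : 'rV[R]_m * A) : O p -> exists N L, [/\ nbhs p N, compact L & forall q g, N q -> ~ L g -> f q g = 0].
  case: p => y d [/= cy Ud]; have [N [L [nN cL NL]]] := average_supported u s Ac cy.
  exists (N `*` setT), L; split => //; last by move=> [z d'] g [/= Nz _]; exact: NL.
  by exists (N, setT) => //; split => //; exact: filterT.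
have [_ ci] := integral_continuous hI hFF hV oO cf sf (a := (y0, b)) (conj cy0 Ub).
apply: (@for_cont_eq _ V O _ _ (y0, b) oO _ _ ci) => //.
move=> [y d] [/= cy Ud]; have [j1 j2] := average_integrand_smooth (cub d Ud) Ac.
have -> : (fun z => average (u d) (cinv c z)) =
    (fun z => integral FF (fun g => cinf_mul (k g) (u d g) (cinv c z))).
  by apply/funext => z; rewrite averageE//; exact: cub.
by rewrite (integral_iter_dderive hI hFF hV oc s j1 j2 cy).
Qed.

End Averaging.

Section AverageSmooth.
Context {R : realType} {n m : nat} {G : lieGroupType R n} {X : manifoldType R m} {V : lcsType R}.
Variables (I : (G -> R) -> R) (FF : set_system (seq (R * G))).
Hypotheses (hI : haar_functional I) (hFF : haar_net I FF) (hV : has_integrals FF V).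
Variable k : G -> Cinf X R^o.
Hypothesis ck : continuous k.
Hypothesis sk : locally_supported setT (fun x g => k g x).

Lemma average_lin (c : R) (u w : G -> Cinf X V) : continuous u -> continuous w ->
  average FF k (fun g => c *: u g + w g) = c *: average FF k u + average FF k w.
Proof.
move=> cu cw; apply/val_inj/funext => x.
have cuw : continuous (fun g => c *: u g + w g).
  move=> g; apply: add_cvg; last exact: cw.
  by apply: scale_cvg; [exact: cvg_cst|exact: cu].
have -> : val (average FF k (fun g => c *: u g + w g)) x = average FF k (fun g => c *: u g + w g) x by [].
have -> : val (c *: average FF k u + average FF k w) x = c *: average FF k u x + average FF k w x by [].
rewrite !(averageE hI hFF hV ck sk)// -(integral_lin hFF c hV (average_csc ck sk x cu) (average_csc ck sk x cw)).
congr integral; apply/funext => g /=.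
by rewrite scalerDr !scalerA mulrC.
Qed.

(* F is of class C^j jointly in (y, g), read in the charts of G. *)
Definition charted_class j (E : tvsType R) (W : tvsType R) (U : set E) (F : E -> G -> W) : Prop :=
  forall e, atlas G e -> diff_class j (U `*` cim e) (fun p => F p.1 (cinv e p.2)).

Lemma charted_continuous j (E W : tvsType R) (U : set E) (F : E -> G -> W) y g : open U ->
  charted_class j U F -> U y -> {for (y, g), continuous (fun p : E * G => F p.1 p.2)}.
Proof.
move=> oU cF Uy; have [e Ae eg] := atlas_cover g.
have [oe oe' eK ce ce'] := atlas_chart e Ae.
have oO : open ([set: E] `*` cdom e).
  rewrite openE => -[z h] [_ eh]; exists (setT, cdom e) => //.
  by split; [exact: filterT|exact: open_nbhs_nbhs].
have H : {for (y, g), continuous (fun p : E * G => F p.1 (cinv e (e p.2)))}.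
  apply: (@cvg_comp _ _ _ (fun p : E * G => (p.1, e p.2)) (fun p => F p.1 (cinv e p.2)) _ (nbhs (y, e g))).
    apply: (@cvg_pair (E * G)%type E 'rV[R]_n (nbhs (y, g)) (nbhs y) (nbhs (e g))); first exact: cvg_fst.
    by apply: (@cvg_comp _ _ _ (snd : E * G -> G) e _ (nbhs g)); [exact: cvg_snd|exact: ce].
  have Uyg : (U `*` cim e) (y, e g) by split => //; exists g.
  exact: (diff_class_cont (cF e Ae) Uyg).
by apply: (@for_cont_eq _ W _ _ _ (y, g) oO _ _ H) => // -[z h] [_ /= eh]; rewrite eK.
Qed.

(** In a chart e of G, the derivative in y along v is the full derivative [df] along (v, 0). The
    function [df] depends on e while [dderive] does not, which makes the local descriptions agree;
    [L] is the linear map that inserts the direction 0. *)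
Lemma charted_dderive j (E : tvsType R) (W : lcsType R) (U : set E) (F : E -> G -> W) : open U ->
  charted_class j.+1 U F ->
  (forall y v g, U y -> is_dderive (F^~ g) y v (dderive (F^~ g) y v)) /\
  charted_class j (U `*` setT) (fun (p : E * E) g => dderive (F^~ g) p.1 p.2).
Proof.
move=> oU cF.
have H e : atlas G e -> exists df : (E * 'rV[R]_n) * (E * 'rV[R]_n) -> W,
    (forall y z v, U y -> cim e z -> is_dderive (F^~ (cinv e z)) y v (df ((y, z), (v, 0)))) /\
    diff_class j ((U `*` cim e) `*` setT) df.
  move=> Ae; have [_ [df [dfP dfj]]] := cF e Ae; exists df; split => // y z v Uy ez.
  have := dfP (y, z) (v, 0) (conj Uy ez); rewrite /is_dderive.
  have -> // : (fun h : R => h^-1 *: (F ((y, z) + h *: (v, 0)).1 (cinv e ((y, z) + h *: (v, 0)).2) - F (y, z).1 (cinv e (y, z).2)))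
    = (fun h : R => h^-1 *: (F (y + h *: v) (cinv e z) - F y (cinv e z))).
  by apply/funext => h /=; rewrite scaler0 addr0.
split.
  move=> y v g Uy; have [e Ae eg] := atlas_cover g.
  have [_ _ eK _ _] := atlas_chart e Ae.
  have [df [dfP _]] := H e Ae.
  have := dfP y (e g) v Uy (ex_intro2 _ _ g eg erefl); rewrite eK// => D.
  by rewrite (dderiveE D).
move=> e Ae; have [df [dfP dfj]] := H e Ae; have [_ oe' _ _ _] := atlas_chart e Ae.
pose L (q : (E * E) * 'rV[R]_n) : (E * 'rV[R]_n) * (E * 'rV[R]_n) := ((q.1.1, q.2), (q.1.2, 0)).
have oUe : open ((U `*` [set: E]) `*` cim e).
  rewrite openE => -[[y v] z] [/= [Uy _] ez]; exists (U `*` setT, cim e) => //.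
  split; last exact: open_nbhs_nbhs.
  by exists (U, setT) => //; split; [exact: open_nbhs_nbhs|exact: filterT].
apply: (@diff_class_eq _ j _ _ _ (df \o L) _ oUe).
  by move=> [[y v] z] [/= [Uy _] ez]; rewrite (dderiveE (dfP y z v Uy ez)).
apply: (@diff_class_sub _ j _ _ (L @^-1` ((U `*` cim e) `*` setT))).
  by move=> [[y v] z] [/= [Uy _] ez].
apply: diff_class_comp_linear dfj.
  by move=> c [[y v] z] [[y' v'] z'] /=; congr (_, (_, _)); rewrite /= scaler0 addr0.
move=> q.
have c1 : fst @ q --> q.1 by exact: cvg_fst.
have c11 : (fun q : (E * E) * 'rV[R]_n => q.1.1) @ q --> q.1.1.
  by apply: (@cvg_comp _ _ _ fst fst _ (nbhs q.1)) => //; case: (q.1) => ? ?; exact: cvg_fst.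
have c12 : (fun q : (E * E) * 'rV[R]_n => q.1.2) @ q --> q.1.2.
  by apply: (@cvg_comp _ _ _ fst snd _ (nbhs q.1)) => //; case: (q.1) => ? ?; exact: cvg_snd.
have c2 : (fun q : (E * E) * 'rV[R]_n => q.2) @ q --> q.2 by exact: cvg_snd.
have H1 : (fun q : (E * E) * 'rV[R]_n => (q.1.1, q.2)) @ q --> (q.1.1, q.2).
  exact: (cvg_pair c11 c2).
have H2 : (fun q : (E * E) * 'rV[R]_n => (q.1.2, 0 : 'rV[R]_n)) @ q --> (q.1.2, 0 : 'rV[R]_n).
  exact: (cvg_pair c12 (@cvg_cst _ _ _ (nbhs q) _)).
exact: (cvg_pair H1 H2).
Qed.

(** Here the differentiation takes place in [Cinf X V]. The difference quotient, extended at h = 0,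
    is a continuous family, so its average converges. The derivative is again an average, now with
    parameter (y, v), so the induction runs over all parameter spaces E. *)
Lemma average_diff_class j (E : tvsType R) (U : set E) (F : E -> G -> Cinf X V) : open U ->
  charted_class j U F -> diff_class j U (fun y => average FF k (F y)).
Proof.
elim: j E U F => [|j IH] E U F oU cF.
  split => // y Uy; apply: (average_continuous hI hFF hV ck sk oU _ Uy) => z g Uz.
  exact: (@charted_continuous _ _ _ _ _ z g oU cF Uz).
have cFc z g : U z -> {for (z, g), continuous (fun p : E * G => F p.1 p.2)}.
  by move=> Uz; exact: (@charted_continuous _ _ _ _ _ z g oU cF Uz).
split.
  by move=> y Uy; exact: (average_continuous hI hFF hV ck sk oU cFc Uy).
have [DF cDF] := charted_dderive oU cF.
have oUT : open (U `*` [set: E]) by exact: nbhs_setXT.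
exists (fun p => average FF k (fun g => dderive (F^~ g) p.1 p.2)); split; last exact: (IH _ _ _ oUT cDF).
move=> y v Uy.
pose f' (z : E) g := dderive (F^~ g) z v.
have cf' z g : U z -> {for (z, g), continuous (fun p : E * G => f' p.1 p.2)}.
  move=> Uz; have H := @charted_continuous _ _ _ _ _ (z, v) g oUT cDF (conj Uz Logic.I).
  apply: (@cvg_comp _ _ _ (fun p : E * G => ((p.1, v), p.2))
    (fun p : (E * E) * G => dderive (F^~ p.2) p.1.1 p.1.2) _ (nbhs ((z, v), g))); last exact: H.
  apply: (@cvg_pair (E * G)%type (E * E)%type G (nbhs (z, g)) (nbhs (z, v)) (nbhs g)); last exact: cvg_snd.
  by apply: (@cvg_pair (E * G)%type E E (nbhs (z, g)) (nbhs z) (nbhs v)); [exact: cvg_fst|exact: cvg_cst].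
pose q (h : R) g := if h == 0 then f' y g else h^-1 *: (F (y + h *: v) g - F y g).
pose A := [set h : R | U (y + h *: v)].
have oA : open A.
  rewrite openE => h Ah.
  have H : (fun h : R => y + h *: v) @ h --> y + h *: v.
    apply: add_cvg; first exact: cvg_cst.
    by apply: scale_cvg; [exact: cvg_id|exact: cvg_cst].
  exact: (H _ (open_nbhs_nbhs (conj oU Ah))).
have cq (h : R) g : A h -> {for (h, g), continuous (fun p : R * G => q p.1 p.2)}.
  move=> Ah; apply: (difference_quotient_continuous oU Uy cFc cf') => // z t Uz; exact: DF.
have A0 : A 0 by rewrite /A /= scale0r addr0.
have c0 := average_continuous hI hFF hV ck sk oA cq A0.
have q0 : q 0 = f' y by apply/funext => g; rewrite /q eqxx.
have {}c0 : (fun h => average FF k (q h)) @ (0:R)^' --> average FF k (f' y).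
  by move=> N; rewrite -q0 => /c0; exact: nbhs_dnbhs.
apply: cvg_trans c0; apply: near_eq_cvg.
have nA : (0:R)^' A by apply: nbhs_dnbhs; exact: open_nbhs_nbhs.
apply: filterS2 (nbhs_dnbhs_neq (0:R)) nA => h h0 Ah /=.
have cFy z : U z -> continuous (F z).
  move=> Uz g; apply: (@cvg_comp _ _ _ (fun g => (z, g)) (fun p : E * G => F p.1 p.2) _ (nbhs (z, g))).
    by apply: (@cvg_pair G E G (nbhs g) (nbhs z) (nbhs g)); [exact: cvg_cst|exact: cvg_id].
  exact: cFc.
have c0' : continuous (fun _ : G => 0 : Cinf X V) by move=> g; exact: cvg_cst.
have E1 := average_lin (-1) (cFy y Uy) (cFy _ Ah).
have cd : continuous (fun g => -1 *: F y g + F (y + h *: v) g).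
  move=> g; apply: add_cvg; last exact: (cFy _ Ah).
  by apply: scale_cvg; [exact: cvg_cst|exact: (cFy _ Uy)].
have E2 := average_lin h^-1 cd c0'.
have E3 : average FF k (fun _ => 0 : Cinf X V) = 0.
  apply/val_inj/funext => x; have := averageE hI hFF hV ck sk x c0'.
  have -> : (fun g => (k g x : R) *: (0 : Cinf X V) x) = (fun _ => 0) by apply/funext => g; rewrite scaler0.
  by rewrite (integral_zero hFF).
rewrite E1 E3 addr0 scaleN1r [- _ + _]addrC in E2; rewrite -E2.
congr (average FF k _); apply/funext => g; rewrite /q (negbTE h0) addr0.
by rewrite scaleN1r [- _ + _]addrC.
Qed.

End AverageSmooth.

(** * Cutoff functions *)

Section SmoothScalars.
Context {R : realType} {m : nat} {X : manifoldType R m}.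
Implicit Types f g : X -> R.

Lemma smooth_funM f g : smooth_fun (atlas X) (f : X -> R^o) -> smooth_fun (atlas X) (g : X -> R^o) ->
  smooth_fun (atlas X) (fun x => f x * g x : R^o).
Proof. by move=> sf sg c Ac k; exact: (diff_class_scale (sf c Ac k) (sg c Ac k)). Qed.

Lemma smooth_fun_cst (V : tvsType R) (v : V) : smooth_fun (atlas X) (fun _ => v).
Proof. by move=> c Ac k; exact: diff_class_cst. Qed.

Lemma smooth_fun_sum (A : Type) (s : seq A) (f : A -> X -> R) :
  (forall i, smooth_fun (atlas X) (f i : X -> R^o)) ->
  smooth_fun (atlas X) (fun x => \sum_(i <- s) f i x : R^o).
Proof. by move=> sf c Ac k; apply: diff_class_sum => i _; exact: sf. Qed.

Lemma smooth_fun_prod (A : Type) (s : seq A) (f : A -> X -> R) :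
  (forall i, smooth_fun (atlas X) (f i : X -> R^o)) ->
  smooth_fun (atlas X) (fun x => \prod_(i <- s) f i x : R^o).
Proof.
move=> sf; elim: s => [|i s IH].
  by under eq_fun do rewrite big_nil; exact: smooth_fun_cst.
by under eq_fun do rewrite big_cons; exact: smooth_funM.
Qed.

Lemma smooth_fun_flat f : smooth_fun (atlas X) (f : X -> R^o) ->
  smooth_fun (atlas X) (fun x => flat_exp 0 (f x) : R^o).
Proof.
move=> sf c Ac k.
exact: (@diff_class_comp _ k _ _ _ _ setT _ (flat_exp 0 : R^o -> R^o) openT _ (sf c Ac k) (diff_class_flat_exp _ _ _)).
Qed.

Lemma smooth_fun_inv f : (forall x, f x != 0) -> smooth_fun (atlas X) (f : X -> R^o) ->
  smooth_fun (atlas X) (fun x => (f x)^-1 : R^o).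
Proof. by move=> f0 sf c Ac k; apply: diff_class_inv => [y _|]; [exact: f0|exact: sf]. Qed.

Lemma smooth_fun_local (V : lcsType R) (f : X -> V) :
  (forall x : X, exists (N : set X) (g : X -> V), [/\ nbhs x N, smooth_fun (atlas X) g & forall y, N y -> f y = g y]) ->
  smooth_fun (atlas X) f.
Proof.
move=> H c Ac k; apply: diff_class_local => y cy.
have [N [g [nN sg fg]]] := H (cinv c y).
have [_ oc _ _ cc'] := atlas_chart c Ac.
have oU : open (cim c `&` [set z | N^° (cinv c z)]).
  rewrite openE => z [cz Nz]; apply: filterI; first exact: open_nbhs_nbhs.
  by apply: (cc' z cz); apply: open_nbhs_nbhs; split => //; exact: open_interior.
exists (cim c `&` [set z | N^° (cinv c z)]); split => //.
apply: (@diff_class_eq _ k _ _ _ (g \o cinv c)) => //.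
  by move=> z [_ /= /interior_subset Nz]; rewrite fg.
by apply: (@diff_class_sub _ k _ _ (cim c)); [move=> z []|exact: sg].
Qed.

Definition bump_fun f : Prop := [/\ smooth_fun (atlas X) (f : X -> R^o), forall x, 0 <= f x &
  exists2 K, compact K & forall x, ~ K x -> f x = 0].

(** A countable base is numbered by an injection [f]. For each basic open set on which some bump is
    everywhere positive, one such bump is chosen and stored at its number; the remaining indices
    receive 0. *)
Lemma bump_cover : exists b : nat -> X -> R, (forall i, bump_fun (b i)) /\ forall x, exists i, 0 < b i x.
Proof.
have [B /countable_injP[f f_inj] [oB bB]] := @manifold_second_countable _ _ X.
pose good U (b : X -> R) := bump_fun b /\ forall x, U x -> 0 < b x.
pose Q i b := bump_fun b /\ forall U, B U -> f U = i -> (exists b', good U b') -> good U b.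
have bump0 : bump_fun (fun _ => 0).
  split => //; first exact: (@smooth_fun_cst R^o).
  by exists set0 => //; exact: compact0.
have /boolp.choice[b bQ] : forall i, exists b, Q i b.
  move=> i; have [[U [BU [fU [b gb]]]]|nU] := pselect (exists U, B U /\ f U = i /\ exists b, good U b).
    exists b; split; first by case: gb.
    move=> U' BU' fU' _; have -> // : U' = U.
    by apply: f_inj; rewrite ?inE// fU' fU.
  by exists (fun _ => 0); split => // U BU fU gU; case: nU; exists U.
exists b; split; first by move=> i; have [] := bQ i.
move=> x; have [|b0 [sb0 b00 b0x [K [cK _ Kb0]]]] := @manifold_bump _ _ _ x setT; first exact: filterT.
have nx : nbhs x [set y | 0 < b0 y].
  exact: (smooth_fun_continuous sb0 (open_nbhs_nbhs (conj (@open_gt R 0) b0x))).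
have [U [BU Ux] Ub0] := bB x _ nx.
exists (f U); have [_ /(_ U BU erefl)] := bQ (f U); case; last by move=> _; apply.
exists b0; split; last by move=> y /Ub0.
by split => //; exists K.
Qed.

End SmoothScalars.

Section Cutoff.
Context {R : realType} {n m : nat} {G : lieGroupType R n} {X : manifoldType R m}.
Variables (a : smooth_action G X) (I : (G -> R) -> R) (FF : set_system (seq (R * G))).
Hypotheses (a_proper : proper_action a) (hI : haar_functional I) (hFF : haar_net I FF).
Implicit Types f chi : X -> R.

(** Compactness of support is asked along orbits only, locally uniformly in x. Unlike compact
    support on X, this can hold for the infinite sum that builds the cutoff, and it is the support
    condition that averages require. *)
Definition transversally_compact (chi : X -> R) : Prop := [/\ smooth_fun (atlas X) (chi : X -> R^o),
  forall x, 0 <= chi x & locally_supported setT (fun x g => chi (a g^-1%g x))].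

Definition orbit_mean (chi : X -> R) (x : X) : R := I (fun g => chi (a g^-1%g x)).

(** If y is in [N] and z = g^-1 y is in [K], then (g z, z) lies in the product of [N] and [K]; by
    properness such pairs (g, z) form a compact set, whose projection to G is the required [L]. *)
Lemma bump_transversally_compact chi : bump_fun chi -> transversally_compact chi.
Proof.
move=> [schi chi0 [K cK Kchi]]; split => // x _.
have [N [cN nN _]] := manifold_compact_nbhs (@filterT _ (nbhs x) _).
pose S := (fun p : G * X => (a p.1 p.2, p.2)) @^-1` (N `*` K).
exists N, (fst @` S); split => //.
  apply: compact_image; first by move=> p _; exact: cvg_fst.
  by apply: a_proper; exact: compact_setX.
move=> y g Ny nS; apply: Kchi => Kz; apply: nS; exists (g, a g^-1%g y) => //=.
by split => //=; rewrite -sactM mulgV sact1.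
Qed.

Lemma transversal_bump chi x : transversally_compact chi -> compact_bump (fun g => chi (a g^-1%g x)).
Proof.
move=> [schi chi0 lchi]; split => //.
  move=> g; apply: (@cvg_comp _ _ _ (translate a schi) (fun f : Cinf X R^o => f x) _ (nbhs (translate a schi g))).
    exact: translate_continuous.
  exact: (@cinf_eval_continuous R m X R^o x (translate a schi g)).
have [N [L [nN cL NL]]] := lchi x Logic.I; exists L => // g nLg.
by apply: NL => //; exact: nbhs_singleton.
Qed.

(** The orbit mean is the average of the constant function 1 with weight [translate a schi], and
    averages are elements of [Cinf X R^o]. *)
Lemma orbit_mean_smooth chi : transversally_compact chi -> smooth_fun (atlas X) (orbit_mean chi : X -> R^o).
Proof.
move=> tchi; have [schi chi0 lchi] := tchi.
have one_smooth : (fun _ => 1 : R^o) \in is_smooth X R^o by apply/asboolP; exact: smooth_fun_cst.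
pose u (g : G) : Cinf X R^o := MkCinf one_smooth.
have cu : continuous u by move=> g; exact: cvg_cst.
have := cinfP (average FF (translate a schi) u).
have -> // : (average FF (translate a schi) u : X -> R^o) = orbit_mean chi.
apply/funext => x; rewrite (averageE hI hFF (has_integrals_regular hFF) (@translate_continuous R n m G X a chi schi) lchi)//.
have := integralE hFF (is_integral_scalar (V := R^o) (v := 1 : R^o) hFF (transversal_bump x tchi)).
by rewrite /GRing.scale /= mulr1.
Qed.

Lemma orbit_mean_invariant chi g x : transversally_compact chi ->
  orbit_mean chi (a g x) = orbit_mean chi x.
Proof.
move=> tchi; rewrite /orbit_mean -(haar_lmul hI g^-1%g (transversal_bump x tchi)).
by congr I; apply/funext => h; rewrite invgM invgK sactM.
Qed.

Lemma orbit_mean_ge0 chi x : transversally_compact chi -> 0 <= orbit_mean chi x.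
Proof. by move=> tchi; apply: (haar_ge0 hI); exact: transversal_bump. Qed.

Lemma orbit_mean_gt0 chi g x : transversally_compact chi -> 0 < chi (a g^-1%g x) -> 0 < orbit_mean chi x.
Proof. by move=> tchi; exact: (haar_gt0 hI (transversal_bump x tchi)). Qed.

Lemma orbit_mean_pos_ex chi x : transversally_compact chi -> 0 < orbit_mean chi x ->
  exists g, 0 < chi (a g^-1%g x).
Proof.
move=> tchi; apply: contraPP => H; rewrite /orbit_mean.
have [_ chi0 _] := tchi.
have -> : (fun g => chi (a g^-1%g x)) = (fun g => 0 * chi (a g^-1%g x)).
  apply/funext => g; rewrite mul0r; apply/eqP; rewrite eq_le chi0 andbT leNgt.
  by apply/negP => chip; apply: H; exists g.
by rewrite (haarZ hI)// ?mul0r ?ltxx//; exact: transversal_bump.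
Qed.

(* Let rho_i be the orbit mean of the i-th bump b_i of a countable cover, and tau_i the
   product over j < i of flat_exp(1 - i rho_j). If rho_j x > 0 then tau_i vanishes near x
   for large i, so chi = sum_i tau_i b_i is locally finite; as the tau_i are invariant, it
   is so uniformly along orbits. At the first i with rho_i x > 0 one has tau_i x > 0. *)
Lemma transversally_compact_exists :
  exists chi, transversally_compact chi /\ forall x, 0 < orbit_mean chi x.
Proof.
have [b [hb bx]] := @bump_cover R m X.
have tb i := bump_transversally_compact (hb i).
pose rho i x := orbit_mean (b i) x.
have srho i : smooth_fun (atlas X) (rho i : X -> R^o) by exact: orbit_mean_smooth.
have rho0 i x : 0 <= rho i x by exact: orbit_mean_ge0.
pose tau i x := \prod_(j < i) flat_exp 0 (1 - i%:R * rho j x).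
have flat0 (t : R) : 0 <= flat_exp 0 t by have /andP[] := flat_exp_le 0 t.
have tau0 i x : 0 <= tau i x by apply: prodr_ge0.
have stau i : smooth_fun (atlas X) (tau i : X -> R^o).
  apply: smooth_fun_prod => j; apply: smooth_fun_flat.
  have := smooth_fun_lin (- i%:R) (srho j) (@smooth_fun_cst R m X R^o 1).
  by congr smooth_fun; apply/funext => x; rewrite /GRing.scale /= mulNr addrC.
have tau_inv i g x : tau i (a g x) = tau i x.
  by apply: eq_bigr => j _; rewrite /rho orbit_mean_invariant.
have rho_pos x : exists j, 0 < rho j x.
  have [j bj] := bx x; exists j; apply: (@orbit_mean_gt0 _ 1%g) => //.
  by rewrite invg1 sact1.
have tau_van (x : X) : exists (N : set X) M, nbhs x N /\ forall y i, N y -> (M <= i)%N -> tau i y = 0.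
  have [j rj] := rho_pos x; pose d := rho j x / 2.
  have d0 : 0 < d by rewrite divr_gt0.
  have dx : d < rho j x by rewrite /d ltr_pdivrMr// ltr_pMr// ltr1n.
  (* Beyond j the product [tau i] contains the factor of index j; beyond 1/d one has i rho_j >= i d
     >= 1 on this neighbourhood, so that factor is 0. *)
  exists [set y | d < rho j y], (maxn j.+1 (Num.truncn d^-1).+1); split.
    exact: (smooth_fun_continuous (srho j) (open_nbhs_nbhs (conj (@open_gt R d) dx))).
  move=> y i /= dy; rewrite geq_max => /andP[ji Mi].
  rewrite /tau (bigD1 (Ordinal ji))//= flat_exp_neg ?mul0r// subr_le0.
  have i1 : d^-1 <= i%:R.
    have := truncnS_gt d^-1; move=> /ltW /le_trans; apply.
    by rewrite ler_nat.
  have : 1 <= i%:R * d by rewrite -ler_pdivrMr// mul1r.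
  by move=> /le_trans; apply; rewrite ler_wpM2l// ltW.
have /boolp.choice[M MP] : forall x, exists M, forall i, (M <= i)%N -> tau i x = 0.
  move=> x; have [N [M [nN NM]]] := tau_van x; exists M => i Mi; apply: NM => //.
  exact: nbhs_singleton.
(* The bound [M x] is chosen pointwise without regularity; [chiE] allows any bound beyond which the
   tau vanish, in particular one that is constant near a point. *)
pose chi x := \sum_(0 <= i < M x) tau i x * b i x.
have chiE K x : (forall i, (K <= i)%N -> tau i x = 0) -> chi x = \sum_(0 <= i < K) tau i x * b i x.
  have ext K1 K2 : (forall i, (K1 <= i)%N -> tau i x = 0) -> (K1 <= K2)%N ->
      \sum_(0 <= i < K1) tau i x * b i x = \sum_(0 <= i < K2) tau i x * b i x.
    move=> H K12; rewrite [RHS](big_cat_nat (leq0n K1) K12)/= [X in _ + X]big1_seq ?addr0// => i /=.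
    by rewrite mem_index_iota => /andP[/H-> _]; rewrite mul0r.
  move=> HK; rewrite /chi (ext _ (maxn (M x) K) (MP x)) ?leq_maxl//.
  by rewrite -(ext K) ?leq_maxr.
have b0 i x : 0 <= b i x by have [] := hb i.
have chi0 x : 0 <= chi x by apply: sumr_ge0 => i _; rewrite mulr_ge0.
have tchi : transversally_compact chi.
  split => //.
    apply: smooth_fun_local => x; have [N [K [nN NK]]] := tau_van x.
    exists N, (fun y => \sum_(0 <= i < K) tau i y * b i y : R^o); split => //.
      by apply: smooth_fun_sum => i; apply: smooth_funM => //; have [] := hb i.
    by move=> y Ny; apply: chiE => i; exact: NK.
  move=> x _; have [N [K [nN NK]]] := tau_van x.
  (* For y near x, invariance of tau leaves the same K terms at all points g^-1 y, and finitely many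
     compact sets have a compact union. *)
  have [N' [L [nN' cL NL]]] : exists N' L, [/\ nbhs x N', compact L & forall y g, N' y -> ~ L g ->
      forall i, (i < K)%N -> b i (a g^-1%g y) = 0].
    elim: K {NK} => [|K [N1 [L1 [nN1 cL1 NL1]]]]; first by exists setT, set0; split => //; [exact: filterT|exact: compact0].
    have [_ _ lK] := tb K; have [N2 [L2 [nN2 cL2 NL2]]] := lK x Logic.I.
    exists (N1 `&` N2), (L1 `|` L2); split; [exact: filterI|exact: compactU|].
    move=> y g [N1y N2y] /not_orP[nL1 nL2] i; rewrite ltnS leq_eqVlt => /orP[/eqP->|iK].
      exact: NL2.
    exact: (NL1 y g).
  exists (N `&` N'), L; split => //; first exact: filterI.
  move=> y g [Ny N'y] nLg; rewrite (chiE K); last by move=> i Ki; rewrite tau_inv; exact: NK.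
  rewrite big_nat_cond big1// => i /andP[/andP[_ iK] _].
  by rewrite (NL y g) ?mulr0.
exists chi; split => // x.
have ex_rho : exists i, 0 < rho i x by exact: rho_pos.
have [i ri imin] := ex_minnP ex_rho.
have [g bg] := orbit_mean_pos_ex (tb i) ri.
have taui : 0 < tau i x.
  apply: prodr_gt0 => j _; apply: flat_exp_pos.
  have -> : rho j x = 0.
    apply/eqP; rewrite eq_le rho0 andbT leNgt; apply/negP => /imin.
    by rewrite leqNgt ltn_ord.
  by rewrite mulr0 subr0.
(* The range is enlarged to contain i; [M x] remains a valid bound at g^-1 x because tau is
   invariant. *)
apply: (orbit_mean_gt0 (g := g) tchi); rewrite (chiE (maxn i.+1 (M x))); last first.
  by move=> j; rewrite geq_max tau_inv => /andP[_]; exact: MP.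
have iM : (i <= maxn i.+1 (M x))%N by rewrite (leq_trans (leqnSn i)) ?leq_maxl.
rewrite (big_cat_nat (leq0n i) iM) /=.
rewrite ltr_wpDl//; first by apply: sumr_ge0 => j _; rewrite mulr_ge0.
rewrite big_ltn ?leq_maxl// ltr_wpDr//; first by apply: sumr_ge0 => j _; rewrite mulr_ge0.
by rewrite mulr_gt0// tau_inv.
Qed.

(** The orbit mean is smooth, positive and constant on orbits, so dividing by it preserves the
    support condition and comes out of the integral as a constant. *)
Lemma cutoff_exists : exists chi, transversally_compact chi /\ forall x, orbit_mean chi x = 1.
Proof.
have [chi [tchi chip]] := transversally_compact_exists; have [schi chi0 lchi] := tchi.
exists (fun x => (orbit_mean chi x)^-1 * chi x); split; last first.
  move=> x.
  have -> : orbit_mean (fun y => (orbit_mean chi y)^-1 * chi y) x =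
    I (fun g => (orbit_mean chi (a g^-1%g x))^-1 * chi (a g^-1%g x)) by [].
  have -> : (fun g => (orbit_mean chi (a g^-1%g x))^-1 * chi (a g^-1%g x)) =
      (fun g => (orbit_mean chi x)^-1 * chi (a g^-1%g x)).
    by apply/funext => g; rewrite orbit_mean_invariant.
  rewrite (haarZ hI) ?invr_ge0 ?orbit_mean_ge0//; last exact: transversal_bump.
  by rewrite mulVf// gt_eqF// chip.
split.
- apply: smooth_funM => //; apply: smooth_fun_inv; last exact: orbit_mean_smooth.
  by move=> x; rewrite gt_eqF.
- by move=> x; rewrite mulr_ge0// invr_ge0 orbit_mean_ge0.
- move=> x _; have [N [L [nN cL NL]]] := lchi x Logic.I.
  by exists N, L; split => // y g Ny nLg; rewrite NL// mulr0.
Qed.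

End Cutoff.

(** * The homotopy *)

Section GroupValued.
Context {R : realType} {n : nat} {G : lieGroupType R n}.

Lemma sum_cvg (T A : Type) (FT : set_system T) (FFT : Filter FT) (F : tvsType R) (s : seq A)
  (f : A -> T -> F) (l : A -> F) : (forall i, f i @ FT --> l i) ->
  (fun t => \sum_(i <- s) f i t) @ FT --> \sum_(i <- s) l i.
Proof.
move=> fl; elim: s => [|i s IH].
  by rewrite big_nil; under eq_fun do rewrite big_nil; exact: cvg_cst.
by rewrite big_cons; under eq_fun do rewrite big_cons; apply: add_cvg.
Qed.

Lemma mx_linear_continuous (q p : nat) (F : tvsType R) (L : 'M[R]_(q, p) -> F) : linear L -> continuous L.
Proof.
move=> lL; have L0 : L 0 = 0 by have := lL (-1) 0 0; rewrite scaler0 addr0 scaleN1r addNr.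
have LD u v : L (u + v) = L u + L v by have := lL 1 u v; rewrite !scale1r.
have LZ a u : L (a *: u) = a *: L u by have := lL a u 0; rewrite L0 !addr0.
have -> : L = (fun M => \sum_i \sum_j M i j *: L (delta_mx i j)).
  apply/funext => M; rewrite {1}(matrix_sum_delta M) (big_morph L LD L0).
  by apply: eq_bigr => i _; rewrite (big_morph L LD L0); apply: eq_bigr => j _; rewrite LZ.
move=> M; have FM : Filter (nbhs M) := nbhs_filter M.
apply: (@sum_cvg _ _ (nbhs M) FM) => i; apply: (@sum_cvg _ _ (nbhs M) FM) => j.
by apply: scale_cvg; [exact: coord_continuous|exact: cvg_cst].
Qed.

(** C^j maps from an open subset of a vector space to G: only the target is read in charts, locally,
    which makes products and inverses of such maps easy to form. *)
Definition group_smooth j (E : tvsType R) (U : set E) (phi : E -> G) : Prop :=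
  (forall x, U x -> {for x, continuous phi}) /\
  forall d x, atlas G d -> U x -> cdom d (phi x) ->
    exists U', [/\ open U', U' x & diff_class j U' (d \o phi)].

Lemma open_preimage_on (E T : topologicalType) (U : set E) (f : E -> T) (O : set T) : open U -> open O ->
  (forall x, U x -> {for x, continuous f}) -> open (U `&` f @^-1` O).
Proof.
move=> oU oO cf; rewrite openE => x [Ux Ox]; apply: filterI; first exact: open_nbhs_nbhs.
by apply: (cf x Ux); exact: open_nbhs_nbhs.
Qed.

Lemma group_smoothM j (E : tvsType R) (U : set E) (phi psi : E -> G) : open U ->
  group_smooth j U phi -> group_smooth j U psi -> group_smooth j U (fun x => (phi x * psi x)%g).
Proof.
move=> oU [cphi sphi] [cpsi spsi].
have cpp x : U x -> {for x, continuous (fun x => (phi x, psi x))}.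
  by move=> Ux; apply: cvg_pair; [exact: cphi|exact: cpsi].
have cm x : U x -> {for x, continuous (fun x => (phi x * psi x)%g)}.
  move=> Ux; apply: (@cvg_comp _ _ _ (fun x => (phi x, psi x)) (fun p : G * G => (p.1 * p.2)%g) _ (nbhs (phi x, psi x))).
    exact: cpp.
  exact: (@lie_mul_continuous R n G (phi x, psi x)).
split => // d x Ad Ux dx.
have [c1 A1 c1x] := atlas_cover (phi x); have [c2 A2 c2x] := atlas_cover (psi x).
have [oc1 _ c1K _ _] := atlas_chart c1 A1; have [oc2 _ c2K _ _] := atlas_chart c2 A2.
have [od _ _ _ _] := atlas_chart d Ad.
have [U1 [oU1 U1x s1]] := sphi c1 x A1 Ux c1x; have [U2 [oU2 U2x s2]] := spsi c2 x A2 Ux c2x.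
have [cmul smul] := @lie_mul_smooth R n G.
have A12 : prod_atlas (atlas G) (atlas G) (prod_chart c1 c2) by exists c1 => //; exists c2.
have i12 : is_chart (prod_chart c1 c2) by apply: prod_chart_is_chart; exact: atlas_chart.
pose U' := (U1 `&` U2) `&` ((U `&` (fun x => (phi x * psi x)%g) @^-1` cdom d) `&`
  ((U `&` phi @^-1` cdom c1) `&` (U `&` psi @^-1` cdom c2))).
have oU' : open U'.
  apply: openI; first exact: openI.
  apply: openI; first exact: open_preimage_on.
  by apply: openI; exact: open_preimage_on.
exists U'; split => //.
set D := cim (prod_chart c1 c2) `&` [set y | cdom d ((fun p : G * G => (p.1 * p.2)%g) (cinv (prod_chart c1 c2) y))].
have oD : open D by apply: chart_open => //; exact: atlas_chart.
apply: (@diff_class_eq _ j _ _ _ ((d \o (fun p : G * G => (p.1 * p.2)%g) \o cinv (prod_chart c1 c2)) \o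
    (fun y => (c1 (phi y), c2 (psi y)))) _ oU').
  by move=> y [_ [_ [[_ c1y] [_ c2y]]]] /=; rewrite c1K// c2K.
apply: (@diff_class_comp _ j _ _ _ _ D _ _ oD); last exact: (smul _ _ A12 Ad j).
  move=> y [_ [[_ dy] [[_ c1y] [_ c2y]]]]; split; first by exists (phi y, psi y).
  by rewrite /= c1K// c2K.
apply: diff_class_pair; [apply: diff_class_sub s1|apply: diff_class_sub s2].
  by move=> y [[]].
by move=> y [[]].
Qed.

Lemma group_smoothV j (E : tvsType R) (U : set E) (phi : E -> G) : open U ->
  group_smooth j U phi -> group_smooth j U (fun x => (phi x)^-1%g).
Proof.
move=> oU [cphi sphi].
have cV x : U x -> {for x, continuous (fun x => (phi x)^-1%g)}.
  move=> Ux; apply: (@cvg_comp _ _ _ phi (fun g : G => g^-1%g) _ (nbhs (phi x))); first exact: cphi.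
  exact: lie_inv_continuous.
split => // d x Ad Ux dx.
have [c1 A1 c1x] := atlas_cover (phi x).
have [oc1 _ c1K _ _] := atlas_chart c1 A1; have [od _ _ _ _] := atlas_chart d Ad.
have [U1 [oU1 U1x s1]] := sphi c1 x A1 Ux c1x.
have [cinvG sinv] := @lie_inv_smooth R n G.
pose U' := U1 `&` ((U `&` (fun x => (phi x)^-1%g) @^-1` cdom d) `&` (U `&` phi @^-1` cdom c1)).
have oU' : open U'.
  by apply: openI => //; apply: openI; exact: open_preimage_on.
exists U'; split => //.
set D := cim c1 `&` [set y | cdom d ((fun g : G => g^-1%g) (cinv c1 y))].
have oD : open D by apply: chart_open => //; exact: atlas_chart.
apply: (@diff_class_eq _ j _ _ _ ((d \o (fun g : G => g^-1%g) \o cinv c1) \o (c1 \o phi)) _ oU').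
  by move=> y [_ [_ [_ c1y]]] /=; rewrite c1K.
apply: (@diff_class_comp _ j _ _ _ _ D _ _ oD); last exact: (sinv _ _ A1 Ad j).
  move=> y [_ [[_ dy] [_ c1y]]]; split; first by exists (phi y).
  by rewrite /= c1K.
by apply: diff_class_sub s1 => y [].
Qed.

Lemma group_smooth_cst j (E : tvsType R) (U : set E) g : open U -> group_smooth j U (fun _ => g).
Proof.
move=> oU; split; first by move=> x _; exact: cvg_cst.
by move=> d x Ad Ux dg; exists U; split => //; exact: (diff_class_cst j U (d g)).
Qed.

Lemma group_smooth_chart j (E : tvsType R) (U : set E) (c : chart G 'rV[R]_n) (L : E -> 'rV[R]_n) :
  open U -> atlas G c -> linear L -> continuous L -> (forall x, U x -> cim c (L x)) ->
  group_smooth j U (fun x => cinv c (L x)).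
Proof.
move=> oU Ac lL cL UL; have [oc oc' cK cc cc'] := atlas_chart c Ac.
have cg x : U x -> {for x, continuous (fun x => cinv c (L x))}.
  move=> Ux; apply: (@cvg_comp _ _ _ L (cinv c) _ (nbhs (L x))); first exact: cL.
  by apply: cc'; exact: UL.
split => // d x Ad Ux dx; have [od _ _ _ _] := atlas_chart d Ad.
exists (U `&` (fun x => cinv c (L x)) @^-1` cdom d); split => //; first exact: open_preimage_on.
have := diff_class_comp_linear lL cL (atlas_compat c d Ac Ad j).
apply: diff_class_sub => y [Uy dy] /=.
have [g cg' E'] := UL y Uy; exists g => //; split => //.
by move: dy; rewrite /= -E' cK.
Qed.

Lemma group_smooth_prod j (E : tvsType R) (U : set E) (A : Type) (s : seq A) (phi : A -> E -> G) :
  open U -> (forall i, group_smooth j U (phi i)) ->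
  group_smooth j U (fun x => (\prod_(i <- s) phi i x)%g).
Proof.
move=> oU sphi; elim: s => [|i s IH].
  have -> : (fun x => (\prod_(i <- [::]) phi i x)%g) = (fun _ => 1%g).
    by apply/funext => x; rewrite big_nil.
  exact: group_smooth_cst.
have -> : (fun x => (\prod_(k <- i :: s) phi k x)%g) = (fun x => (phi i x * \prod_(k <- s) phi k x)%g).
  by apply/funext => x; rewrite big_cons.
exact: group_smoothM.
Qed.

Lemma ptws_continuous_at (T : topologicalType) (r : nat) (f : T -> {ptws 'I_r -> G}) x :
  (forall i, {for x, continuous (fun y => f y i)}) -> {for x, continuous f}.
Proof.
move=> cf; apply/cvg_sup => i A [B [[C oC <-] Cfx] sBA].
suff H : nbhs x [set y | A (f y)] by exact: H.
have H : nbhs x [set y | C (f y i)] by apply: (cf i); apply: open_nbhs_nbhs.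
by apply: filterS H => y Cy; apply: sBA.
Qed.

Lemma ptws_proj_continuous (r : nat) (i : 'I_r) : continuous (fun a : {ptws 'I_r -> G} => a i).
Proof. exact: (@proj_continuous 'I_r (fun _ => G) i). Qed.

Lemma pow_chart_cim_open (r : nat) (c : 'I_r -> chart G 'rV[R]_n) : (forall i, atlas G (c i)) ->
  open (cim (pow_chart c)) /\ forall y, cim (pow_chart c) y <-> forall i, cim (c i) (row i y).
Proof.
move=> Ac.
have E y : cim (pow_chart c) y <-> forall i, cim (c i) (row i y).
  split=> [[a ca <-] i|H].
    exists (a i); first exact: ca.
    by apply/rowP => j; rewrite !mxE.
  exists (fun i => cinv (c i) (row i y)).
    move=> i /=; have [g cg <-] := H i.
    by have [_ _ cK _ _] := atlas_chart (c i) (Ac i); rewrite cK.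
  apply/matrixP => i j; rewrite mxE /=; have [g cg gE] := H i.
  have [_ _ cK _ _] := atlas_chart (c i) (Ac i).
  by rewrite -gE cK// gE mxE.
split => //; rewrite openE => y /E Hy.
have H : nbhs y [set z | forall i, cim (c i) (row i z)].
  apply: (@filter_forall _ _ (fun i z => cim (c i) (row i z)) (nbhs y) (nbhs_filter y)) => i.
  have [_ oc _ _ _] := atlas_chart (c i) (Ac i).
  have cr : continuous (fun z : 'M[R]_(r, n) => row i z).
    by apply: mx_linear_continuous => k u v; rewrite linearP.
  by apply: (cr y); apply: open_nbhs_nbhs.
by apply: filterS H => z /E.
Qed.

Lemma smooth_cochain_comp j (r : nat) (E : tvsType R) (W : lcsType R) (U : set E)
    (l : ('I_r -> G) -> W) (phi : 'I_r -> E -> G) : open U ->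
  smooth_fun (pow_atlas (atlas G)) l -> (forall i, group_smooth j U (phi i)) ->
  diff_class j U (fun x => l (fun i => phi i x)).
Proof.
move=> oU sl sphi; apply: diff_class_local => x Ux.
pose P i (q : chart G 'rV[R]_n * set E) := [/\ atlas G q.1, open q.2, q.2 x,
  forall y, q.2 y -> cdom q.1 (phi i y) & diff_class j q.2 (q.1 \o phi i)].
have /boolp.choice[q qP] : forall i, exists q, P i q.
  move=> i; have [d Ad dx] := atlas_cover (phi i x); have [cphi si] := sphi i.
  have [U1 [oU1 U1x s1]] := si d x Ad Ux dx; have [od _ _ _ _] := atlas_chart d Ad.
  exists (d, U1 `&` (U `&` phi i @^-1` cdom d)); split => //=.
  - by apply: openI => //; exact: open_preimage_on.
  - by move=> y [_ []].
  - by apply: diff_class_sub s1 => y [].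
pose c i := (q i).1.
have Ac i : atlas G (c i) by have [] := qP i.
have nN : nbhs x [set y | forall i, (q i).2 y].
  apply: (@filter_forall _ _ (fun i y => (q i).2 y) (nbhs x) (nbhs_filter x)) => i.
  by have [_ oq qx _ _] := qP i; exact: open_nbhs_nbhs.
have [oN sN] : open [set y | forall i, (q i).2 y]^° /\ [set y | forall i, (q i).2 y]^° `<=` [set y | forall i, (q i).2 y].
  by split; [exact: open_interior|exact: interior_subset].
exists [set y | forall i, (q i).2 y]^°; split => //.
pose Phi y : 'M[R]_(r, n) := \matrix_(i, k) c i (phi i y) 0 k.
have [oC CE] := pow_chart_cim_open Ac.
have dphi y i : [set y | forall i, (q i).2 y]^° y -> cdom (c i) (phi i y).
  by move=> /sN /(_ i); have [_ _ _ H _] := qP i; exact: H.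
apply: (@diff_class_eq _ j _ _ _ ((l \o cinv (pow_chart c)) \o Phi) _ oN).
  move=> y Ny /=; congr l; apply/funext => i.
  have [_ _ cK _ _] := atlas_chart (c i) (Ac i).
  have -> : row i (Phi y) = c i (phi i y) by apply/rowP => k; rewrite !mxE.
  by rewrite cK//; exact: dphi.
apply: (@diff_class_comp _ j _ _ _ _ (cim (pow_chart c)) _ _ oC); last first.
- by apply: sl; exists c.
(* Putting a vector into row i is linear, so [Phi] is a finite sum of C^j maps. *)
- have -> : Phi = (fun y => \sum_i delta_mx i (0 : 'I_1) *m c i (phi i y)).
    apply/funext => y; apply/matrixP => i k; rewrite mxE summxE (bigD1 i)//= big1 ?addr0.
      by rewrite mxE big_ord1 !mxE !eqxx mul1r.
    by move=> i' i'i; rewrite mxE big_ord1 !mxE eq_sym (negbTE i'i) mul0r.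
  apply: diff_class_sum => i _.
  have lL : linear (fun v : 'rV[R]_n => delta_mx i (0 : 'I_1) *m v : 'M[R]_(r, n)).
    by move=> k u v; rewrite linearP.
  apply: (@diff_class_comp _ j _ _ _ _ setT (c i \o phi i) _ openT) => //.
    have [_ _ _ _ s1] := qP i; apply: diff_class_sub s1 => y /sN; exact.
  by apply: diff_class_linear => //; exact: mx_linear_continuous.
- move=> y Ny; apply/CE => i; exists (phi i y); first exact: dphi.
  by apply/rowP => k; rewrite !mxE.
Qed.

End GroupValued.

(** * Tuples of group elements, their products and their faces *)

Section Tuples.
Variable G : groupType.

Definition append (q : nat) (a : 'I_q -> G) (g : G) : 'I_q.+1 -> G := fun i =>
  if unlift ord_max i is Some j then a j else g.

Definition tprod (q : nat) (a : 'I_q -> G) : G := (\prod_(i < q) a i)%g.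

Lemma append_max q (a : 'I_q -> G) g : append a g ord_max = g.
Proof. by rewrite /append unlift_none. Qed.

Lemma append_lt q (a : 'I_q -> G) g (i : 'I_q.+1) (iq : (i < q)%N) : append a g i = a (Ordinal iq).
Proof.
rewrite /append; case: unliftP => [j Ej|Ei]; last by exfalso; move: (iq); have -> : (i : nat) = q by [rewrite Ei]; rewrite ltnn.
by congr a; apply/val_inj; rewrite /= Ej /= /bump leqNgt ltn_ord.
Qed.

Lemma append_widen q (a : 'I_q -> G) g (j : 'I_q) : append a g (widen_ord (leqnSn q) j) = a j.
Proof.
by rewrite (append_lt _ _ (ltn_ord j : (widen_ord (leqnSn q) j < q)%N)); congr a; exact/val_inj.
Qed.

Lemma append_tail q (a : 'I_q.+1 -> G) g (j : 'I_q.+1) :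
  append a g (lift ord0 j) = append (fun j => a (lift ord0 j)) g j.
Proof.
have [jq|jq] := ltnP j q.
  have lq : (lift ord0 j < q.+1)%N by rewrite lift0.
  by rewrite (append_lt _ _ lq) (append_lt _ _ jq); congr a; apply/val_inj.
have -> : j = ord_max by apply/val_inj/eqP; rewrite /= eqn_leq jq -ltnS ltn_ord.
have -> : lift ord0 (ord_max : 'I_q.+1) = ord_max by apply/val_inj; rewrite /= /bump.
by rewrite !append_max.
Qed.

Lemma tprod_tail q (a : 'I_q.+1 -> G) : tprod a = (a ord0 * tprod (fun j => a (lift ord0 j)))%g.
Proof. by rewrite /tprod big_ord_recl. Qed.

Lemma tprod_init q (a : 'I_q.+1 -> G) :
  tprod a = (tprod (fun j => a (widen_ord (leqnSn q) j)) * a ord_max)%g.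
Proof. by rewrite /tprod big_ord_recr. Qed.

End Tuples.

Section Faces.
Context {R : realType} {n : nat} {G : lieGroupType R n}.

Lemma face_append_max q (a : 'I_q.+1 -> G) g :
  face ord_max (append a g) = append (fun j => a (widen_ord (leqnSn q) j)) (a ord_max * g)%g.
Proof.
apply/funext => j; rewrite /face; case: ltnP => jq.
  have jq' : (widen_ord (leqnSn q.+1) j < q.+1)%N by rewrite /= ltnW.
  by rewrite (append_lt _ _ jq') (append_lt _ _ jq); congr a; apply/val_inj.
have -> : j = ord_max by apply/val_inj/eqP; rewrite /= eqn_leq jq -ltnS ltn_ord.
rewrite eqxx append_max append_widen.
have -> : lift ord0 (ord_max : 'I_q.+1) = ord_max by apply/val_inj; rewrite /= /bump.
by rewrite append_max.
Qed.

Lemma face_append q (a : 'I_q.+1 -> G) g (i : 'I_q) :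
  face (widen_ord (leqnSn q) i) (append a g) = append (face i a) g.
Proof.
apply/funext => j; have [jq|jq] := ltnP j q; last first.
  have -> : j = ord_max by apply/val_inj/eqP; rewrite /= eqn_leq jq -ltnS ltn_ord.
  rewrite append_max /face /= ltnNge (ltnW (ltn_ord i)) /=.
  case: eqP => [E|_]; first by have := congr1 val E => /= Eq; have := ltn_ord i; rewrite -Eq ltnn.
  have -> : lift ord0 (ord_max : 'I_q.+1) = ord_max by apply/val_inj; rewrite /= /bump.
  by rewrite append_max.
rewrite (append_lt _ _ jq) /face /=.
have w1 : (widen_ord (leqnSn q.+1) j < q.+1)%N by rewrite /= ltnW.
have w2 : (lift ord0 j < q.+1)%N by rewrite lift0.
rewrite !(append_lt _ _ w1) !(append_lt _ _ w2).
have -> : a (Ordinal w1) = a (widen_ord (leqnSn q) (Ordinal jq)) by congr a; apply/val_inj.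
have -> : a (Ordinal w2) = a (lift ord0 (Ordinal jq)) by congr a; apply/val_inj.
have -> : (j == widen_ord (leqnSn q) i) = (Ordinal jq == i) by rewrite -!val_eqE.
by [].
Qed.

Lemma face0_tprod q (a : 'I_q.+2 -> G) : tprod (face ord0 a) = tprod a.
Proof.
rewrite tprod_tail [RHS]tprod_tail [in RHS]tprod_tail mulgA; congr (_ * _)%g.
  by rewrite /face /=; congr (a _ * a _)%g; exact/val_inj.
Qed.

(** Associativity. Consequently every inner face of b is averaged with the same shift (tprod b)^-1
    as b itself. *)
Lemma tprod_face q (a : 'I_q.+1 -> G) (i : 'I_q) : tprod (face i a) = tprod a.
Proof.
elim: q a i => [a [] //|q IH] a i.
have [->|i0] := eqVneq i ord0; first exact: face0_tprod.
have [i' Ei] : exists i' : 'I_q, i = lift ord0 i'.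
  by case: (unliftP ord0 i) i0 => [j -> _|->]; [exists j|rewrite eqxx].
rewrite tprod_tail [RHS]tprod_tail; congr (_ * _)%g.
  rewrite /face Ei /=; congr a; exact/val_inj.
rewrite -(IH _ i'); congr tprod; apply/funext => j; rewrite /face Ei /= /bump !add1n ltnS.
have -> : (lift ord0 j == lift ord0 i') = (j == i') by rewrite (inj_eq lift_inj).
by case: ifP => _; [congr a; exact/val_inj|case: ifP => _ //; congr (a _ * _)%g; exact/val_inj].
Qed.

End Faces.

Section Homotopy.
Context {R : realType} {n m : nat} {G : lieGroupType R n} {X : manifoldType R m} {V : lcsType R}.
Variables (a : smooth_action G X) (M : gmodule G V).
Variables (I : (G -> R) -> R) (FF : set_system (seq (R * G))).
Hypotheses (hI : haar_functional I) (hFF : haar_net I FF) (hV : has_integrals FF V).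
Variable chi : X -> R.
Hypothesis (schi : smooth_fun (atlas X) (chi : X -> R^o)).
Hypothesis (tchi : transversally_compact a chi).
Hypothesis (mchi : forall x, orbit_mean a I chi x = 1).

Local Notation W := (Cinf X V).
Local Notation act := (cinf_action a M).
Local Notation k := (translate a schi).

Let ck : continuous k. Proof. exact: translate_continuous. Qed.
Let sk : locally_supported setT (fun x g => k g x). Proof. by case: tchi. Qed.

Lemma average_cst (w : W) : average FF k (fun _ => w) = w.
Proof.
have cw : continuous (fun _ : G => w) by move=> g; exact: cvg_cst.
apply/val_inj/funext => x.
have -> : val (average FF k (fun _ => w)) x = average FF k (fun _ => w) x by [].
rewrite (averageE hI hFF hV ck sk x cw).
rewrite (integralE hFF (is_integral_scalar (v := w x) hFF (transversal_bump x tchi))).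
by have := mchi x; rewrite /orbit_mean => ->; rewrite scale1r.
Qed.

(** At x the right side has weight chi(g^-1 h^-1 x). Moving the continuous linear map M h under the
    integral and substituting h^-1 g for g turns this weight into chi(g^-1 x). *)
Lemma average_act h (u : G -> W) : continuous u -> continuous (fun g => act h (u (h^-1 * g)%g)) ->
  average FF k (fun g => act h (u (h^-1 * g)%g)) = act h (average FF k u).
Proof.
move=> cu cu'; apply/val_inj/funext => x.
have -> : val (average FF k (fun g => act h (u (h^-1 * g)%g))) x =
  average FF k (fun g => act h (u (h^-1 * g)%g)) x by [].
have -> : val (act h (average FF k u)) x = M h (average FF k u (a h^-1%g x)) by [].
rewrite (averageE hI hFF hV ck sk x cu') (averageE hI hFF hV ck sk _ cu).
pose y := a h^-1%g x.
have cMh : continuous (M h).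
  move=> v; apply: (@cvg_comp _ _ _ (fun v => (h, v)) (fun p : G * V => M p.1 p.2) _ (nbhs (h, v))).
    by apply: (@cvg_pair V G V (nbhs v) (nbhs h) (nbhs v)); [exact: cvg_cst|exact: cvg_id].
  exact: (@gact_continuous _ _ _ _ M (h, v)).
have cf := average_csc ck sk y cu.
have H := is_integral_map cMh (integralP hFF hV cf).
have cMf : csc (M h \o (fun g => (k g y : R) *: u g y)).
  have [c1 [L cL Lf]] := cf; split.
    by move=> g; apply: continuous_comp; [exact: c1|exact: cMh].
  by exists L => // g /Lf; rewrite /= => ->; rewrite linear0.
rewrite -(integralE hFF H) -(integral_lmul hI hFF h^-1%g hV cMf).
congr integral; apply/funext => g /=.
rewrite linearZ /=; congr (_ *: _).
by rewrite /y invgM invgK -sactM -mulgA mulgV mulg1.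
Qed.

Lemma average_sum (A : Type) (s : seq A) (c : A -> R) (u : A -> G -> W) : (forall i, continuous (u i)) ->
  continuous (fun g => \sum_(i <- s) c i *: u i g) /\
  average FF k (fun g => \sum_(i <- s) c i *: u i g) = \sum_(i <- s) c i *: average FF k (u i).
Proof.
move=> cu; elim: s => [|i s [cs IH]].
  have -> : (fun g => \sum_(i <- [::]) c i *: u i g) = (fun _ => 0 : W).
    by apply/funext => g; rewrite big_nil.
  by rewrite big_nil average_cst; split => // g; exact: cvg_cst.
have -> : (fun g => \sum_(j <- i :: s) c j *: u j g) = (fun g => c i *: u i g + \sum_(j <- s) c j *: u j g).
  by apply/funext => g; rewrite big_cons.
split.
  move=> g; apply: add_cvg; last exact: cs.
  by apply: scale_cvg; [exact: cvg_cst|exact: cu].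
by rewrite big_cons (average_lin hI hFF hV ck sk (c i) (cu i) cs) IH.
Qed.

(** In homogeneous terms the tuple (b, P^-1 g), with P the product of b, is the simplex with
    vertices 1, b_0, b_0 b_1, ..., P, g. This is the cone construction with apex g placed last,
    averaged over the apex. *)
Definition homotopy (q : nat) (l : cochain G W q.+1) : cochain G W q := fun b =>
  average FF k (fun g => l (append b ((tprod b)^-1 * g)%g)).

(* [coc] is the cocycle identity at (b, P^-1 g) with P the product of b; the average of its
   term u0, that of the i-th inner face and that of ul are the terms of the coboundary of
   the homotopy at b, and the remaining term l b is independent of g. *)
Lemma coboundary_homotopy q (l : cochain G W q.+1) :
  (forall b, continuous (fun g => l (append b g))) -> coboundary act l = 0 ->
  forall b, coboundary act (homotopy l) b = (-1) ^+ q.+1 *: l b.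
Proof.
move=> cl l0 b; set P := tprod b.
have clm c t : continuous (fun g => l (append c (t * g)%g)).
  move=> g; apply: (@cvg_comp _ _ _ (fun g : G => (t * g)%g) (fun g => l (append c g)) _ (nbhs (t * g)%g)).
    exact: lmul_continuous.
  exact: cl.
pose tl := fun j : 'I_q => b (lift ord0 j).
pose ini := fun j : 'I_q => b (widen_ord (leqnSn q) j).
pose u0 g := act (b ord0) (l (append tl (P^-1 * g)%g)).
pose ui (i : 'I_q) g := l (append (face i b) (P^-1 * g)%g).
pose ul g := l (append ini ((b ord_max * P^-1) * g)%g).
have cui i : continuous (ui i) by exact: clm.
have cul : continuous ul by exact: clm.
have [cS aS] := average_sum (index_enum _) (fun i : 'I_q => (-1) ^+ i.+1) cui.
set S := (fun g => _) in cS aS.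
have coc g : u0 g = (-1) *: S g + ((-1) ^+ q *: ul g + (-1) ^+ q.+1 *: l b).
  have := congr1 (fun f => f (append b (P^-1 * g)%g)) l0; rewrite /coboundary /=.
  have -> : append b (P^-1 * g)%g ord0 = b ord0.
    by rewrite (append_lt _ _ (ltn0Sn q : (ord0 < q.+1)%N)); congr b; exact/val_inj.
  have -> : (fun j => append b (P^-1 * g)%g (lift ord0 j)) = append tl (P^-1 * g)%g.
    by apply/funext => j; rewrite append_tail.
  have -> : (fun j => append b (P^-1 * g)%g (widen_ord (leqnSn q.+1) j)) = b.
    by apply/funext => j; rewrite append_widen.
  rewrite big_ord_recr /= face_append_max mulgA -/(ul g) -/(u0 g).
  have -> : \sum_(i < q) (-1) ^+ i.+1 *: l (face (widen_ord (leqnSn q) i) (append b (P^-1 * g)%g)) = S g.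
    by apply: eq_bigr => i _; rewrite face_append.
  have -> : (-1 : R) ^+ q.+2 = - (-1) ^+ q.+1 by rewrite exprS mulN1r.
  have -> : (-1 : R) ^+ q.+1 = - (-1) ^+ q by rewrite exprS mulN1r.
  rewrite opprK !scaleNr scale1r => /eqP; rewrite -addrA addr_eq0 => /eqP ->.
  by rewrite !opprD opprK addrA.
have c3 : continuous (fun g => (-1) ^+ q *: ul g + (-1) ^+ q.+1 *: l b).
  move=> g; apply: add_cvg; last exact: cvg_cst.
  by apply: scale_cvg; [exact: cvg_cst|exact: cul].
(* The function [u0] involves the action on [Cinf X V]; its continuity in g is read off from the
   identity [coc]. *)
have cu0 : continuous u0.
  have -> : u0 = (fun g => (-1) *: S g + ((-1) ^+ q *: ul g + (-1) ^+ q.+1 *: l b)) by exact/funext.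
  move=> g; apply: add_cvg; last exact: c3.
  by apply: scale_cvg; [exact: cvg_cst|exact: cS].
have a0 : act (b ord0) (homotopy l tl) = average FF k u0.
  have E0 : u0 = (fun g => act (b ord0) (l (append tl ((tprod tl)^-1 * ((b ord0)^-1 * g))%g))).
    by apply/funext => g; rewrite /u0 /P tprod_tail invgM mulgA.
  rewrite E0 in cu0 *.
  by rewrite (average_act (h := b ord0) (u := fun g => l (append tl ((tprod tl)^-1 * g)%g)) (clm _ _) cu0).
have ai i : homotopy l (face i b) = average FF k (ui i) by rewrite /homotopy tprod_face.
have al : homotopy l ini = average FF k ul.
  rewrite /homotopy; congr (average _ _ _); apply/funext => g; rewrite /ul; congr (l (append _ (_ * g)%g)).
  by rewrite /P tprod_init invgM mulgA mulgV mul1g.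
rewrite /coboundary -/tl -/ini a0 al; under eq_bigr do rewrite ai.
rewrite -aS.
have -> : u0 = (fun g => (-1) *: S g + ((-1) ^+ q *: ul g + (-1) ^+ q.+1 *: l b)) by exact/funext.
rewrite (average_lin hI hFF hV ck sk _ cS c3).
have cc : continuous (fun _ : G => (-1) ^+ q.+1 *: l b) by move=> g; exact: cvg_cst.
rewrite (average_lin hI hFF hV ck sk _ cul cc) average_cst.
have -> : (-1 : R) ^+ q.+1 = - (-1) ^+ q by rewrite exprS mulN1r.
rewrite !scaleNr scale1r; set A := average _ _ S; set B := _ *: average _ _ _; set C := _ *: l b.
by rewrite [- A + _]addrC subrK addrAC subrr add0r.
Qed.

Lemma coboundaryZ q (c : R) (l : cochain G W q) b :
  coboundary act (fun b => c *: l b) b = c *: coboundary act l b.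
Proof.
rewrite /coboundary !scalerDr linearZ /= scaler_sumr !scalerA mulrC; congr (_ + _ + _).
by apply: eq_bigr => i _; rewrite !scalerA mulrC.
Qed.

End Homotopy.

(** * Continuity and smoothness of the homotopy *)

Section Cochains.
Context {R : realType} {n : nat} {G : lieGroupType R n} {W : lcsType R}.

(** This lets the computation of a primitive, which asks for continuity of the cochain, serve both
    complexes. *)
Lemma smooth_cochain_continuous r (l : ('I_r -> G) -> W) : smooth_fun (pow_atlas (atlas G)) l ->
  continuous (l : {ptws 'I_r -> G} -> W).
Proof.
move=> sl a.
have /boolp.choice[c cP] : forall i, exists c, atlas G c /\ cdom c (a i).
  by move=> i; have [c Ac ca] := atlas_cover (a i); exists c.
have Ac i : atlas G (c i) by case: (cP i).
have [oC CE] := pow_chart_cim_open Ac.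
have Ka (b : 'I_r -> G) : (forall i, cdom (c i) (b i)) -> l b = (l \o cinv (pow_chart c)) (pow_chart c b).
  move=> cb /=; congr l; apply/funext => i.
  have [_ _ cK _ _] := atlas_chart (c i) (Ac i).
  have -> : row i (\matrix_(i, k) c i (b i) 0 k) = c i (b i) by apply/rowP => k; rewrite !mxE.
  by rewrite cK.
have Ca : cim (pow_chart c) (pow_chart c a) by exists a => // i; case: (cP i).
have cl : {for pow_chart c a, continuous (l \o cinv (pow_chart c))}.
  by have := sl (pow_chart c) _ 0%N => /(_ (ex_intro2 _ _ c Ac erefl)) [+ _]; apply.
have cC : (pow_chart c : {ptws 'I_r -> G} -> _) @ (a : {ptws 'I_r -> G}) --> pow_chart c a.
  have E (b : 'I_r -> G) : pow_chart c b = \sum_i delta_mx i (0 : 'I_1) *m c i (b i).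
    apply/matrixP => i k; rewrite mxE summxE (bigD1 i)//= big1 ?addr0.
      by rewrite mxE big_ord1 !mxE !eqxx mul1r.
    by move=> i' i'i; rewrite mxE big_ord1 !mxE eq_sym (negbTE i'i) mul0r.
  rewrite (_ : (pow_chart c : {ptws 'I_r -> G} -> _) = fun b => \sum_i delta_mx i (0 : 'I_1) *m c i (b i)); last exact/funext.
  have FN : Filter (nbhs (a : {ptws 'I_r -> G})) := nbhs_filter _.
  apply: (@sum_cvg _ _ _ _ FN) => i.
  have cL : continuous (fun v : 'rV[R]_n => delta_mx i (0 : 'I_1) *m v : 'M[R]_(r, n)).
    by apply: mx_linear_continuous => k u v; rewrite linearP.
  have [_ _ _ cc _] := atlas_chart (c i) (Ac i).
  apply: (@cvg_comp _ _ _ (fun b : {ptws 'I_r -> G} => c i (b i)) _ _ (nbhs (c i (a i)))); last exact: cL.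
  apply: (@cvg_comp _ _ _ (fun b : {ptws 'I_r -> G} => b i) (c i) _ (nbhs (a i))); last by apply: cc; case: (cP i).
  exact: ptws_proj_continuous.
rewrite /continuous_at (Ka a); last by move=> i; case: (cP i).
have H := @cvg_comp _ _ _ (pow_chart c : {ptws 'I_r -> G} -> _) (l \o cinv (pow_chart c)) _ _ _ cC cl.
apply: cvg_trans H; apply: near_eq_cvg; first exact: (nbhs_filter (a : {ptws 'I_r -> G})).
have nN : nbhs (a : {ptws 'I_r -> G}) [set b | forall i, cdom (c i) (b i)].
  apply: (@filter_forall _ _ (fun i (b : {ptws 'I_r -> G}) => cdom (c i) (b i)) _ (nbhs_filter (a : {ptws 'I_r -> G}))) => i.
  have [oc _ _ _ _] := atlas_chart (c i) (Ac i).
  by apply: (@ptws_proj_continuous R n G r i a); apply: open_nbhs_nbhs; split => //; case: (cP i).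
by apply: (@filterS _ _ (nbhs_filter (a : {ptws 'I_r -> G})) _ _ _ nN) => b /Ka.
Qed.

Lemma tprod_continuous q : continuous (@tprod G q : {ptws 'I_q -> G} -> G).
Proof.
move=> a; rewrite /tprod /continuous_at.
elim: (index_enum _) => [|i s IH].
  rewrite (_ : (fun b : {ptws 'I_q -> G} => (\prod_(i <- [::]) b i)%g) = fun _ => 1%g);
    last by apply/funext => b; rewrite big_nil.
  by rewrite big_nil; exact: (@cvg_cst _ _ _ _ (nbhs_filter (a : {ptws 'I_q -> G}))).
rewrite big_cons (_ : (fun b : {ptws 'I_q -> G} => (\prod_(j <- i :: s) b j)%g) =
  fun b => (b i * \prod_(j <- s) b j)%g); last by apply/funext => b; rewrite big_cons.
apply: (@cvg_comp _ _ _ (fun b : {ptws 'I_q -> G} => (b i, (\prod_(j <- s) b j)%g)) (fun p : G * G => (p.1 * p.2)%g)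
   _ (nbhs (a i, (\prod_(j <- s) a j)%g))).
  apply: (@cvg_pair {ptws 'I_q -> G} G G (nbhs (a : {ptws 'I_q -> G})) (nbhs (a i)) (nbhs (\prod_(j <- s) a j)%g)); last exact: IH.
  exact: ptws_proj_continuous.
exact: (@lie_mul_continuous R n G (a i, (\prod_(j <- s) a j)%g)).
Qed.

Lemma append_continuous q (l : ('I_q.+1 -> G) -> W) :
  continuous (l : {ptws 'I_q.+1 -> G} -> W) -> forall (b : {ptws 'I_q -> G}) (g : G),
  {for (b, g), continuous (fun p : {ptws 'I_q -> G} * G => l (append p.1 ((tprod p.1)^-1 * p.2)%g))}.
Proof.
move=> cl b g.
apply: (@cvg_comp _ _ _ (fun p : {ptws 'I_q -> G} * G => append p.1 ((tprod p.1)^-1 * p.2)%g : {ptws 'I_q.+1 -> G})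
  l _ (nbhs (append b ((tprod b)^-1 * g)%g : {ptws 'I_q.+1 -> G}))); last exact: cl.
apply: (@ptws_continuous_at R n G ({ptws 'I_q -> G} * G)%type q.+1
  (fun p => append p.1 ((tprod p.1)^-1 * p.2)%g) (b, g)) => i; rewrite /append; case: unliftP => [j _|_].
  apply: (@cvg_comp _ _ _ (fun p : {ptws 'I_q -> G} * G => p.1) (fun b : {ptws 'I_q -> G} => b j) _ (nbhs b)).
    exact: cvg_fst.
  exact: ptws_proj_continuous.
apply: (@cvg_comp _ _ _ (fun p : {ptws 'I_q -> G} * G => ((tprod p.1)^-1%g, p.2)) (fun p : G * G => (p.1 * p.2)%g)
   _ (nbhs ((tprod b)^-1%g, g))); last exact: (@lie_mul_continuous R n G ((tprod b)^-1%g, g)).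
apply: cvg_pair; last exact: cvg_snd.
apply: (@cvg_comp _ _ _ (fun p : {ptws 'I_q -> G} * G => tprod p.1) (fun g : G => g^-1%g) _ (nbhs (tprod b))).
  apply: (@cvg_comp _ _ _ (fun p : {ptws 'I_q -> G} * G => p.1) (@tprod G q) _ (nbhs b)); first exact: cvg_fst.
  exact: tprod_continuous.
exact: lie_inv_continuous.
Qed.

End Cochains.

Section HomotopyRegularity.
Context {R : realType} {n m : nat} {G : lieGroupType R n} {X : manifoldType R m} {V : lcsType R}.
Variables (a : smooth_action G X) (I : (G -> R) -> R) (FF : set_system (seq (R * G))).
Hypotheses (hI : haar_functional I) (hFF : haar_net I FF) (hV : has_integrals FF V).
Variable chi : X -> R.
Hypothesis (schi : smooth_fun (atlas X) (chi : X -> R^o)).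
Hypothesis (tchi : transversally_compact a chi).

Local Notation W := (Cinf X V).

Let ck : continuous (translate a schi). Proof. exact: translate_continuous. Qed.
Let sk : locally_supported setT (fun x g => translate a schi g x). Proof. by case: tchi. Qed.

Lemma continuous_homotopy q (l : cochain G W q.+1) : continuous (l : {ptws 'I_q.+1 -> G} -> W) ->
  continuous (homotopy a FF schi l : {ptws 'I_q -> G} -> W).
Proof.
move=> cl b.
have cu (c : {ptws 'I_q -> G}) (g : G) : [set: {ptws 'I_q -> G}] c ->
    {for (c, g), continuous (fun p : {ptws 'I_q -> G} * G => l (append p.1 ((tprod p.1)^-1 * p.2)%g))}.
  by move=> _; exact: append_continuous.
have H := @average_continuous _ _ _ _ _ _ _ _ hI hFF hV _ ck sk
  {ptws 'I_q -> G} setT (fun b g => l (append b ((tprod b)^-1 * g)%g)) openT cu b Logic.I.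
exact: H.
Qed.

Lemma smooth_homotopy q (l : cochain G W q.+1) : smooth_fun (pow_atlas (atlas G)) l ->
  smooth_fun (pow_atlas (atlas G)) (homotopy a FF schi l).
Proof.
move=> sl _ [c Ac <-] j; have [oC CE] := pow_chart_cim_open Ac.
pose b (y : 'M[R]_(q, n)) := cinv (pow_chart c) y.
apply: (average_diff_class hI hFF hV ck sk
  (F := fun y g => l (append (b y) ((tprod (b y))^-1 * g)%g)) oC).
move=> e Ae; have [oe oe' eK ce ce'] := atlas_chart e Ae.
have oO : open (cim (pow_chart c) `*` cim e).
  rewrite openE => -[y z] [Cy ez]; exists (cim (pow_chart c), cim e) => //.
  by split; exact: open_nbhs_nbhs.
(* In chart coordinates (y, z) of (b, g), each entry of the tuple (b, P^-1 g) is a C^j map into G,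
   so composing with l shows that the integrand is of class C^j jointly in b and g. *)
have sb i : group_smooth j (cim (pow_chart c) `*` cim e) (fun p => b p.1 i).
  apply: (@group_smooth_chart _ _ _ _ _ _ (c i) (fun p : 'M[R]_(q, n) * 'rV[R]_n => row i p.1) oO (Ac i)).
  - by move=> k u v; rewrite -linearP.
  - move=> p; apply: (@cvg_comp _ _ _ fst (fun y : 'M[R]_(q, n) => row i y) _ (nbhs p.1)); first exact: cvg_fst.
    by apply: mx_linear_continuous => k u v; rewrite linearP.
  - by move=> p [Cp _]; have [+ _] := CE p.1; apply.
apply: (@smooth_cochain_comp _ _ _ j q.+1 _ W _ l (fun i p => append (b p.1) ((tprod (b p.1))^-1 * cinv e p.2)%g i) oO sl) => i.
rewrite /append; case: unliftP => [i' _|_]; first exact: sb.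
apply: group_smoothM => //.
  by apply: group_smoothV => //; apply: group_smooth_prod.
apply: (@group_smooth_chart _ _ _ _ _ _ e (fun p : 'M[R]_(q, n) * 'rV[R]_n => p.2) oO Ae) => //.
  by move=> p; exact: cvg_snd.
by move=> p [].
Qed.

End HomotopyRegularity.

(** * Vanishing of the cohomology groups *)

Lemma cohomology_trivial (R : realType) (n : nat) (G : lieGroupType R n) (W : lcsType R)
    (act : G -> {linear W -> W}) (S : forall r, zmodClosed (cochain G W r)) (r : nat) :
  (forall l, l \in S r -> coboundary act l = 0 -> coboundaries act S l) ->
  [set: cohomology act S r] = [set 0].
Proof.
move=> H; apply/seteqP; split => // z _ /=.
rewrite -[z]reprK; set c := repr z.
have -> : 0 = (\pi_(cohomology act S r) (0 : cocycle act S r))%qT by rewrite piE.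
apply/eqP; rewrite -Quotient.idealrBE subr0; apply/asboolP.
by have /andP[Sc /eqP c0] := valP c; exact: H.
Qed.

Theorem theorem14 (R : realType) (n m : nat)
    (G : lieGroupType R n) (X : manifoldType R m) (V : lcsType R)
    (a : smooth_action G X) (a_proper : proper_action a)
    (M : gmodule G V) (M_diff : differentiable_gmodule M)
    (r : nat) (r_ge1 : (1 <= r)%N) :
  [set: smooth_cohomology (cinf_action a M) r] = [set 0] /\
  [set: continuous_cohomology (cinf_action a M) r] = [set 0].
Proof.
case: r r_ge1 => [//|q] _.
have [I hI] := haar_exists (G := G); have [FF hFF] := haar_net_exists hI.
have hV := has_integrals_quasi_complete hI hFF (gmodule_quasi_complete M_diff).
have [chi [tchi mchi]] := cutoff_exists a_proper hI hFF.
have schi : smooth_fun (atlas X) (chi : X -> R^o) by case: tchi.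
(* The coboundary of the homotopy is (-1)^(q+1) l; the same sign in front of the homotopy squares to
   1. *)
have primitive (l : cochain G (Cinf X V) q.+1) : continuous (l : {ptws 'I_q.+1 -> G} -> Cinf X V) ->
    coboundary (cinf_action a M) l = 0 ->
    l = coboundary (cinf_action a M) (fun b => (-1) ^+ q.+1 *: homotopy a FF schi l b).
  move=> cl l0; apply/funext => b; rewrite coboundaryZ (coboundary_homotopy hI hFF hV schi tchi mchi) //.
    by rewrite scalerA -exprD addnn -signr_odd odd_double scale1r.
  move=> b' g.
  apply: (@cvg_comp _ _ _ (fun g => append b' g : {ptws 'I_q.+1 -> G}) l _ (nbhs (append b' g : {ptws 'I_q.+1 -> G}))); last exact: cl.
  apply: (@ptws_continuous_at R n G G q.+1 (fun g => append b' g) g) => i; rewrite /append.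
  by case: unliftP => [j _|_]; [exact: cvg_cst|exact: cvg_id].
split; apply: cohomology_trivial => l /asboolP sl l0.
- exists (fun b => (-1) ^+ q.+1 *: homotopy a FF schi l b).
    apply/asboolP; have H := smooth_homotopy hI hFF hV schi tchi sl.
    have := smooth_fun_lin ((-1) ^+ q.+1) H (@smooth_fun0 _ _ _ (pow_atlas (atlas G)) (Cinf X V)).
    by congr smooth_fun; apply/funext => b; rewrite addr0.
  by apply: primitive => //; exact: smooth_cochain_continuous.
- exists (fun b => (-1) ^+ q.+1 *: homotopy a FF schi l b).
    apply/asboolP => b; have Fb : Filter (nbhs (b : {ptws 'I_q -> G})) := nbhs_filter _.
    apply: (@scale_cvg R {ptws 'I_q -> G} _ Fb); first exact: cvg_cst.
    exact: (@continuous_homotopy _ _ _ _ _ _ _ _ _ hI hFF hV _ schi tchi _ _ sl b).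
  exact: primitive.
Qed.
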